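(* Let $C$ be a fixed constant, $k$ a nonnegative integer and $1<p<\infty$. Among weights $w$ on $\mathbb{R}$ with $\|(w-1)\langle\lambda\rangle^k\|_{L^1(\mathbb{R})}\le C$, $$\lim_{\|(w-1)\langle\lambda\rangle^k\|_{L^\infty(\mathbb{R})}\to0}\ \sup_{r>0}\|R_{k,r}(\lambda)\|_{L^p(\mathbb{R})}=0 .$$ That is, for every $\eta>0$ there is $\delta>0$ such that every weight $w$ with $\|(w-1)\langle\lambda\rangle^k\|_{L^1(\mathbb{R})}\le C$ and $\|(w-1)\langle\lambda\rangle^k\|_{L^\infty(\mathbb{R})}\le\delta$ satisfies $\sup_{r>0}\|R_{k,r}\|_{L^p(\mathbb{R})}\le\eta$.
   Context: A weight is a measurable function $w\ge0$ on $\mathbb{R}$; $\langle\lambda\rangle=(1+\lambda^2)^{1/2}$; norms are taken in the variable $\lambda$. Krein system and remainder: let $w\ge0$ with $w-1\in L^1(\mathbb{R})+L^2(\mathbb{R})$ and put $H(x)=\frac1{2\pi}\int_{\mathbb{R}}(w(\lambda)-1)e^{i\lambda x}\,d\lambda$. For $r>0$ define $\mathcal{H}_r$ on $L^2([0,r])$ by $\mathcal{H}_rf(x)=\int_0^rH(x-y)f(y)\,dy$; then $I+\mathcal{H}_r>0$ is boundedly invertible, and $I-(I+\mathcal{H}_r)^{-1}$ is an integral operator with kernel $\Gamma_r(s,t)$, $0\le s,t\le r$, satisfying $\Gamma_r(s,t)=\overline{\Gamma_r(t,s)}=\Gamma_r(r-t,r-s)$ and $\Gamma_r(\cdot,0)=(I+\mathcal{H}_r)^{-1}(H|_{[0,r]})$;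 in particular $\Gamma_r(r,t)=\Gamma_r(r-t,0)$. If $\langle\lambda\rangle^k(w-1)\in L^1(\mathbb{R})$ for an integer $k\ge0$, then $H\in C^k(\mathbb{R})$, $\Gamma_r\in C^k([0,r]^2)$, and the remainder is $$R_{k,r}(\lambda)=-i^k\int_0^r\left(\partial_t^k\Gamma_r(r,t)\right)e^{i\lambda t}\,dt .$$ *)

(* Defs.v *)
(* MathComp-Analysis, with complex numbers R[i] over a real type R. *)
From mathcomp Require Export all_boot all_order all_algebra.
From mathcomp Require Export all_classical all_reals all_analysis.
From mathcomp Require Export complex.

Set Implicit Arguments.
Unset Strict Implicit.
Unset Printing Implicit Defensive.

Import Order.TTheory GRing.Theory Num.Theory.
Import numFieldNormedType.Exports.

Local Open Scope classical_set_scope.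
Local Open Scope ring_scope.
Local Open Scope complex_scope.

Section KreinSystem.
Context {R : realType}.

Local Notation mu := (@lebesgue_measure R).

Definition weight (w : R -> R) : Prop :=
  measurable_fun setT w /\ forall x, 0 <= w x.

Definition japanese (x : R) : R := Num.sqrt (1 + x ^+ 2).

Definition weighted_dev (k : nat) (w : R -> R) (x : R) : R :=
  (w x - 1) * japanese x ^+ k.

(* e^{ix} *)
Definition expi (x : R) : R[i] := cos x +i* sin x.

Definition Cintegral (D : set R) (f : R -> R[i]) : R[i] :=
  (\int[mu]_(x in D) complex.Re (f x)) +i* (\int[mu]_(x in D) complex.Im (f x)).

Definition Cderive1n (k : nat) (f : R -> R[i]) (x : R) : R[i] :=
  derive1n k (fun y => complex.Re (f y)) x
    +i* derive1n k (fun y => complex.Im (f y)) x.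

(* The integral converges absolutely as soon as w - 1 is in L^1; for
   w - 1 in L^1 + L^2 it would have to be read in the Plancherel sense. *)
Definition krein_H (w : R -> R) (x : R) : R[i] :=
  ((2 * pi)^-1)%:C * Cintegral setT (fun l => (w l - 1)%:C * expi (l * x)).

Definition L2_on (r : R) (f : R -> R[i]) : Prop :=
  [/\ measurable_fun `[0, r] (fun x => complex.Re (f x)),
      measurable_fun `[0, r] (fun x => complex.Im (f x)) &
      (\int[mu]_(x in `[0%R, r]) ((Normc.normc (f x)) ^+ 2)%:E < +oo)%E].

(* equality of classes in L^2([0, r]) *)
Definition eqae_on (r : R) (f g : R -> R[i]) : Prop :=
  {ae mu, forall x, x \in `[0, r] -> f x = g x}.

Definition int_op (r : R) (K : R -> R -> R[i]) (f : R -> R[i]) (x : R) : R[i] :=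
  Cintegral `[0, r] (fun y => K x y * f y).

Definition krein_op (w : R -> R) (r : R) : (R -> R[i]) -> R -> R[i] :=
  int_op r (fun x y => krein_H w (x - y)).

(* The equivalence says that I + H_r is a bijection of L^2([0, r]) with
   inverse f |-> f - int_op r G f, i.e. that G is an integral kernel of
   I - (I + H_r)^-1. Such a kernel is only determined almost everywhere;
   continuity singles out one representative on the square [0, r]^2. *)
Definition is_krein_kernel (w : R -> R) (r : R) (G : R -> R -> R[i]) : Prop :=
  [/\ {within `[0, r] `*` `[0, r],
         continuous (fun z : R * R => complex.Re (G z.1 z.2))},
      {within `[0, r] `*` `[0, r],
         continuous (fun z : R * R => complex.Im (G z.1 z.2))} &
      forall f g : R -> R[i], L2_on r f -> L2_on r g ->
        (eqae_on r (fun x => g x + krein_op w r g x) f <->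
         eqae_on r g (fun x => f x - int_op r G f x))].

(* Gamma_r; its values outside of [0, r]^2 are unspecified. The default value
   of xget is never used: I + H_r is positive and boundedly invertible, hence
   a kernel exists, for every weight w with w - 1 in L^1 and every r > 0. *)
Definition krein_Gamma (w : R -> R) (r : R) : R -> R -> R[i] :=
  xget (fun _ _ => 0) [set G | is_krein_kernel w r G].

(* The derivative is two-sided, hence meaningful for 0 < t < r only; the two
   endpoints do not contribute to the integral. *)
Definition krein_remainder (w : R -> R) (k : nat) (r : R) (l : R) : R[i] :=
  - ('i%C ^+ k) * Cintegral `[0, r]
      (fun t => Cderive1n k (krein_Gamma w r r) t * expi (l * t)).

End KreinSystem.

(* Main.v *)
(** Write [v = w - 1] and let [P_r] be ([2 pi] times) the projection onto the
    frequencies in [[0, r]], that is [fproj r].  The kernel equation on the row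
    [s = r] says that on [[0, r]] this row is the Fourier transform of
    [h(l) = (2 pi)^-1 v(l) (e^{ilr} - A(l))], where [A = P_r h] is the transform
    of the row itself.  Differentiating under the integral sign, [R_{k,r}] is,
    up to a unimodular factor, [P_r (l^k h)], and [|h|] and [|l^k h|] are both
    at most [u (1 + |A|)] with [u = |v| <l>^k].  Since [P_r] is bounded on [L^s]
    uniformly in [r] (M. Riesz), [||A||_s^s] is at most a constant times
    [||u||_s^s + ||u||_oo^s ||A||_s^s]; for small [||u||_oo] the last term is
    absorbed, and [||u||_s^s <= ||u||_oo^(s-1) ||u||_1] tends to [0].

    The Riesz inequality is only needed for [s = 2m >= p] and for its conjugate
    exponent [s <= p], because [|a|^p] is at most the sum of the two powers.
    For [s = 2m], the Cauchy transform [F] of a compactly supported function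
    satisfies [\int F^(2m) = 0]; the real part of [F^(2m)] is comparable to
    [|F|^(2m)] up to a power of [Re F], and for real data [Re F] is a Poisson
    integral, which Jensen's inequality controls.  Duality gives the conjugate
    exponent. *)

Require Import Defs.
From mathcomp Require Import measurable_realfun ess_sup_inf ring lra.
Import Order.TTheory GRing.Theory Num.Theory.
Import numFieldNormedType.Exports.
Local Open Scope classical_set_scope.
Local Open Scope ring_scope.
Local Open Scope complex_scope.

Set Implicit Arguments.
Unset Strict Implicit.
Unset Printing Implicit Defensive.

(** * Complex-valued integrals *)

Section Normc.
Context {R : realType}.
Implicit Types z w : R[i].
Local Notation Re := complex.Re.
Local Notation Im := complex.Im.
Import Normc.

(** The Riesz inequality is about a singular integral, whereas only absolutely convergent integrals
    are manipulated. Hence a damping [e > 0]: it turns the projection into two convolutions with the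
    bounded kernel [1 / (e - i x)], one of them modulated by the frequency [r]. The constant
    obtained depends neither on [e] nor on [r], so Fatou's lemma removes the damping and the
    supremum over [r] costs nothing. Truncating the data supplies the decay that makes powers of the
    Cauchy transform integrable.

    The resolvent kernel is given by an equivalence between almost everywhere equalities, whereas
    the remainder uses its row at the endpoint [r]. Continuity carries the identity to that row.
    Smoothness is then read off the Fourier representation, whose density has moments up to order
    [k], and the integral equation itself is never differentiated.

    Integrals are absorbed twice, in the duality step and in the fixed-point estimate, and each time
    the absorbed quantity must be finite. Crude bounds depending on [r] or on the kernel serve this
    purpose and do not enter the constants. *)

Lemma normc_ge0 z : 0 <= normc z.
Proof. by case: z => a b; exact: sqrtr_ge0. Qed.

Lemma sqr_normc z : normc z ^+ 2 = Re z ^+ 2 + Im z ^+ 2.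
Proof. by case: z => a b /=; rewrite sqr_sqrtr// addr_ge0 ?sqr_ge0. Qed.

Lemma Re_le_normc z : `|Re z| <= normc z.
Proof.
by case: z => a b /=; rewrite -sqrtr_sqr ler_sqrt ?lerDl ?sqr_ge0 ?addr_ge0 ?sqr_ge0.
Qed.

Lemma Im_le_normc z : `|Im z| <= normc z.
Proof.
by case: z => a b /=; rewrite -sqrtr_sqr ler_sqrt ?lerDr ?sqr_ge0 ?addr_ge0 ?sqr_ge0.
Qed.

Lemma normc_le_ReIm z : normc z <= `|Re z| + `|Im z|.
Proof.
rewrite -(@ler_pXn2r _ 2)// ?nnegrE ?normc_ge0 ?addr_ge0//.
rewrite sqr_normc sqrrD !real_normK ?num_real// lerD2r lerDl.
by rewrite mulrn_wge0// mulr_ge0.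
Qed.

Lemma normcX z n : normc (z ^+ n) = normc z ^+ n.
Proof. by elim: n => [|n IH]; rewrite ?expr0 ?normc1// !exprS normcM IH. Qed.

Lemma normcJ z : normc (conjc z) = normc z.
Proof. by case: z => a b /=; rewrite sqrrN. Qed.

Lemma normcR (a : R) : normc a%:C = `|a|.
Proof. by rewrite /= expr0n/= addr0 sqrtr_sqr. Qed.

Lemma normcB z w : normc (z - w) <= normc z + normc w.
Proof. by rewrite -(normcN w) le_normcD. Qed.

Lemma ReM z w : Re (z * w) = Re z * Re w - Im z * Im w.
Proof. by case: z => a b; case: w => c d. Qed.

Lemma ImM z w : Im (z * w) = Re z * Im w + Im z * Re w.
Proof. by case: z => a b; case: w => c d. Qed.

Lemma eqcP z w : Re z = Re w -> Im z = Im w -> z = w.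
Proof. by case: z => a b; case: w => c d /= -> ->. Qed.

Lemma normc_expi (x : R) : normc (expi x) = 1.
Proof. by rewrite /= cos2Dsin2 sqrtr1. Qed.

Lemma expiD (x y : R) : expi (x + y) = expi x * expi y.
Proof. by apply: eqcP => /=; rewrite ?cosD ?sinD//; ring. Qed.

Lemma conjc_expi (x : R) : conjc (expi x) = expi (- x).
Proof. by apply: eqcP => /=; rewrite ?cosN ?sinN. Qed.

Lemma normc_eq0 z : (normc z == 0) = (z == 0).
Proof. by apply/eqP/eqP => [/eq0_normc//|->]; exact: normc0. Qed.

End Normc.

Section Cmeas.
Context {R : realType} d {T : measurableType d}.
Implicit Types f g : T -> R[i].
Local Notation Re := complex.Re.
Local Notation Im := complex.Im.

Definition Cmeas f := measurable_fun setT (fun x => Re (f x)) /\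
  measurable_fun setT (fun x => Im (f x)).

Lemma Cmeas_cst z : Cmeas (fun=> z).
Proof. by split; exact: measurable_cst. Qed.

Lemma CmeasD f g : Cmeas f -> Cmeas g -> Cmeas (fun x => f x + g x).
Proof.
move=> [f1 f2] [g1 g2]; split; under eq_fun do rewrite raddfD;
  exact: measurable_funD.
Qed.

Lemma CmeasN f : Cmeas f -> Cmeas (fun x => - f x).
Proof.
move=> [f1 f2]; split; under eq_fun do rewrite raddfN;
  exact: measurableT_comp.
Qed.

Lemma CmeasB f g : Cmeas f -> Cmeas g -> Cmeas (fun x => f x - g x).
Proof. by move=> mf mg; apply: CmeasD => //; exact: CmeasN. Qed.

Lemma CmeasM f g : Cmeas f -> Cmeas g -> Cmeas (fun x => f x * g x).
Proof.
move=> [f1 f2] [g1 g2]; split.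
  under eq_fun do rewrite ReM.
  by apply: measurable_funB; exact: measurable_funM.
under eq_fun do rewrite ImM.
by apply: measurable_funD; exact: measurable_funM.
Qed.

Lemma CmeasX f n : Cmeas f -> Cmeas (fun x => f x ^+ n).
Proof.
move=> mf; elim: n => [|n IH]; first exact: Cmeas_cst.
by under eq_fun do rewrite exprS; exact: CmeasM.
Qed.

Lemma CmeasJ f : Cmeas f -> Cmeas (fun x => conjc (f x)).
Proof.
move=> [f1 f2]; split.
  by apply: eq_measurable_fun f1 => x _; case: (f x).
have /(eq_measurable_fun _) : {in setT, (fun x => - Im (f x)) =1 (fun x => Im (conjc (f x)))}.
  by move=> x _; case: (f x).
by apply; exact: measurableT_comp.
Qed.

Lemma CmeasR (f : T -> R) : measurable_fun setT f -> Cmeas (fun x => (f x)%:C).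
Proof. by move=> mf; split => //=; exact: measurable_cst. Qed.

Lemma Cmeas_normc f : Cmeas f -> measurable_fun setT (fun x => Normc.normc (f x)).
Proof.
move=> [f1 f2].
rewrite (_ : (fun _ => _) = (fun x => Num.sqrt (Re (f x) ^+ 2 + Im (f x) ^+ 2))); last first.
  by apply/funext => x; case: (f x).
apply: measurableT_comp; first by apply: continuous_measurable_fun; exact: sqrt_continuous.
by apply: measurable_funD; exact: measurable_funX.
Qed.

Lemma Cmeas_expi (f : T -> R) : measurable_fun setT f -> Cmeas (fun x => expi (f x)).
Proof.
move=> mf; split => /=; apply: measurableT_comp => //;
  apply: continuous_measurable_fun; [exact: continuous_cos|exact: continuous_sin].
Qed.

End Cmeas.

Lemma Cmeas_comp {R : realType} d d' {T : measurableType d} {U : measurableType d'}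
  (f : U -> R[i]) (g : T -> U) : Cmeas f -> measurable_fun setT g ->
  Cmeas (fun x => f (g x)).
Proof.
move=> [f1 f2] mg; split.
  exact: (measurableT_comp (f := fun x => complex.Re (f x))).
exact: (measurableT_comp (f := fun x => complex.Im (f x))).
Qed.

Section Cint.
Context {R : realType}.
Implicit Types f g : R -> R[i].
Local Notation mu := (@lebesgue_measure R).
Local Notation Re := complex.Re.
Local Notation Im := complex.Im.
Local Notation normc := Normc.normc.

Definition rint (f : R -> R) := mu.-integrable setT (EFin \o f).

Definition Cint f := rint (fun x => Re (f x)) /\ rint (fun x => Im (f x)).

Lemma ae_imp (P Q : R -> Prop) : {ae mu, forall x, P x} ->
  (forall x, P x -> Q x) -> {ae mu, forall x, Q x}.
Proof. by move=> aeP PQ; apply: negligibleS aeP => x /= nQ /PQ. Qed.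

Lemma rint_le (f g : R -> R) : measurable_fun setT f -> rint g ->
  (forall x, `|f x| <= g x) -> rint f.
Proof.
move=> mf ig fg; apply: le_integrable ig => //; first exact/measurable_EFinP.
by move=> x _ /=; rewrite lee_fin (le_trans (fg x))// ler_norm.
Qed.

Lemma rint_meas (f : R -> R) : rint f -> measurable_fun setT f.
Proof. by move=> /measurable_int /measurable_EFinP. Qed.

Lemma rintD (f g : R -> R) : rint f -> rint g -> rint (fun x => f x + g x).
Proof. by move=> fi gi; have := integrableD measurableT fi gi. Qed.

Lemma rintZ (a : R) (f : R -> R) : rint f -> rint (fun x => a * f x).
Proof. by move=> fi; have := integrableZl measurableT a fi. Qed.

Lemma rintB (f g : R -> R) : rint f -> rint g -> rint (fun x => f x - g x).
Proof. by move=> fi gi; have := integrableB measurableT fi gi. Qed.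

Lemma rint_norm (f : R -> R) : rint f -> rint (fun x => `|f x|).
Proof. by move=> fi; have := integrable_norm fi. Qed.

Lemma Cint_meas f : Cint f -> Cmeas f.
Proof. by move=> [f1 f2]; split; exact: rint_meas. Qed.

Lemma Cint_le f (g : R -> R) : Cmeas f -> rint g ->
  (forall x, normc (f x) <= g x) -> Cint f.
Proof.
move=> [f1 f2] ig fg; split; apply: (rint_le _ ig) => // x.
  exact: le_trans (Re_le_normc _) (fg x).
exact: le_trans (Im_le_normc _) (fg x).
Qed.

Lemma Cint_normc f : Cint f -> rint (fun x => normc (f x)).
Proof.
move=> [f1 f2].
apply: (@rint_le _ (fun x => `|Re (f x)| + `|Im (f x)|)).
- by apply: Cmeas_normc; split; exact: rint_meas.
- by apply: rintD; exact: rint_norm.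
- by move=> x; rewrite ger0_norm ?normc_ge0// normc_le_ReIm.
Qed.

Lemma CintP f : Cmeas f -> rint (fun x => normc (f x)) -> Cint f.
Proof. by move=> mf nf; apply: (Cint_le mf nf) => x. Qed.

Lemma CintD f g : Cint f -> Cint g -> Cint (fun x => f x + g x).
Proof.
by move=> [f1 f2] [g1 g2]; split; under eq_fun do rewrite raddfD; exact: rintD.
Qed.

Lemma CintZ (a : R[i]) f : Cint f -> Cint (fun x => a * f x).
Proof.
move=> [f1 f2]; split.
  under eq_fun do rewrite ReM.
  by apply: rintB; exact: rintZ.
under eq_fun do rewrite ImM.
by apply: rintD; exact: rintZ.
Qed.

Lemma CintN f : Cint f -> Cint (fun x => - f x).
Proof. by move=> /(CintZ (-1)); under eq_fun do rewrite mulN1r. Qed.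

Lemma CintB f g : Cint f -> Cint g -> Cint (fun x => f x - g x).
Proof. by move=> fi gi; apply: CintD => //; exact: CintN. Qed.

Lemma CintM f g B : Cint f -> Cmeas g -> (forall x, normc (g x) <= B) ->
  Cint (fun x => f x * g x).
Proof.
move=> fi mg gB; apply: (@Cint_le _ (fun x => B * normc (f x))).
- by apply: CmeasM => //; exact: Cint_meas.
- exact/rintZ/Cint_normc.
- by move=> x; rewrite Normc.normcM mulrC ler_wpM2r ?normc_ge0.
Qed.

Lemma CintJ f : Cint f -> Cint (fun x => conjc (f x)).
Proof.
move=> fi; apply: CintP; first exact/CmeasJ/Cint_meas.
by under eq_fun do rewrite normcJ; exact: Cint_normc.
Qed.

Lemma CintegralD f g : Cint f -> Cint g ->
  Cintegral setT (fun x => f x + g x) = Cintegral setT f + Cintegral setT g.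
Proof.
move=> [f1 f2] [g1 g2]; apply: eqcP => /=;
  under eq_Rintegral do rewrite raddfD; exact: RintegralD.
Qed.

Lemma CintegralZ (a : R[i]) f : Cint f ->
  Cintegral setT (fun x => a * f x) = a * Cintegral setT f.
Proof.
move=> [f1 f2]; apply: eqcP => /=.
  under eq_Rintegral do rewrite ReM.
  rewrite RintegralB//; [|exact: rintZ|exact: rintZ].
  by rewrite !RintegralZl//; case: (a).
under eq_Rintegral do rewrite ImM.
rewrite RintegralD//; [|exact: rintZ|exact: rintZ].
by rewrite !RintegralZl//; case: (a).
Qed.

Lemma CintegralZr (a : R[i]) f : Cint f ->
  Cintegral setT (fun x => f x * a) = Cintegral setT f * a.
Proof.
move=> fi; rewrite mulrC -CintegralZ//; congr Cintegral.
by apply/funext => x; rewrite mulrC.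
Qed.

Lemma CintegralN f : Cint f ->
  Cintegral setT (fun x => - f x) = - Cintegral setT f.
Proof.
move=> fi; rewrite -mulN1r -CintegralZ//; congr Cintegral.
by apply/funext => x; rewrite mulN1r.
Qed.

Lemma CintegralB f g : Cint f -> Cint g ->
  Cintegral setT (fun x => f x - g x) = Cintegral setT f - Cintegral setT g.
Proof.
by move=> fi gi; rewrite CintegralD ?CintegralN//; exact: CintN.
Qed.

Lemma Cintegral0 D : Cintegral D (fun _ : R => 0) = 0 :> R[i].
Proof.
by apply: eqcP => /=; rewrite /Rintegral integral0_eq.
Qed.

Lemma CintegralJ f : Cint f ->
  Cintegral setT (fun x => conjc (f x)) = conjc (Cintegral setT f).
Proof.
move=> [f1 f2]; apply: eqcP => /=.
  by apply: eq_Rintegral => x _; case: (f x).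
rewrite -[RHS]mulN1r -RintegralZl//; apply: eq_Rintegral => x _.
by case: (f x) => a b /=; rewrite mulN1r.
Qed.

(** Multiplication by the conjugate of the integral rotates it onto the positive axis, where
    comparing real parts under the integral suffices. *)
Lemma normc_Cintegral f : Cint f ->
  normc (Cintegral setT f) <= \int[mu]_x normc (f x).
Proof.
move=> fi; set z := Cintegral setT f.
have [->|z0] := eqVneq z 0.
  by rewrite Normc.normc0; apply: Rintegral_ge0 => x _; exact: normc_ge0.
have nz0 : 0 < normc z.
  by rewrite lt0r normc_eq0 z0 normc_ge0.
rewrite -(ler_pM2l nz0) -RintegralZl//; last exact: Cint_normc.
rewrite -expr2 sqr_normc.
have [c -> cz] : exists2 c, Re z ^+ 2 + Im z ^+ 2 = Re (c * z) & normc c = normc z.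
  by exists (conjc z); [case: (z) => a b /=; ring|exact: normcJ].
rewrite {1}/z -CintegralZ//; apply: le_Rintegral => //.
- exact: (CintZ c fi).1.
- exact/rintZ/Cint_normc.
- move=> x _; apply: le_trans (ler_norm _) _; apply: le_trans (Re_le_normc _) _.
  by rewrite Normc.normcM cz.
Qed.

Lemma normc_Cintegral_le f (g : R -> R) : Cmeas f -> rint g ->
  (forall x, normc (f x) <= g x) ->
  normc (Cintegral setT f) <= \int[mu]_x g x.
Proof.
move=> mf ig fg; have fi := Cint_le mf ig fg.
apply: le_trans (normc_Cintegral fi) _; apply: le_Rintegral => //.
exact: Cint_normc.
Qed.

Lemma eq_Cintegral D f g : {in D, f =1 g} -> Cintegral D f = Cintegral D g.
Proof.
by move=> fg; apply: eqcP => /=; apply: eq_Rintegral => x xD; rewrite fg.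
Qed.

Lemma ae_eq_Cintegral f g : Cmeas f -> Cmeas g ->
  {ae mu, forall x, f x = g x} -> Cintegral setT f = Cintegral setT g.
Proof.
move=> [f1 f2] [g1 g2] fg; apply: eqcP => /=; congr fine.
  apply: ae_eq_integral => //; [exact/measurable_EFinP|exact/measurable_EFinP|].
  by apply: (ae_imp fg) => x /= -> _.
apply: ae_eq_integral => //; [exact/measurable_EFinP|exact/measurable_EFinP|].
by apply: (ae_imp fg) => x /= -> _.
Qed.

(** Moves integrals over an interval to the whole line, where linearity, conjugation and Fubini are
    available. *)
Lemma Cintegral_indic (D : set R) f :
  Cintegral D f = Cintegral setT (fun x => (\1_D x)%:C * f x).
Proof.
apply: eqcP => /=; rewrite Rintegral_mkcond; apply: eq_Rintegral => x _;
  rewrite patchE indicE; case: (f x) => a b /=; case: (x \in D) => /=;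
  by rewrite ?mul1r ?mul0r ?subr0 ?addr0.
Qed.

End Cint.

(** * Fubini's theorem under a product majorant *)

Section Fubini.
Context {R : realType}.
Local Notation mu := (@lebesgue_measure R).
Local Notation Re := complex.Re.
Local Notation Im := complex.Im.
Local Notation normc := Normc.normc.

Lemma rint_normZ (a : R) (b : R -> R) : rint b -> rint (fun y => `|a| * `|b y|).
Proof. by move=> ib; exact/rintZ/rint_norm. Qed.

(** A majorant in product form makes the Tonelli integral finite at once; all complex kernels
    exchanged below are dominated in this form. *)
Lemma prod_integrable (f : R * R -> R) (a b : R -> R) :
  measurable_fun setT f -> rint a -> rint b ->
  (forall x y, `|f (x, y)| <= `|a x| * `|b y|) ->
  (mu \x mu)%E.-integrable setT (EFin \o f).
Proof.
move=> mf ia ib fab.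
apply/integrable12ltyP; first exact/measurable_EFinP.
have [_ iboo] := integrableP _ _ _ ib.
have [_ iaoo] := integrableP _ _ _ ia.
set B := (\int[mu]_y `|(EFin \o b) y|)%E in iboo.
have B0 : (0 <= B)%E by apply: integral_ge0.
have ma : measurable_fun setT (fun x => `|(EFin \o a) x|)%E.
  by apply: measurableT_comp => //; exact: measurable_int ia.
have mb : measurable_fun setT (fun x => `|(EFin \o b) x|)%E.
  by apply: measurableT_comp => //; exact: measurable_int ib.
apply: (@le_lt_trans _ _ (\int[mu]_x (`|(EFin \o a) x| * B))%E); last first.
  rewrite ge0_integralZr// lte_mul_pinfty// ?integral_ge0// ge0_fin_numE//.
  exact: integral_ge0.
apply: ge0_le_integral => //.
- by move=> x _; apply: integral_ge0.
- apply: (@measurable_fun_fubini_tonelli_F _ _ _ _ R mu (abse \o (EFin \o f))) => [|z]; last exact: abse_ge0.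
  by apply: measurableT_comp => //; exact/measurable_EFinP.
- exact: emeasurable_funM.
- move=> x _; rewrite /B -ge0_integralZl//.
  apply: ge0_le_integral => //.
  + apply: measurableT_comp => //; apply/measurable_EFinP.
    exact: measurableT_comp.
  + exact: emeasurable_funM.
  + by move=> y _ /=; rewrite -EFinM lee_fin.
Qed.

(** The two inner integrals are returned as integrable functions because later computations subtract
    them or change them on null sets. *)
Lemma Rfubini (f : R * R -> R) (a b : R -> R) :
  measurable_fun setT f -> rint a -> rint b ->
  (forall x y, `|f (x, y)| <= `|a x| * `|b y|) ->
  [/\ rint (fun x => \int[mu]_y f (x, y)), rint (fun y => \int[mu]_x f (x, y)) &
  \int[mu]_x \int[mu]_y f (x, y) = \int[mu]_y \int[mu]_x f (x, y)].
Proof.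
move=> mf ia ib fab.
have fi := prod_integrable mf ia ib fab.
have fx x : rint (fun y => f (x, y)).
  apply: (rint_le _ (rint_normZ (a x) ib)); last exact: fab.
  exact: measurableT_comp.
have fy y : rint (fun x => f (x, y)).
  apply: (rint_le _ (rint_normZ (b y) ia)).
    exact: measurableT_comp.
  by move=> x; rewrite mulrC; exact: fab.
have E1 : EFin \o (fun x => \int[mu]_y f (x, y)) = fun x => (\int[mu]_y (f (x, y))%:E)%E.
  by apply/funext => x /=; rewrite fineK//; exact: integrable_fin_num (fx x).
have E2 : EFin \o (fun y => \int[mu]_x f (x, y)) = fun y => (\int[mu]_x (f (x, y))%:E)%E.
  by apply/funext => y /=; rewrite fineK//; exact: integrable_fin_num (fy y).
split.
- by rewrite /rint E1; exact: (integrable_fubini_F fi).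
- rewrite /rint E2.
  apply/integrableP; split; first exact: (measurable_fubini_G fi).
  have mEf : measurable_fun setT (EFin \o f) by exact/measurable_EFinP.
  have oo := (@integrable21ltyP _ _ _ _ R mu mu _ mEf).1 fi.
  apply: le_lt_trans oo; apply: ge0_le_integral => //.
  + by apply: measurableT_comp => //; exact: (measurable_fubini_G fi).

  + apply: (@measurable_fun_fubini_tonelli_G _ _ _ _ R mu (abse \o (EFin \o f))) => [|z]; last exact: abse_ge0.
    by apply: measurableT_comp => //; exact/measurable_EFinP.
  + move=> y _; apply: le_abse_integral => //; exact: measurable_int (fy y).
- rewrite {1 3}/Rintegral; congr fine.
  have := Fubini fi => /=; under eq_integral do rewrite -/(_ _).
  by rewrite -[X in (\int[mu]_x X x)%E = _]E1 -[X in _ = (\int[mu]_x X x)%E]E2.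
Qed.

Lemma Cfubini (F : R * R -> R[i]) (a b : R -> R) :
  Cmeas F -> rint a -> rint b ->
  (forall x y, normc (F (x, y)) <= `|a x| * `|b y|) ->
  [/\ Cint (fun x => Cintegral setT (fun y => F (x, y))),
  Cint (fun y => Cintegral setT (fun x => F (x, y))) &
  Cintegral setT (fun x => Cintegral setT (fun y => F (x, y))) =
  Cintegral setT (fun y => Cintegral setT (fun x => F (x, y)))].
Proof.
move=> [m1 m2] ia ib Fab.
have [r1 r2 r3] := Rfubini m1 ia ib (fun x y => le_trans (Re_le_normc _) (Fab x y)).
have [i1 i2 i3] := Rfubini m2 ia ib (fun x y => le_trans (Im_le_normc _) (Fab x y)).
split; [exact: conj r1 i1|exact: conj r2 i2|].
by apply: eqcP; [exact: r3|exact: i3].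
Qed.

End Fubini.

(** * Integrals depending on a parameter *)

Section Param.
Context {R : realType}.
Local Notation mu := (@lebesgue_measure R).
Local Notation Re := complex.Re.
Local Notation Im := complex.Im.
Local Notation normc := Normc.normc.

(** Tonelli's measurability applies separately to the positive and negative parts, whether or not
    the slices are integrable, and [fine] preserves measurability. *)
Lemma Rmeas_int (f : R * R -> R) : measurable_fun setT f ->
  measurable_fun setT (fun x => \int[mu]_y f (x, y)).
Proof.
move=> mf; apply: (measurableT_comp (@fine_measurable R setT measurableT)).
have mE : measurable_fun setT (EFin \o f) by exact/measurable_EFinP.
rewrite (_ : (fun x => _) = (fun x => \int[mu]_y ((EFin \o f)^\+ (x, y)) -
   \int[mu]_y ((EFin \o f)^\- (x, y)))%E); last first.
  apply/funext=> x; rewrite [LHS]integralE.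
  by congr (_ - _)%E; apply: eq_integral => y _; rewrite ?funeposE ?funenegE.
apply: emeasurable_funB.
  apply: (@measurable_fun_fubini_tonelli_F _ _ _ _ R mu ((EFin \o f)^\+)%E) => [|z].
    exact: measurable_funepos.
  exact: funepos_ge0.
apply: (@measurable_fun_fubini_tonelli_F _ _ _ _ R mu ((EFin \o f)^\-)%E) => [|z].
  exact: measurable_funeneg.
exact: funeneg_ge0.
Qed.

Lemma Cmeas_int (F : R * R -> R[i]) : Cmeas F ->
  Cmeas (fun x => Cintegral setT (fun y => F (x, y))).
Proof. by move=> [m1 m2]; split; [exact: (Rmeas_int m1)|exact: (Rmeas_int m2)]. Qed.

Lemma Rint_dct (f_ : nat -> R -> R) (f g : R -> R) :
  (forall n, measurable_fun setT (f_ n)) -> measurable_fun setT f -> rint g ->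
  (forall x, f_ ^~ x @ \oo --> f x) -> (forall n x, `|f_ n x| <= g x) ->
  (fun n => \int[mu]_x f_ n x) @ \oo --> \int[mu]_x f x.
Proof.
move=> mf_ mf ig fcv fg.
have fi : rint f.
  apply: (rint_le mf ig) => x.
  rewrite -(cvg_lim _ (cvg_norm (fcv x)))//.
  apply: limr_le; first by apply: is_cvg_norm; apply/cvg_ex; exists (f x); exact: fcv.
  by near=> n; exact: fg.
apply: fine_cvg; rewrite fineK; last exact: integrable_fin_num fi.
apply: (@dominated_cvg _ _ _ mu setT measurableT (fun n x => (f_ n x)%:E) (EFin \o f) (EFin \o g)) => //=.
- by move=> n; apply/measurable_EFinP; exact: mf_.
- by move=> x _; apply: cvg_EFin; [exact: nearW|exact: fcv].
- by move=> n x _; rewrite lee_fin.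
Unshelve. all: by end_near. Qed.

Lemma Rint_continuous (f : R -> R -> R) (g : R -> R) :
  (forall x, measurable_fun setT (f x)) -> rint g ->
  (forall y, continuous (f ^~ y)) -> (forall x y, `|f x y| <= g y) ->
  continuous (fun x => \int[mu]_y f x y).
Proof.
move=> mf ig fc fg x.
apply: (@continuity_under_integral R _ _ mu f setT measurableT (x - 1) (x + 1) _ _ g) => //.
- by move=> z _; exact: rint_le (mf z) ig (fg z).
- by apply: aeW => y _ z _; exact: fc.
- by move=> z _; apply: aeW.
- by rewrite inE/= in_itv/=; apply/andP; split; lra.
Qed.

Lemma Rint_derive (f f' : R -> R -> R) (g : R -> R) :
  (forall x, rint (f x)) -> rint g ->
  (forall x y : R, is_derive x 1 (f ^~ y) (f' x y)) ->
  (forall x y, `|f' x y| <= g y) ->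
  forall x : R, is_derive x 1 (fun x => \int[mu]_y f x y) (\int[mu]_y f' x y).
Proof.
move=> fi ig fd fg a.
have D x y : partial1of2 f x y = f' x y.
  by rewrite partial1of2E; apply: derive_val.
have aI : `](a - 1), (a + 1)[%classic a.
  by rewrite /= in_itv/=; apply/andP; split; lra.
have g0 y : 0 <= g y by exact: le_trans (fg a y).
have I1 x : `](a - 1), (a + 1)[%classic x -> mu.-integrable setT (EFin \o f x).
  by move=> _; exact: fi.
have I2 x y : `](a - 1), (a + 1)[%classic x -> [set: R] y -> derivable (f ^~ y) x 1.
  by move=> _ _; exact: ex_derive.
have I3 x y : `](a - 1), (a + 1)[%classic x -> [set: R] y -> `|partial1of2 f x y| <= g y.
  by move=> _ _; rewrite D.
have dF := derivable_under_integral measurableT aI I1 I2 g0 ig I3.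
apply: DeriveDef => //.
rewrite -derive1E (differentiation_under_integral measurableT aI I1 I2 g0 ig I3).
by apply: eq_Rintegral => y _; rewrite D.
Qed.

End Param.

(** * Integrals over the line computed from primitives *)

Section LineFTC.
Context {R : realType}.
Local Notation mu := (@lebesgue_measure R).

Local Notation sym n := `[(- n%:R : R)%R, n%:R]%classic.

(** Uniform bounds pass to the limit without a majorant. This removes the exhaustion of the line,
    the damping, and the truncation of data and test functions. *)
Lemma fatou_le (f_ : nat -> R -> R) (f : R -> R) (B : \bar R) :
  (forall n, measurable_fun setT (f_ n)) -> (forall n x, 0 <= f_ n x) ->
  (forall x, f_ ^~ x @ \oo --> f x) ->
  (forall n, (\int[mu]_x (f_ n x)%:E <= B)%E) ->
  (\int[mu]_x (f x)%:E <= B)%E.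
Proof.
move=> mf f0 fcv E.
have -> : (\int[mu]_x (f x)%:E = \int[mu]_x limn_einf (fun n => (f_ n x)%:E))%E.
  apply: eq_integral => x _; apply/esym.
  have cE : (f_ n x)%:E @[n --> \oo] --> (f x)%:E.
    by apply: cvg_EFin; [exact: nearW|exact: fcv].
  by have [-> _] := cvg_limn_einf_sup cE.
apply: (@le_trans _ _ (limn_einf (fun n => \int[mu]_x (f_ n x)%:E)%E)).
  apply: fatou => //; first by move=> n; apply/measurable_EFinP; exact: mf.
  by move=> n x _; rewrite lee_fin.
rewrite limn_einf_lim; apply: lime_le; first exact: is_cvg_einfs.
apply: nearW => n; apply: le_trans (E n); apply: ereal_inf_lbound.
by exists n => //=.
Qed.

Lemma FTC_segment (f F : R -> R) (a b : R) : a < b -> continuous f ->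
  (forall x : R, is_derive x 1 F (f x)) ->
  (\int[mu]_(x in `[a, b]) (f x)%:E = (F b - F a)%:E)%E.
Proof.
move=> ab cf dF.
have cF : continuous F.
  by move=> x; apply/differentiable_continuous/derivable1_diffP/ex_derive; exact: dF.
rewrite (@continuous_FTC2 _ f F)//.
- by apply: continuous_subspaceT => x; exact: cf.
- split.
  + by move=> x _; apply: ex_derive; exact: dF.
  + by apply: cvg_at_right_filter; exact: cF.
  + by apply: cvg_at_left_filter; exact: cF.
- by move=> x _; rewrite derive1E; apply: derive_val.
Qed.

(** The index [n.+1] keeps every window nondegenerate, as [FTC_segment] requires. *)
Lemma cvg_indic_sym (f : R -> R) (x : R) :
  (fun n => f x * \1_(sym n.+1) x) @ \oo --> f x.
Proof.
have [N /ltW xN] : exists N : nat, `|x| < N%:R by exists (Num.truncn `|x|).+1; exact: truncnS_gt.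
apply: cvg_near_cst; near=> n.
rewrite indicE mem_set ?mulr1//= in_itv/= -ler_norml.
rewrite (le_trans xN)// ler_nat ltnW// ltnS.
near: n; exact: nbhs_infty_ge.
Unshelve. all: by end_near. Qed.

Lemma Rint_sym (f : R -> R) n : (\int[mu]_(x in sym n) (f x)%:E =
  \int[mu]_x (f x * \1_(sym n) x)%:E)%E.
Proof.
rewrite integral_mkcond; apply: eq_integral => x _.
by rewrite patchE indicE; case: (x \in _); rewrite ?mulr1 ?mulr0.
Qed.

(** For a nonnegative integrand, bounded increments of the primitive already give integrability. A
    sign-changing integrand must be known to be integrable first, which is the case treated by
    [Rint_FTC]. *)
Lemma rint_FTC (f F : R -> R) (B : R) : continuous f -> (forall x, 0 <= f x) ->
  (forall x : R, is_derive x 1 F (f x)) ->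
  (forall n, F n.+1%:R - F (- n.+1%:R) <= B) ->
  rint f /\ \int[mu]_x f x <= B.
Proof.
move=> cf f0 dF FB.
have mf : measurable_fun setT f by exact: continuous_measurable_fun.
have mfn n : measurable_fun setT (fun x => f x * \1_(sym n.+1) x).
  by apply: measurable_funM => //; exact: measurable_indic.
have E n : (\int[mu]_x (f x * \1_(sym n.+1) x)%:E <= B%:E)%E.
  rewrite -Rint_sym (FTC_segment _ cf dF) ?lee_fin//.
  by rewrite (@lt_le_trans _ _ 0)// oppr_lt0.
have le : (\int[mu]_x (f x)%:E <= B%:E)%E.
  apply: (fatou_le mfn) E => [n x|x]; last exact: cvg_indic_sym.
  by rewrite mulr_ge0// indicE.
have fi : rint f.
  apply/integrableP; split; first exact/measurable_EFinP.
  under eq_integral do rewrite /= ger0_norm//.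
  by rewrite (le_lt_trans le)// ltry.
split => //.
by rewrite -lee_fin /Rintegral fineK//; exact: integrable_fin_num fi.
Qed.

Lemma Rint_FTC (f F : R -> R) (L : R) : continuous f -> rint f ->
  (forall x : R, is_derive x 1 F (f x)) ->
  (fun n => F n.+1%:R - F (- n.+1%:R)) @ \oo --> L ->
  \int[mu]_x f x = L.
Proof.
move=> cf fi dF FL.
have mf : measurable_fun setT f by exact: continuous_measurable_fun.
have : (fun n => \int[mu]_x (f x * \1_(sym n.+1) x)) @ \oo --> \int[mu]_x f x.
  apply: (Rint_dct _ mf (rint_norm fi)) => [n|x|n x].
  - by apply: measurable_funM => //; exact: measurable_indic.
  - exact: cvg_indic_sym.
  - by rewrite normrM indicE; case: (x \in _); rewrite ?normr1 ?mulr1// normr0 mulr0.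
rewrite (_ : (fun n => _) = (fun n => F n.+1%:R - F (- n.+1%:R))).
  by move=> /cvg_lim <-//; apply/cvg_lim.
apply/funext => n; rewrite /Rintegral -Rint_sym (FTC_segment _ cf dF)//.
by rewrite (@lt_le_trans _ _ 0)// oppr_lt0.
Qed.

End LineFTC.

(** * The Cauchy transform *)

Section CauchyKernel.
Context {R : realType}.
Local Notation mu := (@lebesgue_measure R).
Local Notation Re := complex.Re.
Local Notation Im := complex.Im.
Local Notation normc := Normc.normc.

Variable e : R.
Hypothesis e0 : 0 < e.

Definition quad (x : R) : R := e ^+ 2 + x ^+ 2.

(* [1 / (e - i x)] *)
Definition ckern (x : R) : R[i] := (e / quad x) +i* (x / quad x).

Lemma quad_gt0 x : 0 < quad x.
Proof. by rewrite /quad ltr_wpDr ?sqr_ge0// exprn_gt0. Qed.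

Lemma quad_neq0 x : quad x != 0.
Proof. by rewrite gt_eqF// quad_gt0. Qed.

Lemma sqr_normc_ckern x : normc (ckern x) ^+ 2 = (quad x)^-1.
Proof.
rewrite sqr_normc /=; have := quad_neq0 x; rewrite {2 3 4}/quad => q0.
have E : (e / quad x) ^+ 2 + (x / quad x) ^+ 2 = quad x / quad x ^+ 2.
  by rewrite /quad; field.
by rewrite -/(quad x) E; field; exact: quad_neq0.
Qed.

Lemma ckernE x : ckern x * (e +i* (- x)) = 1.
Proof.
by apply: eqcP => /=; have := quad_neq0 x; rewrite /quad => q0; field.
Qed.

Lemma normc_ckern_le x : normc (ckern x) <= e^-1.
Proof.
rewrite -(@ler_pXn2r _ 2)// ?nnegrE ?normc_ge0 ?invr_ge0 ?(ltW e0)//.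
by rewrite sqr_normc_ckern exprVn lef_pV2 ?posrE ?quad_gt0 ?exprn_gt0// lerDl sqr_ge0.
Qed.

Lemma continuous_quad : continuous quad.
Proof. by move=> x; apply: cvgD; [exact: cvg_cst|exact: exprn_continuous]. Qed.

Lemma measurable_quadV : measurable_fun setT (fun x => (quad x)^-1).
Proof.
apply: continuous_measurable_fun => x; apply: cvgV; first exact: quad_neq0.
exact: continuous_quad.
Qed.

Lemma Cmeas_ckern : Cmeas ckern.
Proof.
by split => /=; apply: measurable_funM => //; exact: measurable_quadV.
Qed.

(** Partial fractions: the two denominators differ by the constant [0 +i* (z - w)]. *)
Lemma ckern_mul x w z : w != z ->
  ckern (x - w) * ckern (x - z) =
  (0 +i* (z - w))^-1 * (ckern (x - w) - ckern (x - z)).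
Proof.
move=> wz; have zw0 : (0 +i* (z - w)) != 0 :> R[i].
  by rewrite eq_complex /= eqxx/= subr_eq0 eq_sym.
apply: (mulfI zw0); rewrite [RHS]mulrA mulfV// mul1r.
have A := ckernE (x - w); have B := ckernE (x - z).
set a := ckern (x - w) in A *; set b := ckern (x - z) in B *.
have -> : 0 +i* (z - w) = (e +i* - (x - z)) - (e +i* - (x - w)).
  by apply: eqcP => /=; ring.
transitivity (a * (b * (e +i* - (x - z))) - b * (a * (e +i* - (x - w)))).
  by ring.
by rewrite A B !mulr1.
Qed.

Lemma is_derive_atan_quad (w x : R) :
  is_derive x 1 (fun x => e^-1 * atan ((x - w) / e)) (quad (x - w))^-1.
Proof.
have en0 : e != 0 by rewrite gt_eqF.
have D : is_derive x 1 (fun x : R => (x - w) / e) e^-1.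
  by apply: is_derive_eq; rewrite scaler0 add0r subr0 /GRing.scale/= mulr1.
have D2 := @is_derive1_comp _ (@atan R) _ x _ _ (is_derive1_atan _) D.
have D3 := is_deriveM (is_derive_cst e^-1 x 1) D2.
apply: (is_derive_eq D3); rewrite scaler0 addr0 /GRing.scale/= /cst/=.
have := quad_neq0 (x - w); rewrite /quad => q0; field.
by rewrite en0 q0.
Qed.

Lemma is_derive_ln_quad (w x : R) :
  is_derive x 1 (fun x => ln (quad (x - w))) (2 * (x - w) / quad (x - w)).
Proof.
have D1 : is_derive x 1 (fun x : R => x - w) 1.
  by apply: is_derive_eq; rewrite subr0.
have D0 := is_deriveX 2 D1.
have D : is_derive x 1 (fun x : R => quad (x - w)) (2 * (x - w)).
  have D3 := is_deriveD (is_derive_cst (e ^+ 2) x 1) D0.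
  apply: (is_derive_eq D3).
  by rewrite /= expr1 /GRing.scale/= mulr1 add0r.
have D2 := @is_derive1_comp _ (@ln R) _ x _ _ (is_derive1_ln (quad_gt0 (x - w))) D.
by apply: (is_derive_eq D2); rewrite mulrC.
Qed.
Lemma continuous_quadVB (w : R) : continuous (fun x => (quad (x - w))^-1).
Proof.
move=> x; apply: cvgV; first exact: quad_neq0.
apply: (@continuous_comp _ _ _ (fun x => x - w) quad); last exact: continuous_quad.
by apply: cvgB; [exact: cvg_id|exact: cvg_cst].
Qed.

Lemma rint_quadV (w : R) : rint (fun x => (quad (x - w))^-1) /\
  \int[mu]_x (quad (x - w))^-1 <= pi / e.
Proof.
have f0 x : 0 <= (quad (x - w))^-1 by rewrite invr_ge0 ltW// quad_gt0.
apply: (rint_FTC (@continuous_quadVB w) f0 (is_derive_atan_quad w)).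
move=> n; rewrite -mulrBr mulrC ler_pM2r ?invr_gt0//.
have := atan_ltpi2 ((n.+1%:R - w) / e).
have := atan_gtNpi2 ((- n.+1%:R - w) / e).
lra.
Qed.

Lemma cvg_shifty (a : R) : (fun n : nat => n.+1%:R + a) @ \oo --> +oo.
Proof.
apply/cvgryPge => A; near=> n.
have : A - a <= n.+1%:R.
  have /le_trans : A - a <= (Num.truncn `|A - a|).+1%:R.
    by rewrite (le_trans (ler_norm _))// ltW// truncnS_gt.
  by apply; rewrite ler_nat ltnS; near: n; exact: nbhs_infty_ge.
lra.
Unshelve. all: by end_near. Qed.

Lemma cvg_shiftV (a : R) : (fun n : nat => (n.+1%:R + a)^-1) @ \oo --> (0 : R).
Proof.
apply/(@gtr0_cvgV0 _ _ _ _ (fun n : nat => n.+1%:R + a)); last exact: cvg_shifty.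
by have /cvgryPgt := cvg_shifty a; apply.
Qed.

(** The inequality [ln u - ln v <= (u - v) / v] is used in both directions: [quad] grows
    quadratically, the difference of two of its translates only linearly. These are the boundary
    terms of [Cintegral_ckern_mul], where each logarithm alone diverges. *)
Lemma cvg_ln_quadB (a b : R) :
  (fun n : nat => ln (quad (n.+1%:R + a)) - ln (quad (n.+1%:R + b))) @ \oo --> (0 : R).
Proof.
have ln_le (u v : R) : 0 < u -> 0 < v -> ln u - ln v <= (u - v) / v.
  move=> u0 v0; rewrite -ln_div ?posrE// mulrBl divff ?gt_eqF// -[X in ln X](subrK 1) addrC.
  by apply: le_ln1Dx; rewrite ltrBrDl addrN divr_gt0.
have key (a' b' : R) : exists K : R, \forall n \near \oo,
    `|(quad (n.+1%:R + a') - quad (n.+1%:R + b')) / quad (n.+1%:R + b')| <= K / (n.+1%:R + b').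
  (* With [t = n.+1%:R + b'], the difference of the two quadratics factors as
     [(a' - b') (2 t + (a' - b'))]; for [t >= 1] this is at most the chosen constant times [t] in
     absolute value. *)
  exists (`|a' - b'| * (2 + `|a' - b'|)); near=> n.
  have t1 : 1 <= n.+1%:R + b' by near: n; have /cvgryPge := cvg_shifty b'; apply.
  set t := n.+1%:R + b' in t1 *.
  have -> : quad (n.+1%:R + a') - quad t = (a' - b') * (2 * t + (a' - b')).
    by rewrite /quad /t; ring.
  have t0 : 0 < t by lra.
  rewrite !normrM -!mulrA ler_wpM2l//.
  rewrite normfV (gtr0_norm (quad_gt0 _)) ler_pdivrMr ?quad_gt0//.
  apply: (@le_trans _ _ ((2 + `|a' - b'|) * t)).
    rewrite (le_trans (ler_normD _ _))// normrM (gtr0_norm t0) (gtr0_norm (ltr0Sn _ 1)).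
    by rewrite [leRHS]mulrDl lerD2l ler_peMr.
  rewrite -mulrA ler_wpM2l ?addr_ge0//.
  by rewrite /quad mulrDr expr2 mulKf ?gt_eqF// lerDr mulr_ge0 ?sqr_ge0// invr_ge0 ltW.
have [K1 h1] := key a b; have [K2 h2] := key b a.
apply: (@squeeze_cvgr _ _ _ _ (fun n => - (K2 / (n.+1%:R + a))) (fun n => K1 / (n.+1%:R + b))).
- near=> n; apply/andP; split.
    rewrite lerNl opprB; apply: (le_trans (ln_le _ _ (quad_gt0 _) (quad_gt0 _))).
    by apply: (le_trans (ler_norm _)); near: n.
  apply: (le_trans (ln_le _ _ (quad_gt0 _) (quad_gt0 _))).
  by apply: (le_trans (ler_norm _)); near: n.
- rewrite -oppr0 -[X in _ --> - X](mulr0 K2); apply: cvgN; apply: cvgM; first exact: cvg_cst.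
  exact: cvg_shiftV.
- rewrite -[X in _ --> X](mulr0 K1); apply: cvgM; first exact: cvg_cst.
  exact: cvg_shiftV.
Unshelve. all: by end_near. Qed.

Lemma Rint_quadV (w : R) : \int[mu]_x (quad (x - w))^-1 = pi / e.
Proof.
have lim a : (fun n : nat => atan ((n.+1%:R + a) / e)) @ \oo --> pi / 2.
  apply: (@cvg_comp _ _ _ (fun n : nat => (n.+1%:R + a) / e) (@atan R) _ +oo _ _ (@cvgy_atan R)).
  apply/cvgryPge => A; near=> n.
  rewrite ler_pdivlMr//; near: n.
  by have /cvgryPge := cvg_shifty a; apply.
apply: (Rint_FTC (@continuous_quadVB w) (rint_quadV w).1 (is_derive_atan_quad w)).
have -> : (fun n => e^-1 * atan ((n.+1%:R - w) / e) - e^-1 * atan ((- n.+1%:R - w) / e)) =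
  (fun n => e^-1 * (atan ((n.+1%:R - w) / e) + atan ((n.+1%:R + w) / e))).
  apply/funext => n; rewrite -[- _ - _]opprD mulNr atanN; ring.
rewrite mulrC; apply: cvgM; first exact: cvg_cst.
have H := cvgD (lim (- w)) (lim w).
rewrite [pi in _ --> pi]splitr; exact: H.
Unshelve. all: by end_near. Qed.

Lemma ckern_mul_norm (x w z : R) : normc (ckern (x - w) * ckern (x - z)) <=
  (quad (x - w))^-1 + (quad (x - z))^-1.
Proof.
rewrite Normc.normcM -!sqr_normc_ckern.
set a := normc _; set b := normc _.
have : 0 <= (a - b) ^+ 2 + a ^+ 2 + b ^+ 2 by rewrite !addr_ge0 ?sqr_ge0.
rewrite sqrrB; have : 0 <= a * b by rewrite mulr_ge0 ?normc_ge0.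
lra.
Qed.

Lemma rint_quadV2 (w z : R) : rint (fun x => (quad (x - w))^-1 + (quad (x - z))^-1).
Proof. by apply: rintD; apply: (rint_quadV _).1. Qed.

Lemma Cmeas_ckernB (w : R) : Cmeas (fun x : R => ckern (x - w)).
Proof. by apply: (Cmeas_comp Cmeas_ckern); exact: measurable_funB. Qed.

Lemma Cint_ckern_mul (w z : R) : Cint (fun x => ckern (x - w) * ckern (x - z)).
Proof.
apply: (Cint_le _ (rint_quadV2 w z)); last by move=> x; exact: ckern_mul_norm.
by apply: CmeasM; exact: Cmeas_ckernB.
Qed.

(** Both poles lie in the lower half-plane. On the real line this appears as follows: after partial
    fractions the imaginary part is a difference of two translates with the same mass [pi / e], and
    the real part has a difference of logarithms as primitive. The two halves of the real part are
    not integrable separately, so the primitive is taken of their difference. *)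
Lemma Cintegral_ckern_mul (w z : R) : w != z ->
  Cintegral setT (fun x => ckern (x - w) * ckern (x - z)) = 0.
Proof.
move=> wz; have zw : z - w != 0 by rewrite subr_eq0 eq_sym.
have E x : ckern (x - w) * ckern (x - z) =
    ((2 * (z - w))^-1 * (2 * (x - w) / quad (x - w) - 2 * (x - z) / quad (x - z))) +i*
    (- e / (z - w) * ((quad (x - w))^-1 - (quad (x - z))^-1)).
  rewrite ckern_mul//.
  have -> : (0 +i* (z - w))^-1 = 0 +i* (- (z - w)^-1).
    apply: (mulfI (x := 0 +i* (z - w))).
      by rewrite eq_complex /= eqxx/=.
    rewrite mulfV; last by rewrite eq_complex /= eqxx/=.
    by apply: eqcP => /=; field.
  by apply: eqcP => /=; rewrite !mul0r; field; rewrite ?zw ?quad_neq0.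
have := Cint_ckern_mul w z; rewrite (funext E) => -[f1 _].
apply: eqcP => /=.
  apply: (@Rint_FTC _ _ (fun x => (2 * (z - w))^-1 * (ln (quad (x - w)) - ln (quad (x - z))))).
  - move=> x; apply: cvgM; first exact: cvg_cst.
    apply: cvgB; apply: cvgM; try exact: continuous_quadVB.
      by apply: cvgM; [exact: cvg_cst|apply: cvgB; [exact: cvg_id|exact: cvg_cst]].
    by apply: cvgM; [exact: cvg_cst|apply: cvgB; [exact: cvg_id|exact: cvg_cst]].
  - exact: f1.
  - move=> x; have D := is_deriveM (is_derive_cst (2 * (z - w))^-1 x 1)
      (is_deriveB (is_derive_ln_quad w x) (is_derive_ln_quad z x)).
    by apply: (is_derive_eq D); rewrite scaler0 addr0.
  - have q a n : quad (- n.+1%:R - a) = quad (n.+1%:R + a) by rewrite /quad -opprD sqrrN.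
    rewrite [X in X @ _ --> _](_ : _ = (fun n => (2 * (z - w))^-1 *
       ((ln (quad (n.+1%:R - w)) - ln (quad (n.+1%:R - z))) -
        (ln (quad (n.+1%:R + w)) - ln (quad (n.+1%:R + z)))))); last first.
      by apply/funext => n; rewrite !q -mulrBr.
    have -> : 0 = (2 * (z - w))^-1 * (0 - 0) by rewrite subr0 mulr0.
    apply: cvgM; first exact: cvg_cst.
    by apply: cvgB; exact: cvg_ln_quadB.
rewrite RintegralZl//; last first.
  by apply: rintB; apply: (rint_quadV _).1.
rewrite RintegralB//; [|exact: (rint_quadV _).1|exact: (rint_quadV _).1].
by rewrite !Rint_quadV subrr mulr0.
Qed.

End CauchyKernel.

(** * Powers of Cauchy transforms of compactly supported data *)

Section CauchyTransform.
Context {R : realType}.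
Local Notation mu := (@lebesgue_measure R).
Local Notation Re := complex.Re.
Local Notation Im := complex.Im.
Local Notation normc := Normc.normc.

Lemma ae_neq (w z : R) : {ae mu, forall y : R, y != w /\ y != z}.
Proof.
have n1 a : mu.-negligible [set a].
  by apply/negligibleP => //; exact: lebesgue_measure_set1.
apply: negligibleS (negligibleU (n1 w) (n1 z)) => y /= h.
have [->|yw] := eqVneq y w; first by left.
have [->|yz] := eqVneq y z; first by right.
by exfalso; apply: h.
Qed.

(** Partial fractions exclude the points where two shifts of the kernel coincide; there are at most
    two, and they form a null set. *)
Lemma Cintegral_ae0 (f : R -> R[i]) (w z : R) : Cmeas f ->
  (forall y, y != w -> y != z -> f y = 0) -> Cintegral setT f = 0.
Proof.
move=> mf f0; rewrite -(Cintegral0 setT); apply: ae_eq_Cintegral => //.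
by apply: (ae_imp (ae_neq w z)) => y [yw yz]; exact: f0.
Qed.

Lemma Cmeas_fst (f : R -> R[i]) : Cmeas f -> Cmeas (fun p : R * R => f p.1).
Proof. by move=> mf; apply: (Cmeas_comp mf); exact: measurable_fst. Qed.

Lemma Cmeas_snd (f : R -> R[i]) : Cmeas f -> Cmeas (fun p : R * R => f p.2).
Proof. by move=> mf; apply: (Cmeas_comp mf); exact: measurable_snd. Qed.

Lemma quadV_ge0 (e x : R) : 0 <= (quad e x)^-1.
Proof. by rewrite invr_ge0 /quad addr_ge0// sqr_ge0. Qed.

(** Since [ckern e (x - y)] is [i / ((x + i e) - y)], this is, up to a constant, the Cauchy integral
    of [h] along the horizontal line at height [e]: the trace of a function analytic in the upper
    half-plane. *)
Definition cauchyT (e : R) (h : R -> R[i]) (x : R) : R[i] :=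
  Cintegral setT (fun y => h y * ckern e (x - y)).

Lemma Cmeas_cauchy_integrand (e : R) (h : R -> R[i]) : 0 < e -> Cmeas h ->
  Cmeas (fun z : R * R => h z.2 * ckern e (z.1 - z.2)).
Proof.
move=> e0 mh; apply: CmeasM.
  exact: Cmeas_snd.
apply: (Cmeas_comp (Cmeas_ckern e0)); apply: measurable_funB.
  exact: measurable_fst.
exact: measurable_snd.
Qed.

Lemma Cmeas_cauchyT (e : R) (h : R -> R[i]) : 0 < e -> Cmeas h -> Cmeas (cauchyT e h).
Proof. by move=> e0 mh; exact: (Cmeas_int (Cmeas_cauchy_integrand e0 mh)). Qed.

Section compact_support.
Variables (e : R) (h : R -> R[i]) (A : R).
Hypothesis e0 : 0 < e.
Hypothesis ih : Cint h.
Hypothesis hA : forall x, A < `|x| -> h x = 0.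

Let F := cauchyT e h.
Let N := \int[mu]_x normc (h x).
Let K := 2 + 2 * A ^+ 2 / e ^+ 2.

Let mh : Cmeas h. Proof. exact: Cint_meas. Qed.
Let mF : Cmeas F. Proof. exact: Cmeas_cauchyT. Qed.
Let N0 : 0 <= N. Proof. by apply: Rintegral_ge0 => x _; exact: normc_ge0. Qed.
Let K0 : 0 <= K.
Proof. by rewrite /K addr_ge0// divr_ge0// ?sqr_ge0// mulr_ge0// sqr_ge0. Qed.

Lemma Cint_cauchy_integrand x : Cint (fun y => h y * ckern e (x - y)).
Proof.
apply: (CintM ih (B := e^-1)); last by move=> y; exact: normc_ckern_le.
apply: (Cmeas_comp (Cmeas_ckern e0)).
by apply: measurable_funB => //; exact: measurable_cst.
Qed.

Lemma normc_cauchyT x : normc (F x) <= e^-1 * N.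
Proof.
rewrite /N -RintegralZl//; last exact: Cint_normc.
apply: normc_Cintegral_le.
- exact: Cint_meas (Cint_cauchy_integrand x).
- exact/rintZ/Cint_normc.
- by move=> y; rewrite Normc.normcM mulrC ler_wpM2r ?normc_ge0 ?normc_ckern_le.
Qed.

(** From [x ^+ 2 <= 2 (x - y) ^+ 2 + 2 y ^+ 2]. The term [2 A ^+ 2] is absorbed thanks to
    [e ^+ 2 <= quad e (x - y)], which is the origin of the quotient in [K]. *)
Lemma quadV_supp x y : `|y| <= A -> (quad e (x - y))^-1 <= K / quad e x.
Proof.
move=> yA; rewrite ler_pdivlMr ?quad_gt0// mulrC ler_pdivrMr ?quad_gt0//.
have yA2 : y ^+ 2 <= A ^+ 2 by rewrite -(real_normK (num_real y)) ler_sqr ?nnegrE// (le_trans _ yA).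
have -> : K * quad e (x - y) = 2 * e ^+ 2 + 2 * (x - y) ^+ 2 + 2 * A ^+ 2
   + 2 * A ^+ 2 / e ^+ 2 * (x - y) ^+ 2.
  by rewrite /K /quad; field; rewrite gt_eqF.
have : 0 <= 2 * A ^+ 2 / e ^+ 2 * (x - y) ^+ 2.
  by rewrite mulr_ge0 ?sqr_ge0// divr_ge0// ?sqr_ge0// mulr_ge0// sqr_ge0.
have : 0 <= (x - 2 * y) ^+ 2 by exact: sqr_ge0.
have : 0 <= e ^+ 2 by exact: sqr_ge0.
rewrite /quad; nra.
Qed.

(** A majorant of the kernel over the support, decaying like [1 / |x|]. Only its square is
    integrable, so domination on the line always needs two decaying factors. *)
Let D x := Num.sqrt (K / quad e x).

Lemma sqrD x : D x ^+ 2 = K / quad e x.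
Proof. by rewrite sqr_sqrtr// divr_ge0// ltW// quad_gt0. Qed.

Lemma ckern_supp x y : normc (h y * ckern e (x - y)) <= normc (h y) * D x.
Proof.
rewrite Normc.normcM; have [yA|yA] := lerP `|y| A; last first.
  by rewrite hA// Normc.normc0 !mul0r.
rewrite ler_wpM2l ?normc_ge0// -(@ler_pXn2r _ 2)// ?nnegrE ?normc_ge0 ?sqrtr_ge0//.
by rewrite sqrD sqr_normc_ckern// quadV_supp.
Qed.

Lemma normc_cauchyT_decay x : normc (F x) <= D x * N.
Proof.
rewrite /N -RintegralZl//; last exact: Cint_normc.
apply: normc_Cintegral_le.
- exact: Cint_meas (Cint_cauchy_integrand x).
- exact/rintZ/Cint_normc.
- by move=> y; rewrite [leRHS]mulrC; exact: ckern_supp.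
Qed.

Lemma normc_cauchyTX n x : normc (F x ^+ n) <= (e^-1 * N) ^+ n.
Proof. by rewrite normcX lerXn2r ?nnegrE ?normc_ge0 ?mulr_ge0 ?invr_ge0 ?(ltW e0) ?normc_cauchyT. Qed.

Lemma Cint_ckern_cauchyTX n (w z : R) :
  Cint (fun x => ckern e (x - w) * ckern e (x - z) * F x ^+ n).
Proof.
apply: (CintM (Cint_ckern_mul e0 w z)); last exact: normc_cauchyTX.
exact: CmeasX.
Qed.

(* By partial fractions ([ckern_mul]), the product of two shifts of the kernel
   is a multiple of their difference; with Fubini this makes the integral
   vanish by induction, without contour integration. *)
Lemma Cintegral_ckern_cauchyTX n (w z : R) : w != z ->
  Cintegral setT (fun x => ckern e (x - w) * ckern e (x - z) * F x ^+ n) = 0.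
Proof.
elim: n w z => [|n IH] w z wz.
  by under eq_Cintegral do rewrite expr0 mulr1; exact: Cintegral_ckern_mul.
pose Phi (p : R * R) := ckern e (p.1 - w) * ckern e (p.1 - z) * F p.1 ^+ n *
  (h p.2 * ckern e (p.1 - p.2)).
have mPhi : Cmeas Phi.
  apply: CmeasM; last exact: Cmeas_cauchy_integrand.
  exact (Cmeas_fst (Cint_meas (Cint_ckern_cauchyTX n w z))).
have ia := rintZ ((e^-1 * N) ^+ n) (rint_quadV2 e0 w z).
have ib := rintZ e^-1 (Cint_normc ih).
have Pab x y : normc (Phi (x, y)) <=
    `|(e^-1 * N) ^+ n * ((quad e (x - w))^-1 + (quad e (x - z))^-1)| *
    `|e^-1 * normc (h y)|.
  rewrite /Phi/= Normc.normcM ger0_norm; last first.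
    by rewrite mulr_ge0 ?exprn_ge0 ?mulr_ge0 ?invr_ge0 ?(ltW e0)// addr_ge0// invr_ge0 ltW// quad_gt0.
  rewrite ger0_norm ?mulr_ge0 ?normc_ge0 ?invr_ge0 ?(ltW e0)//.
  apply: ler_pM; rewrite ?normc_ge0//.
    rewrite Normc.normcM mulrC; apply: ler_pM; rewrite ?normc_ge0 ?normc_cauchyTX//.
    exact: ckern_mul_norm.
  by rewrite Normc.normcM mulrC ler_wpM2r ?normc_ge0 ?normc_ckern_le.
have [_ i2 E] := Cfubini mPhi ia ib Pab.
have -> : Cintegral setT (fun x => ckern e (x - w) * ckern e (x - z) * F x ^+ n.+1) =
   Cintegral setT (fun x => Cintegral setT (fun y => Phi (x, y))).
  apply: eq_Cintegral => x _; rewrite /Phi/= CintegralZ; last exact: Cint_cauchy_integrand.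
  by rewrite exprSr mulrA.
rewrite E; apply: (@Cintegral_ae0 _ w z); first exact: Cint_meas i2.
move=> y yw yz; rewrite /Phi/=.
have -> : (fun x => ckern e (x - w) * ckern e (x - z) * F x ^+ n * (h y * ckern e (x - y))) =
  (fun x => h y * (0 +i* (w - y))^-1 *
    (ckern e (x - y) * ckern e (x - z) * F x ^+ n - ckern e (x - w) * ckern e (x - z) * F x ^+ n)).
  apply/funext => x; rewrite -!mulrBl.
  have aux1 (a b c d u : R[i]) : b * c * d * (a * u) = a * (u * b) * (c * d) by ring.
  have aux2 (u v a b c d : R[i]) : u * (v * (a - b)) * (c * d) = u * v * ((a - b) * c * d) by ring.
  by rewrite aux1 ckern_mul// aux2.
rewrite CintegralZ; last by apply: CintB; exact: Cint_ckern_cauchyTX.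
rewrite CintegralB; [|exact: Cint_ckern_cauchyTX|exact: Cint_ckern_cauchyTX].
by rewrite (IH y z yz) (IH w z wz) subrr mulr0.
Qed.

Lemma cauchyTX_bound n : exists2 M : R, 0 <= M & forall x, normc (F x ^+ n) <= M.
Proof.
exists ((e^-1 * N) ^+ n); last exact: normc_cauchyTX.
by rewrite exprn_ge0// mulr_ge0// invr_ge0 ltW.
Qed.

Lemma rint_sqrD : rint (fun x => D x ^+ 2).
Proof.
under eq_fun do rewrite sqrD; apply: rintZ.
by have := (rint_quadV e0 0).1; under eq_fun do rewrite subr0.
Qed.

(** One factor [F x] is expanded into its defining integral; its kernel provides the second shift
    required by [Cintegral_ckern_cauchyTX]. The decay of that kernel over the support justifies the
    exchange. *)
Lemma Cintegral_ckern_cauchyTXS n (y : R) :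
  Cint (fun x => ckern e (x - y) * F x ^+ n.+1) /\
  Cintegral setT (fun x => ckern e (x - y) * F x ^+ n.+1) = 0.
Proof.
have [M M0 FM] := cauchyTX_bound n.
pose Psi (p : R * R) := ckern e (p.1 - y) * F p.1 ^+ n * (h p.2 * ckern e (p.1 - p.2)).
have mck : Cmeas (fun x : R => ckern e (x - y) * F x ^+ n).
  by apply: CmeasM; [exact: Cmeas_ckernB|exact: CmeasX].
have mPsi : Cmeas Psi.
  apply: CmeasM; last exact: Cmeas_cauchy_integrand.
  exact (Cmeas_fst mck).
have ia := rintZ M (rintD (rint_quadV e0 y).1 rint_sqrD).
have aux2 (a b : R) : 0 <= a -> 0 <= b -> a * b <= a ^+ 2 + b ^+ 2.
  move=> a0 b0; have : 0 <= (a - b) ^+ 2 + a ^+ 2 + b ^+ 2 by rewrite !addr_ge0 ?sqr_ge0.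
  by rewrite sqrrB; have : 0 <= a * b by [exact: mulr_ge0]; lra.
have Pab x z : normc (Psi (x, z)) <=
    `|M * ((quad e (x - y))^-1 + D x ^+ 2)| * `|normc (h z)|.
  apply: (@le_trans _ _ (M * ((quad e (x - y))^-1 + D x ^+ 2) * normc (h z))); last first.
    by apply: ler_pM; rewrite ?normc_ge0 ?ler_norm// mulr_ge0// addr_ge0 ?quadV_ge0 ?sqr_ge0.
  have c0 := normc_ge0 (ckern e (x - y)).
  have d0 : 0 <= D x := sqrtr_ge0 _.
  rewrite /Psi/= Normc.normcM.
  apply: (@le_trans _ _ (normc (ckern e (x - y)) * M * (normc (h z) * D x))).
    apply: ler_pM; rewrite ?normc_ge0 ?ckern_supp// Normc.normcM.
    by apply: ler_wpM2l.
  rewrite -sqr_normc_ckern//.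
  have aux (a b c d : R) : a * b * (c * d) = b * (a * d) * c by ring.
  rewrite aux; apply: ler_wpM2r; first exact: normc_ge0.
  by apply: ler_wpM2l => //; exact: aux2.
have [i1 i2 E] := Cfubini mPsi ia (Cint_normc ih) Pab.
have EP : (fun x => ckern e (x - y) * F x ^+ n.+1) =
    (fun x => Cintegral setT (fun z => Psi (x, z))).
  apply/funext => x; rewrite /Psi/= CintegralZ; last exact: Cint_cauchy_integrand.
  by rewrite exprSr mulrA.
rewrite EP; split; [exact: i1|]; rewrite E; clear E EP i1.
apply: (@Cintegral_ae0 _ y y); first exact: Cint_meas i2.
move=> z zy _; rewrite /Psi/=.
have -> : (fun x => ckern e (x - y) * F x ^+ n * (h z * ckern e (x - z))) =
  (fun x => h z * (ckern e (x - z) * ckern e (x - y) * F x ^+ n)).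
  have aux (a b c d : R[i]) : a * b * (c * d) = c * (d * a * b) by ring.
  by apply/funext => x; exact: aux.
rewrite CintegralZ; last exact: Cint_ckern_cauchyTX.
rewrite (Cintegral_ckern_cauchyTX n zy); exact: mulr0.
Qed.

(** One more expansion of a factor reduces the claim to a single kernel times a power. The exponent
    starts at two because [F] itself decays only like [1 / |x|]. *)
Lemma Cintegral_cauchyTX n :
  Cint (fun x => F x ^+ n.+2) /\ Cintegral setT (fun x => F x ^+ n.+2) = 0.
Proof.
have [M M0 FM] := cauchyTX_bound n.
pose Phi (p : R * R) := F p.1 ^+ n.+1 * (h p.2 * ckern e (p.1 - p.2)).
have mPhi : Cmeas Phi.
  apply: CmeasM; last exact: Cmeas_cauchy_integrand.
  exact (Cmeas_fst (CmeasX n.+1 mF)).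
have ia := rintZ (M * N) rint_sqrD.
have Pab x y : normc (Phi (x, y)) <= `|M * N * D x ^+ 2| * `|normc (h y)|.
  apply: (@le_trans _ _ (M * N * D x ^+ 2 * normc (h y))); last first.
    apply: ler_pM; rewrite ?normc_ge0 ?ler_norm//.
    by apply: mulr_ge0; [exact: mulr_ge0|exact: sqr_ge0].
  rewrite /Phi/= exprSr 2!Normc.normcM -/F.
  apply: (@le_trans _ _ (M * (D x * N) * (normc (h y) * D x))); last first.
    have aux (a b c d : R) : a * (b * c) * (d * b) = a * c * b ^+ 2 * d by ring.
    by rewrite aux.
  apply: ler_pM; rewrite ?mulr_ge0 ?normc_ge0 ?ckern_supp//.
  by apply: ler_pM; rewrite ?normc_ge0 ?normc_cauchyT_decay.
have [i1 i2 E] := Cfubini mPhi ia (Cint_normc ih) Pab.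
have EP : (fun x => F x ^+ n.+2) = (fun x => Cintegral setT (fun y => Phi (x, y))).
  apply/funext => x; rewrite /Phi/= CintegralZ; last exact: Cint_cauchy_integrand.
  by rewrite exprSr.
rewrite EP; split; [exact: i1|]; rewrite E -(Cintegral0 setT).
clear E EP i1 i2; apply: eq_Cintegral => y _.
rewrite /Phi/=.
have [ci c0] := Cintegral_ckern_cauchyTXS n y.
rewrite (_ : (fun x => _) = (fun x => h y * (ckern e (x - y) * F x ^+ n.+1))).
  rewrite CintegralZ; last exact: ci.
  rewrite c0; exact: mulr0.
apply/funext => x; have aux (a b c : R[i]) : a * (b * c) = b * (c * a) by ring.
exact: aux.
Qed.

End compact_support.
End CauchyTransform.

(** * The Riesz inequality for even exponents *)

Section RieszCauchy.
Context {R : realType}.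
Local Notation mu := (@lebesgue_measure R).
Local Notation Re := complex.Re.
Local Notation Im := complex.Im.
Local Notation normc := Normc.normc.

Lemma normc_sum (I : Type) (s : seq I) (f : I -> R[i]) :
  normc (\sum_(i <- s) f i) <= \sum_(i <- s) normc (f i).
Proof.
elim/big_ind2 : _ => [|x1 x2 y1 y2 h1 h2|//]; first by rewrite Normc.normc0.
by apply: (le_trans (le_normcD _ _)); exact: lerD.
Qed.

Lemma normc_subXX (z w : R[i]) (a : R) n : normc z <= a -> normc w <= a ->
  normc (z ^+ n.+1 - w ^+ n.+1) <= normc (z - w) * (n.+1%:R * a ^+ n).
Proof.
move=> za wa; rewrite subrXX Normc.normcM ler_wpM2l ?normc_ge0//.
apply: (le_trans (normc_sum _ _)); rewrite mulr_natl -[X in _ *+ X]card_ord -sumr_const.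
apply: ler_sum => i _; rewrite Normc.normcM !normcX /=.
have -> : a ^+ n = a ^+ (n - i) * a ^+ i by rewrite -exprD subnK// -ltnS.
have a0 : 0 <= a by exact: le_trans (normc_ge0 z) za.
by apply: ler_pM; rewrite ?exprn_ge0 ?normc_ge0// lerXn2r// nnegrE normc_ge0.
Qed.

(* With [z = u + i v], [z] is within [|u|] of [i v], and the real part of
   [(i v) ^+ (2 m)] is [(-1) ^+ m * v ^+ (2 m)]: the main term of [z ^+ (2 m)]
   has a sign, and the remaining terms are absorbed. *)
Lemma normcX_le_Re (z : R[i]) m : (0 < m)%N ->
  normc z ^+ (2 * m) <= 2 * ((-1) ^+ m * Re (z ^+ (2 * m))) +
    2 * ((4 * (2 * m)%:R) * `|Re z|) ^+ (2 * m).
Proof.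
move=> m0; have [n E] : exists n, (2 * m = n.+1)%N by exists (2 * m).-1; rewrite prednK// muln_gt0.
set a := normc z; set u := Re z; set v := Im z.
have a0 : 0 <= a := normc_ge0 z.
have ua : `|u| <= a := Re_le_normc z.
have va : `|v| <= a := Im_le_normc z.
have avu : a - `|v| <= `|u| by rewrite lerBlDr; exact: normc_le_ReIm.
have zv : normc (z - 0 +i* v) = `|u|.
  have -> : z - 0 +i* v = u%:C by apply: eqcP; rewrite /u /v; case: (z) => ? ? /=; ring.
  exact: normcR.
have iv2 : (0 +i* v) ^+ (2 * m) = ((-1) ^+ m * v ^+ (2 * m))%:C.
  rewrite exprM rmorphM !rmorphXn /= [X in _ = _ * X]exprM -exprMn; congr (_ ^+ _).
  by rewrite !expr2; apply: eqcP => /=; ring.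
have H1 : normc (z ^+ (2 * m) - (0 +i* v) ^+ (2 * m)) <= `|u| * ((2 * m)%:R * a ^+ n).
  rewrite E -zv; apply: normc_subXX => //.
  by rewrite /= expr0n/= add0r sqrtr_sqr.
have H2 : v ^+ (2 * m) - `|u| * ((2 * m)%:R * a ^+ n) <= (-1) ^+ m * Re (z ^+ (2 * m)).
  have : `|Re (z ^+ (2 * m)) - (-1) ^+ m * v ^+ (2 * m)| <= `|u| * ((2 * m)%:R * a ^+ n).
    apply: le_trans H1; rewrite iv2.
    have -> : Re (z ^+ (2 * m)) - (-1) ^+ m * v ^+ (2 * m) =
      Re (z ^+ (2 * m) - ((-1) ^+ m * v ^+ (2 * m))%:C) by rewrite raddfB.
    exact: Re_le_normc.
  rewrite -signr_odd ler_norml => /andP[h1 h2].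
  by case: (odd m) h1 h2 => /=; rewrite ?expr1 ?expr0 ?mulN1r ?mul1r; lra.
have H3 : a ^+ (2 * m) - v ^+ (2 * m) <= `|u| * ((2 * m)%:R * a ^+ n).
  have -> : v ^+ (2 * m) = `|v| ^+ (2 * m) by rewrite !exprM real_normK// num_real.
  have := @normc_subXX a%:C `|v|%:C a n; rewrite !normcR normr_id (ger0_norm a0) => /(_ (lexx _) va).
  rewrite -E -!rmorphXn -!rmorphB !normcR => h.
  apply: (le_trans (ler_norm _)); apply: (le_trans h).
  apply: ler_wpM2r; first by rewrite mulr_ge0// exprn_ge0.
  by rewrite ger0_norm// subr_ge0.
set X := (-1) ^+ m * _ in H2 *; set c := (2 * m)%:R in H1 H2 H3 *.
have c0 : 0 <= c by rewrite /c ler0n.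
have H4 : a ^+ (2 * m) <= X + 2 * (`|u| * (c * a ^+ n)) by lra.
rewrite E in H4 *.
(* If [a] is above the threshold, the error [2 c |u| a ^+ n] is at most half of [a ^+ n.+1] and is
   absorbed; below it, [a] is already controlled by [|u|]. The threshold gives the constant of the
   statement. *)
have [h|h] := lerP (4 * c * `|u|) a.
  have : `|u| * (c * a ^+ n) * 4 <= a ^+ n.+1.
    have -> : `|u| * (c * a ^+ n) * 4 = (4 * c * `|u|) * a ^+ n by ring.
    by rewrite exprS ler_wpM2r ?exprn_ge0.
  have : 0 <= (4 * c * `|u|) ^+ n.+1 by rewrite exprn_ge0// !mulr_ge0.
  lra.
have u0 : 0 <= 4 * c * `|u| := le_trans a0 (ltW h).
have h1 : a ^+ n <= (4 * c * `|u|) ^+ n by rewrite lerXn2r ?nnegrE// ltW.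
have h2 : `|u| * (c * a ^+ n) * 4 <= (4 * c * `|u|) ^+ n.+1.
  have -> : `|u| * (c * a ^+ n) * 4 = (4 * c * `|u|) * a ^+ n by ring.
  by rewrite exprS ler_wpM2l.
have h3 : 0 <= a ^+ n.+1 by rewrite exprn_ge0.
have h4 : 0 <= (4 * c * `|u|) ^+ n.+1 by rewrite exprn_ge0.
lra.
Qed.

(** In the induction the defect is [(a - b) ^+ 2] with a nonnegative coefficient. *)
Lemma ler_tangent (a b : R) n : 0 <= a -> 0 <= b ->
  b ^+ n.+1 + n.+1%:R * b ^+ n * (a - b) <= a ^+ n.+1.
Proof.
move=> a0 b0; elim: n => [|n IH]; first by rewrite !expr1 expr0 !mul1r addrC subrK.
rewrite [leRHS]exprS; apply: le_trans (ler_wpM2l a0 IH).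
rewrite -subr_ge0.
have -> : a * (b ^+ n.+1 + n.+1%:R * b ^+ n * (a - b)) -
  (b ^+ n.+2 + n.+2%:R * b ^+ n.+1 * (a - b)) = n.+1%:R * b ^+ n * (a - b) ^+ 2.
  by rewrite !exprS -(natr1 n.+1); ring.
by rewrite mulr_ge0 ?sqr_ge0// mulr_ge0// exprn_ge0.
Qed.

(* The real part of the Cauchy kernel is the Poisson kernel [e / quad e], of
   mass [pi]; Jensen's inequality comes from the tangent line [ler_tangent]. *)
Lemma cauchyT_real_jensen (e : R) (g : R -> R) (B : R) n (x : R) : 0 < e ->
  rint g -> (forall y, `|g y| <= B) ->
  `|Re (cauchyT e (fun y => (g y)%:C) x)| ^+ n.+1 <=
  pi ^+ n * \int[mu]_y (`|g y| ^+ n.+1 * (e / quad e (y - x))).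
Proof.
move=> e0 ig gB.
have mg := rint_meas ig.
have mq : measurable_fun setT (fun y : R => e / quad e (y - x)).
  by apply: measurable_funM; [exact: measurable_cst|exact: rint_meas (rint_quadV e0 x).1].
have P0 y : 0 <= e / quad e (y - x) by rewrite mulr_ge0 ?quadV_ge0 ?ltW.
have B0 : 0 <= B by exact: le_trans (gB 0).
have iP : rint (fun y => e / quad e (y - x)) by exact: rintZ (rint_quadV e0 x).1.
have PE : \int[mu]_y (e / quad e (y - x)) = pi.
  rewrite RintegralZl//; last exact: (rint_quadV e0 x).1.
  by rewrite Rint_quadV// mulrCA divff ?mulr1// gt_eqF.
have igP k : rint (fun y => `|g y| ^+ k * (e / quad e (y - x))).
  apply: (@rint_le _ _ (fun y => B ^+ k * (e / quad e (y - x)))).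
  - apply: measurable_funM => //; apply: measurable_funX; exact: measurableT_comp.
  - exact: rintZ.
  - move=> y; rewrite ger0_norm; last by rewrite mulr_ge0// exprn_ge0.
    by rewrite ler_wpM2r// lerXn2r ?nnegrE.
set I := \int[mu]_y (_ * _).
(* The mean of [|g|] for the Poisson probability measure. At this point the linear term of the
   tangent has mean zero; the exponent [1] lets [igP] serve here as well. *)
pose b := (\int[mu]_y (`|g y| ^+ 1 * (e / quad e (y - x)))) / pi.
have b0 : 0 <= b.
  by rewrite divr_ge0 ?pi_ge0//; apply: Rintegral_ge0 => y _; rewrite mulr_ge0.
have H1 : `|Re (cauchyT e (fun y => (g y)%:C) x)| <= pi * b.
  rewrite /b mulrC divfK ?gt_eqF ?pi_gt0//.
  have -> : Re (cauchyT e (fun y => (g y)%:C) x) = \int[mu]_y (g y * (e / quad e (y - x))).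
    rewrite /cauchyT /=; apply: eq_Rintegral => y _.
    by rewrite mul0r subr0 /quad -(sqrrN (y - x)) opprB.
  have igP' : rint (fun y => g y * (e / quad e (y - x))).
    apply: (@rint_le _ _ (fun y => `|g y| ^+ 1 * (e / quad e (y - x)))) => //.
      exact: measurable_funM.
    by move=> y; rewrite normrM expr1 (ger0_norm (P0 y)).
  apply: (le_trans (le_normr_Rintegral _ igP')) => //.
  apply: le_Rintegral => //; [exact: (rint_norm igP')|exact: (igP 1%N)|].
  by move=> y _; rewrite normrM expr1 (ger0_norm (P0 y)).
have H2 : pi * b ^+ n.+1 <= I.
  have -> : pi * b ^+ n.+1 = \int[mu]_y ((b ^+ n.+1 + n.+1%:R * b ^+ n * (`|g y| - b)) * (e / quad e (y - x))).
    under eq_Rintegral.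
      move=> y _.
      have -> : (b ^+ n.+1 + n.+1%:R * b ^+ n * (`|g y| - b)) * (e / quad e (y - x)) =
        (b ^+ n.+1 - n.+1%:R * b ^+ n * b) * (e / quad e (y - x)) +
        n.+1%:R * b ^+ n * (`|g y| ^+ 1 * (e / quad e (y - x))) by rewrite expr1; ring.
      over.
    rewrite RintegralD//; [|exact: rintZ|exact: rintZ (igP 1%N)].
    have Z1 c := RintegralZl c measurableT iP.
    have Z2 c := RintegralZl c measurableT (igP 1%N).
    rewrite Z1 Z2 PE.
    have -> : \int[mu]_y (`|g y| ^+ 1 * (e / quad e (y - x))) = b * pi.
      by rewrite /b divfK// gt_eqF ?pi_gt0.
    by ring.
  apply: le_Rintegral => //.
    rewrite (_ : _ \o _ = EFin \o (fun y =>
        (b ^+ n.+1 - n.+1%:R * b ^+ n * b) * (e / quad e (y - x)) +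
        n.+1%:R * b ^+ n * (`|g y| ^+ 1 * (e / quad e (y - x))))); last first.
      by apply/funext => y /=; congr (_%:E); rewrite expr1; ring.
    by apply: rintD; [exact: rintZ|exact: rintZ (igP 1%N)].
  exact: igP.
  by move=> y _; rewrite ler_wpM2r// ler_tangent.
apply: (@le_trans _ _ ((pi * b) ^+ n.+1)).
  by rewrite lerXn2r ?nnegrE// mulr_ge0// pi_ge0.
by rewrite exprMn exprSr -mulrA ler_wpM2l// exprn_ge0// pi_ge0.
Qed.

(** Jensen gives [pi ^+ n], and after Tonelli the mass of the Poisson kernel in [x] gives the last
    factor [pi]; hence a constant free of [e]. Extended reals spare a separate proof that the
    left-hand side is finite. *)
Lemma Re_cauchyT_bound (e : R) (g : R -> R) (B : R) n : 0 < e ->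
  rint g -> (forall y, `|g y| <= B) ->
  (\int[mu]_x (`|Re (cauchyT e (fun y => (g y)%:C) x)| ^+ n.+1)%:E <=
  (pi ^+ n.+1)%:E * \int[mu]_y (`|g y| ^+ n.+1)%:E)%E.
Proof.
move=> e0 ig gB.
have mg := rint_meas ig.
have mgn : measurable_fun setT (fun y => `|g y| ^+ n.+1).
  by apply: measurable_funX; exact: measurableT_comp.
have P0 y x : 0 <= e / quad e (y - x) by rewrite mulr_ge0 ?quadV_ge0 ?ltW.
have B0 : 0 <= B by exact: le_trans (gB 0).
pose J (p : R * R) := (`|g p.2| ^+ n.+1 * (e / quad e (p.2 - p.1)))%:E.
have mJ : measurable_fun setT J.
  apply/measurable_EFinP; apply: measurable_funM.
    apply: (@measurableT_comp _ _ _ _ _ _ (fun y => `|g y| ^+ n.+1) _ snd) => //.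
  apply: measurable_funM; first exact: measurable_cst.
  apply: (@measurableT_comp _ _ _ _ _ _ (fun y => (quad e y)^-1) _ (fun p : R * R => p.2 - p.1)).
    exact: measurable_quadV.
  by apply: measurable_funB; [exact: measurable_snd|exact: measurable_fst].
have J0 p : (0 <= J p)%E by rewrite lee_fin mulr_ge0// exprn_ge0.
have igP x : rint (fun y => `|g y| ^+ n.+1 * (e / quad e (y - x))).
  apply: (@rint_le _ _ (fun y => B ^+ n.+1 * (e / quad e (y - x)))).
  - apply: measurable_funM => //; apply: measurable_funM; first exact: measurable_cst.
    exact: rint_meas (rint_quadV e0 x).1.
  - by apply: rintZ; apply: rintZ; exact: (rint_quadV e0 x).1.
  - move=> y; rewrite ger0_norm; last by rewrite mulr_ge0// exprn_ge0.
    by rewrite ler_wpM2r// lerXn2r ?nnegrE.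
have H1 x : ((`|Re (cauchyT e (fun y => (g y)%:C) x)| ^+ n.+1)%:E <=
    (pi ^+ n)%:E * \int[mu]_y J (x, y))%E.
  have := cauchyT_real_jensen n x e0 ig gB; rewrite -lee_fin EFinM.
  by rewrite /Rintegral fineK//; exact: integrable_fin_num (igP x).
have mF : Cmeas (cauchyT e (fun y => (g y)%:C)).
  by apply: Cmeas_cauchyT => //; exact: CmeasR.
have mJ1 : measurable_fun setT (fun x => \int[mu]_y J (x, y))%E.
  exact: (@measurable_fun_fubini_tonelli_F _ _ _ _ R mu J).
apply: (@le_trans _ _ (\int[mu]_x ((pi ^+ n)%:E * \int[mu]_y J (x, y)))%E).
  apply: ge0_le_integral => //.
  - apply/measurable_EFinP; apply: measurable_funX.
    by apply: measurableT_comp => //; exact: mF.1.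
  - exact: measurable_funeM.
rewrite ge0_integralZl//; last 2 first.
- by move=> x _; exact: integral_ge0.
- by rewrite lee_fin exprn_ge0// pi_ge0.
rewrite (fubini_tonelli (m1 := mu) (m2 := mu) J mJ J0)/=.
rewrite exprSr EFinM -muleA; apply: lee_wpmul2l.
  by rewrite lee_fin exprn_ge0// pi_ge0.
rewrite -ge0_integralZl//; last 2 first.
- exact/measurable_EFinP.
- by rewrite lee_fin pi_ge0.
rewrite le_eqVlt; apply/orP; left; apply/eqP; apply: eq_integral => y _.
have E x : J (x, y) = ((`|g y| ^+ n.+1 * e)%:E * ((quad e (x - y))^-1)%:E)%E.
  by rewrite /J/= -EFinM mulrA -opprB /quad sqrrN.
under eq_integral do rewrite E.
rewrite ge0_integralZl//; last 3 first.
- by apply/measurable_EFinP; exact: rint_meas (rint_quadV e0 y).1.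
- by move=> x _; rewrite lee_fin quadV_ge0.
- by rewrite lee_fin mulr_ge0 ?exprn_ge0// ltW.
have <- : (pi / e)%:E = (\int[mu]_x ((quad e (x - y))^-1)%:E)%E.
  rewrite -(Rint_quadV e0 y) /Rintegral fineK//.
  exact: integrable_fin_num (rint_quadV e0 y).1.
rewrite -!EFinM; congr (_%:E).
have aux (a p : R) : a * e * (p / e) = p * a by field; rewrite gt_eqF.
exact: aux.
Qed.

(** When [normcX_le_Re] is integrated, its signed main term disappears by [Cintegral_cauchyTX], and
    the power of the real part is a Poisson integral. The constant depends on [m] alone. *)
Lemma cauchyT_real_bound (e : R) (g : R -> R) (A B : R) m : 0 < e -> (0 < m)%N ->
  rint g -> (forall y, `|g y| <= B) -> (forall y, A < `|y| -> g y = 0) ->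
  (\int[mu]_x (normc (cauchyT e (fun y => (g y)%:C) x) ^+ (2 * m))%:E <=
  (2 * (4 * (2 * m)%:R * pi) ^+ (2 * m))%:E * \int[mu]_y (`|g y| ^+ (2 * m))%:E)%E.
Proof.
move=> e0 m0 ig gB gA; set h := (fun y => (g y)%:C).
have ih : Cint h.
  apply: CintP; first exact: CmeasR (rint_meas ig).
  by rewrite /h; under eq_fun do rewrite normcR; exact: rint_norm.
have hA x : A < `|x| -> h x = 0 by move=> /gA; rewrite /h => ->.
have [n E] : exists n, (2 * m = n.+2)%N.
  by exists (2 * m.-1)%N; rewrite -[in LHS](prednK m0) mulnS.
have [iF F0] := Cintegral_cauchyTX e0 ih hA n; rewrite -E in iF F0.
set F := cauchyT e h in iF F0 *.
have nF : rint (fun x => normc (F x) ^+ (2 * m)).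
  by have := Cint_normc iF; under eq_fun do rewrite normcX.
have mF : Cmeas F by exact: Cmeas_cauchyT (Cint_meas ih).
have rF : rint (fun x => `|Re (F x)| ^+ (2 * m)).
  apply: (rint_le _ nF) => [|x].
    by apply: measurable_funX; apply: measurableT_comp => //; exact: mF.1.
  by rewrite ger0_norm ?exprn_ge0// lerXn2r ?nnegrE ?normc_ge0 ?Re_le_normc.
set c := 4 * (2 * m)%:R.
have H : \int[mu]_x (normc (F x) ^+ (2 * m)) <=
    2 * c ^+ (2 * m) * \int[mu]_x (`|Re (F x)| ^+ (2 * m)).
  have Z1 := RintegralZl (2 * (-1) ^+ m) measurableT iF.1.
  have Z2 := RintegralZl (2 * c ^+ (2 * m)) measurableT rF.
  have F0' : \int[mu]_x Re (F x ^+ (2 * m)) = 0 by exact: (congr1 (@complex.Re R) F0).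
  rewrite F0' mulr0 in Z1; rewrite -[leRHS]add0r -{1}Z1 -Z2 -RintegralD//; last 2 first.
  - exact: rintZ iF.1.
  - exact: rintZ rF.
  apply: le_Rintegral => //.
    by apply: rintD; [exact: rintZ iF.1|exact: rintZ rF].
  move=> x _; have := normcX_le_Re (F x) m0.
  by rewrite exprMn -/c !mulrA.
have H' : (\int[mu]_x (normc (F x) ^+ (2 * m))%:E <=
  (2 * c ^+ (2 * m))%:E * \int[mu]_x (`|Re (F x)| ^+ (2 * m))%:E)%E.
  move: H; rewrite -lee_fin EFinM /Rintegral !fineK//.
    exact: integrable_fin_num rF.
  exact: integrable_fin_num nF.
apply: (le_trans H').
have := @Re_cauchyT_bound e g B n.+1 e0 ig gB; rewrite -/h -/F -E => HR.
rewrite [(c * pi) ^+ _]exprMn mulrA [((_ * _) * pi ^+ _)%:E]EFinM -muleA.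
apply: lee_wpmul2l HR.
by rewrite lee_fin mulr_ge0// exprn_ge0// mulr_ge0.
Qed.

Lemma ler_addXn (a b : R) n : 0 <= a -> 0 <= b ->
  (a + b) ^+ n <= 2 ^+ n * (a ^+ n + b ^+ n).
Proof.
move=> a0 b0; wlog ab : a b a0 b0 / a <= b.
  by move=> H; case: (leP a b) => [|/ltW] ab; [exact: H|rewrite addrC [X in _ * X]addrC; exact: H].
apply: (@le_trans _ _ ((2 * b) ^+ n)).
  by rewrite lerXn2r ?nnegrE ?addr_ge0 ?mulr_ge0// mulr_natl mulr2n lerD2r.
by rewrite exprMn ler_wpM2l ?exprn_ge0// lerDr exprn_ge0.
Qed.

End RieszCauchy.

(** * Complex data and the damped frequency integral *)

Section RieszProjection.
Context {R : realType}.
Local Notation mu := (@lebesgue_measure R).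
Local Notation Re := complex.Re.
Local Notation Im := complex.Im.
Local Notation normc := Normc.normc.

Lemma le_int (f g : R -> R) : measurable_fun setT f -> measurable_fun setT g ->
  (forall x, 0 <= f x) -> (forall x, f x <= g x) ->
  (\int[mu]_x (f x)%:E <= \int[mu]_x (g x)%:E)%E.
Proof.
move=> mf mg f0 fg; apply: ge0_le_integral => //.
- by move=> x _; rewrite lee_fin.
- exact/measurable_EFinP.
- exact/measurable_EFinP.
- by move=> x _; rewrite lee_fin.
Qed.

Lemma le_int_lin (f g1 g2 : R -> R) (C : R) : measurable_fun setT f ->
  measurable_fun setT g1 -> measurable_fun setT g2 -> 0 <= C ->
  (forall x, 0 <= f x) -> (forall x, 0 <= g1 x) -> (forall x, 0 <= g2 x) ->
  (forall x, f x <= C * (g1 x + g2 x)) ->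
  (\int[mu]_x (f x)%:E <= C%:E * (\int[mu]_x (g1 x)%:E + \int[mu]_x (g2 x)%:E))%E.
Proof.
move=> mf m1 m2 C0 f0 g10 g20 fg.
have e1 x : setT x -> (0 <= (g1 x)%:E)%E by rewrite lee_fin.
have e2 x : setT x -> (0 <= (g2 x)%:E)%E by rewrite lee_fin.
have me1 : measurable_fun setT (fun x => (g1 x)%:E) by exact/measurable_EFinP.
have me2 : measurable_fun setT (fun x => (g2 x)%:E) by exact/measurable_EFinP.
rewrite -(ge0_integralD mu measurableT e1 me1 e2 me2) -ge0_integralZl//; last 2 first.
- exact: emeasurable_funD.
- by move=> x _; rewrite adde_ge0// lee_fin.
apply: le_int => //; apply: measurable_funM => //.
exact: measurable_funD.
Qed.

(** The innermost factor is the constant for real data; [2 ^+ (2 * m)] and the outer [2] pay for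
    splitting the data into real and imaginary parts. *)
Definition cauchy_cst (m : nat) : R :=
  2 ^+ (2 * m) * (2 * (2 * (4 * (2 * m)%:R * pi) ^+ (2 * m))).

Lemma cauchyT_bound (e : R) (h : R -> R[i]) (A B : R) m : 0 < e -> (0 < m)%N ->
  Cint h -> (forall y, normc (h y) <= B) -> (forall y, A < `|y| -> h y = 0) ->
  (\int[mu]_x (normc (cauchyT e h x) ^+ (2 * m))%:E <=
  (cauchy_cst m)%:E * \int[mu]_y (normc (h y) ^+ (2 * m))%:E)%E.
Proof.
move=> e0 m0 ih hB hA.
pose h1 y := (Re (h y))%:C; pose h2 y := (Im (h y))%:C.
have mh := Cint_meas ih.
have i1 : Cint h1.
  apply: CintP; first exact: CmeasR mh.1.
  by rewrite /h1; under eq_fun do rewrite normcR; exact: rint_norm ih.1.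
have i2 : Cint h2.
  apply: CintP; first exact: CmeasR mh.2.
  by rewrite /h2; under eq_fun do rewrite normcR; exact: rint_norm ih.2.
have T x : cauchyT e h x = cauchyT e h1 x + 'i%C * cauchyT e h2 x.
  rewrite /cauchyT -CintegralZ; last exact: Cint_cauchy_integrand.
  rewrite -CintegralD; [|exact: Cint_cauchy_integrand|exact/CintZ/Cint_cauchy_integrand].
  apply: eq_Cintegral => y _; rewrite mulrA -mulrDl; congr (_ * _).
  by rewrite /h1 /h2; apply: eqcP; case: (h y) => a b /=; ring.
pose c : R := 2 * (4 * (2 * m)%:R * pi) ^+ (2 * m).
have c0 : 0 <= c by rewrite mulr_ge0// exprn_ge0// mulr_ge0 ?pi_ge0// mulr_ge0.
have b1 := cauchyT_real_bound e0 m0 ih.1 (fun y => le_trans (Re_le_normc _) (hB y))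
  (fun y Ay => congr1 (@complex.Re R) (hA y Ay)).
have b2 := cauchyT_real_bound e0 m0 ih.2 (fun y => le_trans (Im_le_normc _) (hB y))
  (fun y Ay => congr1 (@complex.Im R) (hA y Ay)).
have mT k : Cint k -> measurable_fun setT (fun x => normc (cauchyT e k x) ^+ (2 * m)).
  by move=> ik; apply: measurable_funX; apply: Cmeas_normc; apply: Cmeas_cauchyT => //; exact: Cint_meas.
apply: (@le_trans _ _ ((2 ^+ (2 * m))%:E * (\int[mu]_x (normc (cauchyT e h1 x) ^+ (2 * m))%:E +
   \int[mu]_x (normc (cauchyT e h2 x) ^+ (2 * m))%:E))%E).
  apply: le_int_lin; try exact: mT; rewrite ?exprn_ge0//.
  - by move=> x; rewrite exprn_ge0 ?normc_ge0.
  - by move=> x; rewrite exprn_ge0 ?normc_ge0.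
  - by move=> x; rewrite exprn_ge0 ?normc_ge0.
  - move=> x; apply: le_trans (ler_addXn _ (normc_ge0 _) (normc_ge0 _)).
    rewrite lerXn2r ?nnegrE ?addr_ge0 ?normc_ge0// T.
    apply: (le_trans (le_normcD _ _)); rewrite Normc.normcM.
    by rewrite /= expr0n/= add0r expr1n sqrtr1 mul1r.
rewrite /cauchy_cst -/c [X in (_ <= X * _)%E]EFinM -muleA; apply: lee_wpmul2l.
  by rewrite lee_fin exprn_ge0.
rewrite mulr2n mulrDl !mul1r EFinD ge0_muleDl ?lee_fin//.
have mn : measurable_fun setT (fun x => normc (h x) ^+ (2 * m)).
  by apply: measurable_funX; exact: Cmeas_normc.
apply: leeD.
  apply: (le_trans b1); apply: lee_wpmul2l; first by rewrite lee_fin.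
  apply: le_int => //.
  - by apply: measurable_funX; apply: measurableT_comp => //; exact: mh.1.
  - by move=> x; rewrite lerXn2r ?nnegrE ?normc_ge0 ?Re_le_normc.
apply: (le_trans b2); apply: lee_wpmul2l; first by rewrite lee_fin.
apply: le_int => //.
- by apply: measurable_funX; apply: measurableT_comp => //; exact: mh.2.
- by move=> x; rewrite lerXn2r ?nnegrE ?normc_ge0 ?Im_le_normc.
Qed.

Lemma Cintegral_damped_expi (e x r : R) : 0 < e -> 0 < r ->
  Cintegral `[0, r] (fun t => (expR (- (e * t)))%:C * expi (x * t)) =
  ckern e x * (1 - (expR (- (e * r)))%:C * expi (x * r)).
Proof.
move=> e0 r0; have q0 := quad_neq0 e0 x.
have dl (a t : R) : is_derive t 1 (fun t : R => a * t) a.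
  have D := is_deriveM (is_derive_cst a t 1) (is_derive_id t 1).
  by apply: (is_derive_eq D); rewrite scaler0 addr0 /GRing.scale/= mulr1.
have dE (t : R) : is_derive t 1 (fun t => expR (- (e * t))) (- e * expR (- (e * t))).
  have D := @is_derive1_comp _ (@expR R) (fun t => - e * t) t _ _ (is_derive_expR _) (dl _ t).
  rewrite (_ : (fun t => expR (- (e * t))) = @expR R \o (fun t => - e * t)).
    by apply: (is_derive_eq D); rewrite mulrC [- e * t]mulNr.
  by apply/funext => s /=; rewrite mulNr.
have dc (t : R) : is_derive t 1 (fun t => cos (x * t)) (- x * sin (x * t)).
  have D := @is_derive1_comp _ (@cos R) (fun t => x * t) t _ _ (is_derive_cos _) (dl _ t).
  by apply: (is_derive_eq D); rewrite mulrC mulrN mulNr.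
have ds (t : R) : is_derive t 1 (fun t => sin (x * t)) (x * cos (x * t)).
  have D := @is_derive1_comp _ (@sin R) (fun t => x * t) t _ _ (is_derive_sin _) (dl _ t).
  by apply: (is_derive_eq D); rewrite mulrC.
have cont (f : R -> R) (f' : R -> R) : (forall t : R, is_derive t 1 f (f' t)) -> continuous f.
  by move=> df t; apply/differentiable_continuous/derivable1_diffP/ex_derive; exact: df.
have comb (a b t : R) : is_derive t 1
    (fun t => expR (- (e * t)) * (a * sin (x * t) + b * cos (x * t)))
    (expR (- (e * t)) * ((a * x - b * e) * cos (x * t) - (b * x + a * e) * sin (x * t))).
  have D1 := is_deriveM (is_derive_cst a t 1) (ds t).
  have D2 := is_deriveM (is_derive_cst b t 1) (dc t).
  have D : is_derive t 1 _ (expR (- (e * t)) *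
      (a * (x * cos (x * t)) + sin (x * t) * 0 + (b * (- x * sin (x * t)) + cos (x * t) * 0)) +
      (a * sin (x * t) + b * cos (x * t)) * (- e * expR (- (e * t)))) :=
    is_deriveM (dE t) (is_deriveD D1 D2).
  by apply: (is_derive_eq D); ring.
have sol (f g : R -> R) (a b : R) : (forall t, f t = expR (- (e * t)) *
     ((a * x - b * e) * cos (x * t) - (b * x + a * e) * sin (x * t))) ->
   (forall t, g t = expR (- (e * t)) * (a * sin (x * t) + b * cos (x * t))) ->
   \int[mu]_(t in `[0, r]) f t = g r - g 0.
  move=> fE gE.
  have E : f = fun t => expR (- (e * t)) *
     ((a * x - b * e) * cos (x * t) - (b * x + a * e) * sin (x * t)) by apply/funext.
  have G : g = fun t => expR (- (e * t)) * (a * sin (x * t) + b * cos (x * t)) by apply/funext.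
  have cf : continuous f.
    rewrite E => t; apply: cvgM; first exact: (cont _ _ dE).
    apply: cvgB; apply: cvgM; try exact: cvg_cst; first exact: (cont _ _ dc).
    exact: (cont _ _ ds).
  have dg (t : R) : is_derive t 1 g (f t) by rewrite E G; exact: comb.
  by rewrite /Rintegral (FTC_segment r0 cf dg).
(* The coefficients [a] and [b] in the two uses of [sol] solve the linear system that reduces [comb]
   to the pure cosine, respectively the pure sine; its determinant is [quad e x]. *)
apply: eqcP => /=.
  rewrite (@sol _ (fun t => expR (- (e * t)) * (x / quad e x * sin (x * t) + - (e / quad e x) * cos (x * t))) _ _ _ (fun=> erefl)).
    by rewrite !mulr0 oppr0 expR0 sin0 cos0; ring.
  move=> t; rewrite /=.
  have -> : x / quad e x * x - - (e / quad e x) * e = 1 by move: q0; rewrite /quad => q0; field.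
  have -> : - (e / quad e x) * x + x / quad e x * e = 0 by ring.
  by ring.
rewrite (@sol _ (fun t => expR (- (e * t)) * (- (e / quad e x) * sin (x * t) + - (x / quad e x) * cos (x * t))) _ _ _ (fun=> erefl)).
  by rewrite !mulr0 oppr0 expR0 sin0 cos0; ring.
move=> t; rewrite /=.
have -> : - (e / quad e x) * x - - (x / quad e x) * e = 0 by ring.
have -> : - (x / quad e x) * x + - (e / quad e x) * e = -1 by move: q0; rewrite /quad => q0; field.
by ring.
Qed.

End RieszProjection.

(** * The frequency projection as a limit of Cauchy transforms *)

Section FourierProjection.
Context {R : realType}.
Local Notation mu := (@lebesgue_measure R).
Local Notation Re := complex.Re.
Local Notation Im := complex.Im.
Local Notation normc := Normc.normc.

Definition Ccvg (u : nat -> R[i]) (l : R[i]) :=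
  (fun n => Re (u n)) @ \oo --> Re l /\ (fun n => Im (u n)) @ \oo --> Im l.

Lemma Ccvg_cst l : Ccvg (fun=> l) l.
Proof. by split; exact: cvg_cst. Qed.

Lemma CcvgM u v a b : Ccvg u a -> Ccvg v b -> Ccvg (fun n => u n * v n) (a * b).
Proof.
move=> [u1 u2] [v1 v2]; split.
  under eq_fun do rewrite ReM.
  by rewrite ReM; apply: cvgB; exact: cvgM.
under eq_fun do rewrite ImM.
by rewrite ImM; apply: cvgD; exact: cvgM.
Qed.

Lemma CcvgR (u : nat -> R) (a : R) : u @ \oo --> a -> Ccvg (fun n => (u n)%:C) a%:C.
Proof. by move=> ua; split => //=; exact: cvg_cst. Qed.

Lemma Ccvg_normc u a : Ccvg u a -> (fun n => normc (u n)) @ \oo --> normc a.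
Proof.
move=> [u1 u2].
have E z : normc z = Num.sqrt (Re z ^+ 2 + Im z ^+ 2) by case: z.
under eq_fun do rewrite E.
rewrite E; apply: continuous_cvg; first exact: sqrt_continuous.
by apply: cvgD; rewrite ?expr2; under eq_fun do rewrite expr2; exact: cvgM.
Qed.

Lemma Cint_dct (f_ : nat -> R -> R[i]) (f : R -> R[i]) (g : R -> R) :
  (forall n, Cmeas (f_ n)) -> Cmeas f -> rint g ->
  (forall x, Ccvg (f_ ^~ x) (f x)) -> (forall n x, normc (f_ n x) <= g x) ->
  Ccvg (fun n => Cintegral setT (f_ n)) (Cintegral setT f).
Proof.
move=> mf_ mf ig fcv fg; split => /=.
  apply: (Rint_dct (fun n => (mf_ n).1) mf.1 ig (fun x => (fcv x).1)) => n x.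
  exact: le_trans (Re_le_normc _) (fg n x).
apply: (Rint_dct (fun n => (mf_ n).2) mf.2 ig (fun x => (fcv x).2)) => n x.
exact: le_trans (Im_le_normc _) (fg n x).
Qed.

Definition fourier (h : R -> R[i]) (t : R) : R[i] :=
  Cintegral setT (fun m => h m * expi (- (m * t))).

(* [2 pi] times the spectral projection onto the frequencies in [[0, r]]. *)
Definition fproj (r : R) (h : R -> R[i]) (l : R) : R[i] :=
  Cintegral `[0, r] (fun t => fourier h t * expi (l * t)).

(** The exponential regularizes the contributions of the two endpoints [0] and [r], which otherwise
    would be principal value integrals. *)
Definition fproj_damped (e r : R) (h : R -> R[i]) (l : R) : R[i] :=
  Cintegral `[0, r] (fun t => (expR (- (e * t)))%:C * (fourier h t * expi (l * t))).

Definition cind (r : R) (t : R) : R[i] := (\1_(`[0, r]%classic : set R) t)%:C.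

Lemma Cmeas_cind r : Cmeas (cind r).
Proof. by apply: CmeasR; exact: measurable_indic. Qed.

Lemma normc_cind r t : normc (cind r t) = \1_(`[0, r]%classic : set R) t.
Proof. by rewrite /cind normcR ger0_norm// indicE. Qed.

Lemma rint_indic (r : R) : rint (fun t => \1_(`[0, r]%classic : set R) t).
Proof. exact: integrable_indic_itv. Qed.

Lemma Cmeas_expiM (a : R) : Cmeas (fun t : R => expi (a * t)).
Proof. by apply: Cmeas_expi; exact: measurable_funM. Qed.

Lemma Cmeas_expi2 : Cmeas (fun p : R * R => expi (- (p.2 * p.1))).
Proof.
apply: Cmeas_expi; apply: measurable_funN; apply: measurable_funM.
  exact: measurable_snd.
exact: measurable_fst.
Qed.

Lemma Cint_fourier (h : R -> R[i]) (t : R) : Cint h -> Cint (fun m => h m * expi (- (m * t))).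
Proof.
move=> ih; apply: (CintM ih (B := 1)) => [|x]; last by rewrite normc_expi.
by apply: Cmeas_expi; apply: measurable_funN; exact: measurable_funM.
Qed.

Lemma Cmeas_fourier h : Cint h -> Cmeas (fourier h).
Proof.
move=> ih; apply: (@Cmeas_int _ (fun p => h p.2 * expi (- (p.2 * p.1)))).
by apply: CmeasM; [exact: Cmeas_snd (Cint_meas ih)|exact: Cmeas_expi2].
Qed.

Lemma normc_fourier h t : Cint h -> normc (fourier h t) <= \int[mu]_x normc (h x).
Proof.
move=> ih; apply: normc_Cintegral_le.
- exact: Cint_meas (Cint_fourier _ ih).
- exact: Cint_normc.
- by move=> y; rewrite Normc.normcM normc_expi mulr1.
Qed.

Lemma Cmeas_damped (e x r : R) :
  Cmeas (fun t => cind r t * ((expR (- (e * t)))%:C * expi (x * t))).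
Proof.
apply: CmeasM; first exact: Cmeas_cind.
apply: CmeasM; last exact: Cmeas_expiM.
apply: CmeasR; apply: measurableT_comp => //; apply: measurable_funN.
exact: measurable_funM.
Qed.

Lemma normc_damped (e x r t : R) : 0 < e ->
  normc (cind r t * ((expR (- (e * t)))%:C * expi (x * t))) <=
  \1_(`[0, r]%classic : set R) t.
Proof.
move=> e0; rewrite !Normc.normcM normc_expi !mulr1 normc_cind normcR ger0_norm ?expR_ge0//.
rewrite indicE; case: (boolP (t \in _)) => [|_]; last by rewrite mul0r.
rewrite inE/= in_itv/= => /andP[t0 _]; rewrite mul1r.
by rewrite -expR0 ler_expR oppr_le0 mulr_ge0// ltW.
Qed.

Lemma Cint_damped (e x r : R) : 0 < e ->
  Cint (fun t => cind r t * ((expR (- (e * t)))%:C * expi (x * t))).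
Proof.
move=> e0; apply: (Cint_le (Cmeas_damped _ _ _) (rint_indic r)) => t.
exact: normc_damped.
Qed.

Lemma Cint_modulated (h : R -> R[i]) (r : R) : Cint h ->
  Cint (fun m => h m * expi (- (m * r))).
Proof. exact: Cint_fourier. Qed.

(** The interval of frequencies is the half-line from [0] minus the half-line from [r], and the
    second half-line is the first one conjugated by a modulation. Modulations preserve absolute
    values and the damping factor at [r] is at most one, so every bound for [cauchyT] carries over
    uniformly in [r]. *)
Lemma fproj_dampedE (e r : R) (h : R -> R[i]) (l : R) : 0 < e -> 0 < r -> Cint h ->
  fproj_damped e r h l = cauchyT e h l -
  (expR (- (e * r)))%:C * expi (l * r) * cauchyT e (fun m => h m * expi (- (m * r))) l.
Proof.
move=> e0 r0 ih.
pose Phi (p : R * R) := cind r p.1 * ((expR (- (e * p.1)))%:C * expi (l * p.1)) *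
  (h p.2 * expi (- (p.2 * p.1))).
have mPhi : Cmeas Phi.
  apply: CmeasM; last first.
    by apply: CmeasM; [exact: Cmeas_snd (Cint_meas ih)|exact: Cmeas_expi2].
  exact: (Cmeas_fst (Cmeas_damped e l r)).
have Pab t m : normc (Phi (t, m)) <= `|\1_(`[0, r]%classic : set R) t| * `|normc (h m)|.
  rewrite /Phi/= Normc.normcM; apply: ler_pM; rewrite ?normc_ge0//.
    by apply: (le_trans (normc_damped _ _ _ e0)); exact: ler_norm.
  by rewrite Normc.normcM normc_expi mulr1 ler_norm.
have [_ _ E] := Cfubini mPhi (rint_indic r) (Cint_normc ih) Pab.
have -> : fproj_damped e r h l = Cintegral setT (fun t => Cintegral setT (fun m => Phi (t, m))).
  rewrite /fproj_damped Cintegral_indic; apply: eq_Cintegral => t _.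
  rewrite /Phi/= CintegralZ; last exact: Cint_fourier.
  rewrite -/(cind r t) -/(fourier h t).
  have aux (a b c d : R[i]) : a * (b * (c * d)) = a * (b * d) * c by ring.
  exact: aux.
rewrite {}E.
have E m : Cintegral setT (fun t => Phi (t, m)) =
    h m * ckern e (l - m) - (expR (- (e * r)))%:C * expi (l * r) *
      (h m * expi (- (m * r)) * ckern e (l - m)).
  transitivity (h m * (ckern e (l - m) * (1 - (expR (- (e * r)))%:C * expi ((l - m) * r)))).
    rewrite -Cintegral_damped_expi// (Cintegral_indic `[0, r]) -CintegralZ; last exact: Cint_damped.
    apply: eq_Cintegral => t _; rewrite /Phi/= mulrBl expiD.
    have aux (a b c d k : R[i]) : a * (b * c) * (d * k) = d * (a * (b * (c * k))) by ring.
    exact: aux.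
  rewrite mulrBl expiD.
  have aux (a b c d k : R[i]) : a * (b * (1 - c * (d * k))) = a * b - c * d * (a * k * b) by ring.
  exact: aux.
have -> : Cintegral setT (fun m => Cintegral setT (fun t => Phi (t, m))) =
  Cintegral setT (fun m => h m * ckern e (l - m) -
    (expR (- (e * r)))%:C * expi (l * r) * (h m * expi (- (m * r)) * ckern e (l - m))).
  by apply: eq_Cintegral => m _; exact: E.
have ci := Cint_cauchy_integrand e0 ih l.
have ci' := Cint_cauchy_integrand e0 (Cint_modulated r ih) l.
rewrite CintegralB; [|exact: ci|exact: CintZ ci'].
by rewrite (CintegralZ _ ci').
Qed.

Lemma fproj_damped_bound (e r A B : R) (h : R -> R[i]) m : 0 < e -> 0 < r -> (0 < m)%N ->
  Cint h -> (forall y, normc (h y) <= B) -> (forall y, A < `|y| -> h y = 0) ->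
  (\int[mu]_x (normc (fproj_damped e r h x) ^+ (2 * m))%:E <=
  (2 ^+ (2 * m) * (cauchy_cst m + cauchy_cst m))%:E * \int[mu]_y (normc (h y) ^+ (2 * m))%:E)%E.
Proof.
move=> e0 r0 m0 ih hB hA.
pose k y := h y * expi (- (y * r)).
have ik : Cint k := Cint_modulated r ih.
have nk y : normc (k y) = normc (h y) by rewrite /k Normc.normcM normc_expi mulr1.
have kB y : normc (k y) <= B by rewrite nk.
have kA y : A < `|y| -> k y = 0 by move=> /hA; rewrite /k => ->; rewrite mul0r.
have b1 := cauchyT_bound e0 m0 ih hB hA.
have b2 := cauchyT_bound e0 m0 ik kB kA.
have c0 : 0 <= cauchy_cst m :> R.
  by rewrite /cauchy_cst mulr_ge0 ?exprn_ge0// mulr_ge0// mulr_ge0// exprn_ge0// !mulr_ge0 ?pi_ge0.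
have mT (u : R -> R[i]) : Cint u -> measurable_fun setT (fun x => normc (cauchyT e u x) ^+ (2 * m)).
  by move=> iu; apply: measurable_funX; apply: Cmeas_normc; apply: Cmeas_cauchyT => //; exact: Cint_meas.
have T x : fproj_damped e r h x = cauchyT e h x - (expR (- (e * r)))%:C * expi (x * r) * cauchyT e k x.
  exact: fproj_dampedE.
have n0 (u : R -> R[i]) x : 0 <= normc (u x) ^+ (2 * m) by rewrite exprn_ge0// normc_ge0.
apply: (@le_trans _ _ ((2 ^+ (2 * m))%:E * (\int[mu]_x (normc (cauchyT e h x) ^+ (2 * m))%:E +
   \int[mu]_x (normc (cauchyT e k x) ^+ (2 * m))%:E))%E).
  apply: le_int_lin; [|exact: mT|exact: mT|exact: exprn_ge0|exact: n0|exact: n0|exact: n0|].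
    apply: measurable_funX; apply: Cmeas_normc; rewrite (funext T).
    apply: CmeasB; first exact: Cmeas_cauchyT (Cint_meas ih).
    apply: CmeasM; last exact: Cmeas_cauchyT (Cint_meas ik).
    apply: CmeasM; first exact: Cmeas_cst.
    by apply: Cmeas_expi; exact: measurable_funM.
  move=> x; apply: le_trans (ler_addXn _ (normc_ge0 _) (normc_ge0 _)).
  rewrite lerXn2r ?nnegrE ?addr_ge0 ?normc_ge0// T.
  apply: (le_trans (normcB _ _)); rewrite lerD2l !Normc.normcM normc_expi mulr1 normcR.
  rewrite ger0_norm ?expR_ge0// ler_piMl ?normc_ge0//.
  by rewrite -expR0 ler_expR oppr_le0 mulr_ge0// ltW.
rewrite [X in (_ <= X * _)%E]EFinM -muleA; apply: lee_wpmul2l.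
  by rewrite lee_fin exprn_ge0.
rewrite EFinD ge0_muleDl; [|by rewrite lee_fin|by rewrite lee_fin].
have nkE : (fun y => (normc (k y) ^+ (2 * m))%:E) = (fun y => (normc (h y) ^+ (2 * m))%:E).
  by apply/funext => y; rewrite nk.
rewrite nkE in b2; apply: leeD; [exact: b1|exact: b2].
Qed.

Definition trunc (n : nat) (h : R -> R[i]) (y : R) : R[i] :=
  (\1_(`[(- n.+1%:R : R), n.+1%:R]%classic) y)%:C * h y.

Lemma normc_trunc n h y : normc (trunc n h y) <= normc (h y).
Proof.
rewrite /trunc Normc.normcM normcR indicE ger0_norm//.
by rewrite ler_piMl ?normc_ge0//; case: (y \in _).
Qed.

Lemma Cint_trunc n h : Cint h -> Cint (trunc n h).
Proof.
move=> ih; apply: (Cint_le _ (Cint_normc ih)); last exact: normc_trunc.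
by apply: CmeasM; [apply: CmeasR; exact: measurable_indic|exact: Cint_meas].
Qed.

Lemma trunc_supp n h y : n.+1%:R < `|y| -> trunc n h y = 0.
Proof.
move=> ny; rewrite /trunc indicE memNset ?mul0r//= in_itv/= -ler_norml.
by apply/negP; rewrite -ltNge.
Qed.

Lemma Ccvg_trunc h y : Ccvg (fun n => trunc n h y) (h y).
Proof.
rewrite -[h y]mul1r; apply: CcvgM; last exact: Ccvg_cst.
apply: CcvgR.
by have := @cvg_indic_sym R (fun=> 1) y; under eq_fun do rewrite mul1r.
Qed.

Lemma Ccvg_fourier_trunc h t : Cint h ->
  Ccvg (fun n => fourier (trunc n h) t) (fourier h t).
Proof.
move=> ih; apply: (Cint_dct _ _ (Cint_normc ih)).
- by move=> n; apply: Cint_meas; apply: Cint_fourier; exact: Cint_trunc.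
- exact: Cint_meas (Cint_fourier t ih).
- by move=> y; apply: CcvgM; [exact: Ccvg_trunc|exact: Ccvg_cst].
- by move=> n y; rewrite Normc.normcM normc_expi mulr1 normc_trunc.
Qed.

Lemma cvg_expR_damp (t : R) : (fun n : nat => expR (- (n.+1%:R^-1 * t))) @ \oo --> (1 : R).
Proof.
rewrite -[X in _ --> X]expR0; apply: continuous_cvg; first exact: continuous_expR.
have -> : 0 = - (0 * t) :> R by rewrite mul0r oppr0.
apply: cvgN; apply: cvgM; last exact: cvg_cst.
by have := @cvg_shiftV R 0; under eq_fun do rewrite addr0.
Qed.

(** Damping and truncation are removed along one and the same index; on [[0, r]] the integral norm
    of [h] dominates. *)
Lemma Ccvg_fproj_damped (r : R) h l : Cint h ->
  Ccvg (fun n => fproj_damped n.+1%:R^-1 r (trunc n h) l) (fproj r h l).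
Proof.
move=> ih; rewrite /fproj_damped /fproj Cintegral_indic.
under eq_fun do rewrite Cintegral_indic.
have e0 n : 0 < n.+1%:R^-1 :> R by rewrite invr_gt0.
have iN := rintZ (\int[mu]_x normc (h x)) (rint_indic r).
have mE n : Cmeas (fun t : R => (expR (- (n.+1%:R^-1 * t)))%:C : R[i]).
  apply: CmeasR; apply: measurableT_comp => //; apply: measurable_funN.
  exact: measurable_funM.
apply: (Cint_dct _ _ iN).
- move=> n; apply: CmeasM; first exact: Cmeas_cind.
  apply: CmeasM; first exact: mE.
  by apply: CmeasM; [apply: Cmeas_fourier; exact: Cint_trunc|exact: Cmeas_expiM].
- apply: CmeasM; first exact: Cmeas_cind.
  by apply: CmeasM; [exact: Cmeas_fourier|exact: Cmeas_expiM].
- move=> t; apply: CcvgM; first exact: Ccvg_cst.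
  rewrite -[fourier h t * _]mul1r; apply: CcvgM; first by apply: CcvgR; exact: cvg_expR_damp.
  by apply: CcvgM; [exact: Ccvg_fourier_trunc|exact: Ccvg_cst].
- move=> n t.
  have -> : (\1_(`[0, r]%classic : set R) t)%:C * ((expR (- (n.+1%:R^-1 * t)))%:C *
     (fourier (trunc n h) t * expi (l * t))) =
     fourier (trunc n h) t * (cind r t * ((expR (- (n.+1%:R^-1 * t)))%:C * expi (l * t))).
    have aux (a b c d : R[i]) : a * (b * (c * d)) = c * (a * (b * d)) by ring.
    exact: aux.
  rewrite Normc.normcM; apply: ler_pM; rewrite ?normc_ge0 ?normc_damped//.
  apply: (le_trans (normc_fourier _ (Cint_trunc n ih))).
  apply: le_Rintegral => //; [exact: Cint_normc (Cint_trunc n ih)|exact: Cint_normc|].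
  by move=> x _; exact: normc_trunc.
Qed.

Lemma Cmeas_fproj (r : R) h : Cint h -> Cmeas (fproj r h).
Proof.
move=> ih; pose Phi (p : R * R) := cind r p.2 * (fourier h p.2 * expi (p.1 * p.2)).
have mPhi : Cmeas Phi.
  apply: CmeasM; first exact: Cmeas_snd (Cmeas_cind r).
  apply: CmeasM; first exact: Cmeas_snd (Cmeas_fourier ih).
  apply: Cmeas_expi; apply: measurable_funM; first exact: measurable_fst.
  exact: measurable_snd.
rewrite (_ : fproj r h = fun l => Cintegral setT (fun t => Phi (l, t))).
  exact: Cmeas_int mPhi.
by apply/funext => l; rewrite /fproj Cintegral_indic.
Qed.

(** The constant is chosen before [r], [B] and [h]. The damped estimates are uniform in the
    approximation, so Fatou is enough. *)
Lemma fproj_bound m : (0 < m)%N -> exists2 c : R, 0 <= c & forall (r B : R) (h : R -> R[i]),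
  0 < r -> Cint h -> (forall y, normc (h y) <= B) ->
  (\int[mu]_x (normc (fproj r h x) ^+ (2 * m))%:E <=
  c%:E * \int[mu]_y (normc (h y) ^+ (2 * m))%:E)%E.
Proof.
move=> m0; exists (2 ^+ (2 * m) * (cauchy_cst m + cauchy_cst m)).
  have c0 : 0 <= cauchy_cst m :> R.
    by rewrite /cauchy_cst mulr_ge0 ?exprn_ge0// mulr_ge0// mulr_ge0// exprn_ge0// !mulr_ge0 ?pi_ge0.
  by rewrite mulr_ge0 ?exprn_ge0// addr_ge0.
move=> r B h r0 ih hB.
set c := _ * _.
have c0 : 0 <= c.
  have c0 : 0 <= cauchy_cst m :> R.
    by rewrite /cauchy_cst mulr_ge0 ?exprn_ge0// mulr_ge0// mulr_ge0// exprn_ge0// !mulr_ge0 ?pi_ge0.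
  by rewrite mulr_ge0 ?exprn_ge0// addr_ge0.
have e0 n : 0 < n.+1%:R^-1 :> R by rewrite invr_gt0.
have itr n := Cint_trunc n ih.
have tB n y : normc (trunc n h y) <= B by exact: le_trans (normc_trunc n h y) (hB y).
apply: (@fatou_le _ (fun n x => normc (fproj_damped n.+1%:R^-1 r (trunc n h) x) ^+ (2 * m))).
- move=> n; apply: measurable_funX; apply: Cmeas_normc.
  rewrite (funext (fun x => fproj_dampedE x (e0 n) r0 (itr n))).
  apply: CmeasB; first exact: Cmeas_cauchyT (Cint_meas (itr n)).
  apply: CmeasM; last by apply: Cmeas_cauchyT => //; exact: Cint_meas (Cint_modulated r (itr n)).
  apply: CmeasM; first exact: Cmeas_cst.
  by apply: Cmeas_expi; exact: measurable_funM.
- by move=> n x; rewrite exprn_ge0// normc_ge0.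
- move=> x; apply: (continuous_cvg _ (@exprn_continuous _ _ _)).
  exact: Ccvg_normc (Ccvg_fproj_damped r x ih).
- move=> n; have := fproj_damped_bound (e0 n) r0 m0 (itr n) (tB n) (@trunc_supp n h).
  move=> /le_trans; apply; apply: lee_wpmul2l; first by rewrite lee_fin.
  apply: le_int.
  + by apply: measurable_funX; apply: Cmeas_normc; exact: Cint_meas.
  + by apply: measurable_funX; apply: Cmeas_normc; exact: Cint_meas.
  + by move=> y; rewrite exprn_ge0// normc_ge0.
  + by move=> y; rewrite lerXn2r ?nnegrE ?normc_ge0 ?normc_trunc.
Qed.

End FourierProjection.

(** * The Riesz inequality for conjugate exponents *)

Section RieszDual.
Context {R : realType}.
Local Notation mu := (@lebesgue_measure R).
Local Notation Re := complex.Re.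
Local Notation Im := complex.Im.
Local Notation normc := Normc.normc.

Lemma conjc_mul (z w : R[i]) : conjc (z * w) = conjc z * conjc w.
Proof. by apply: eqcP; case: z => a b; case: w => c d /=; ring. Qed.

Lemma conjc_mulE (z : R[i]) : conjc z * z = (normc z ^+ 2)%:C.
Proof. by rewrite sqr_normc; case: z => a b; apply: eqcP => /=; ring. Qed.

Lemma normc_fproj_integrand (r x t : R) h : Cint h ->
  normc (cind r t * (fourier h t * expi (x * t))) <=
  \int[mu]_x normc (h x) * \1_(`[0, r]%classic : set R) t.
Proof.
move=> ih; rewrite Normc.normcM normc_cind Normc.normcM normc_expi mulr1 mulrC.
by apply: ler_wpM2r; [rewrite indicE|exact: normc_fourier].
Qed.

Lemma Cint_fproj_integrand (r x : R) h : Cint h ->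
  Cint (fun t => cind r t * (fourier h t * expi (x * t))).
Proof.
move=> ih; apply: (Cint_le _ (rintZ _ (rint_indic r))); last first.
  by move=> t; exact: normc_fproj_integrand.
apply: CmeasM; first exact: Cmeas_cind.
by apply: CmeasM; [exact: Cmeas_fourier|exact: Cmeas_expiM].
Qed.

(** A crude bound growing with [r]; it serves only to show that functions are bounded or
    integrable. *)
Lemma normc_fproj (r : R) h l : 0 < r -> Cint h ->
  normc (fproj r h l) <= r * \int[mu]_x normc (h x).
Proof.
move=> r0 ih; rewrite /fproj Cintegral_indic.
have -> : r * \int[mu]_x normc (h x) =
    \int[mu]_t (\int[mu]_x normc (h x) * \1_(`[0, r]%classic : set R) t).
  rewrite RintegralZl//; last exact: rint_indic.
  rewrite mulrC; congr (_ * _).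
  rewrite /Rintegral integral_indic// setIT/= lebesgue_measure_itv/= lte_fin r0.
  by rewrite sube0.
apply: normc_Cintegral_le.
- exact: Cint_meas (Cint_fproj_integrand r l ih).
- by apply: rintZ; exact: rint_indic.
- by move=> t; exact: normc_fproj_integrand.
Qed.

(** The projection is self-adjoint for the sesquilinear pairing; with the bilinear pairing used
    here, conjugations appear. Both sides are exchanged into the same integral over the frequency
    [t]. *)
Lemma fproj_dual (r : R) (h f : R -> R[i]) : 0 < r -> Cint h -> Cint f ->
  Cintegral setT (fun x => f x * fproj r h x) =
  Cintegral setT (fun m => h m * conjc (fproj r (fun x => conjc (f x)) m)).
Proof.
move=> r0 ih jf.
set k := fun x => conjc (f x).
have ik : Cint k := CintJ jf.
have iN := rintZ (\int[mu]_x normc (h x)) (rint_indic r).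
have iM := rintZ (\int[mu]_x normc (k x)) (rint_indic r).
have ind0 t : 0 <= \1_(`[0, r]%classic : set R) t :> R by rewrite indicE.
have mX : Cmeas (fun p : R * R => expi (p.1 * p.2)).
  apply: Cmeas_expi; apply: measurable_funM; first exact: measurable_fst.
  exact: measurable_snd.
pose Phi (p : R * R) := f p.1 * (cind r p.2 * (fourier h p.2 * expi (p.1 * p.2))).
have mPhi : Cmeas Phi.
  apply: CmeasM; first exact: Cmeas_fst (Cint_meas jf).
  apply: CmeasM; first exact: Cmeas_snd (Cmeas_cind r).
  apply: CmeasM; first exact: Cmeas_snd (Cmeas_fourier ih).
  exact: mX.
have Pab x t : normc (Phi (x, t)) <=
    `|normc (f x)| * `|\int[mu]_x normc (h x) * \1_(`[0, r]%classic : set R) t|.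
  rewrite /Phi/= Normc.normcM; apply: ler_pM; rewrite ?normc_ge0 ?ler_norm//.
  by apply: le_trans (ler_norm _); exact: normc_fproj_integrand.
have [_ _ E1] := Cfubini mPhi (Cint_normc jf) iN Pab.
have Kt t : conjc (fourier k t) = Cintegral setT (fun x => f x * expi (x * t)).
  rewrite -CintegralJ; last exact: Cint_fourier.
  apply: eq_Cintegral => x _; rewrite conjc_mul conjc_expi opprK /k.
  by rewrite conjcK.
have Cx x := Cint_fproj_integrand r x ih.
have Cfx t : Cint (fun x => f x * expi (x * t)).
  apply: (CintM jf (B := 1)); last by move=> x; rewrite normc_expi.
  by apply: Cmeas_expi; exact: measurable_funM.
have -> : Cintegral setT (fun x => f x * fproj r h x) =
    Cintegral setT (fun x => Cintegral setT (fun t => Phi (x, t))).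
  apply: eq_Cintegral => x _; rewrite /Phi/= CintegralZ; last exact: Cx.
  by rewrite /fproj Cintegral_indic.
rewrite {}E1.
pose kc t := conjc (fourier k t).
pose Psi (p : R * R) := cind r p.1 * kc p.1 * (h p.2 * expi (- (p.2 * p.1))).
have mPsi : Cmeas Psi.
  apply: CmeasM.
    apply: CmeasM; first exact: Cmeas_fst (Cmeas_cind r).
    exact: (Cmeas_fst (CmeasJ (Cmeas_fourier ik))).
  by apply: CmeasM; [exact: Cmeas_snd (Cint_meas ih)|exact: Cmeas_expi2].
have Pab' t m : normc (Psi (t, m)) <=
    `|\int[mu]_x normc (k x) * \1_(`[0, r]%classic : set R) t| * `|normc (h m)|.
  rewrite /Psi/= Normc.normcM; apply: ler_pM; rewrite ?normc_ge0//.
    apply: le_trans (ler_norm _); rewrite Normc.normcM normc_cind mulrC.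
    apply: ler_wpM2r; first exact: ind0.
    by rewrite /kc normcJ; exact: normc_fourier.
  by rewrite Normc.normcM normc_expi mulr1 ler_norm.
have [_ _ E2] := Cfubini mPsi iM (Cint_normc ih) Pab'.
have -> : Cintegral setT (fun t => Cintegral setT (fun x => Phi (x, t))) =
    Cintegral setT (fun t => Cintegral setT (fun m => Psi (t, m))).
  apply: eq_Cintegral => t _; rewrite /Psi/= [RHS]CintegralZ; last exact: Cint_fourier.
  rewrite -/(fourier h t) /kc Kt -CintegralZ; last exact: Cfx.
  rewrite -CintegralZr; last exact: CintZ (Cfx t).
  apply: eq_Cintegral => x _; rewrite /Phi/=.
  have aux (a b c d : R[i]) : a * (b * (c * d)) = b * (a * d) * c by ring.
  exact: aux.
rewrite {}E2; apply: eq_Cintegral => m _; rewrite /Psi [LHS]/=.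
have Cy := Cint_fproj_integrand r m ik.
rewrite /fproj (Cintegral_indic `[0, r]) -CintegralJ; last exact: Cy.
rewrite -CintegralZ; last exact: CintJ Cy.
apply: eq_Cintegral => t _; rewrite -/(cind r t) !conjc_mul conjc_expi /kc.
have -> : conjc (cind r t) = cind r t by rewrite /cind; apply: eqcP; rewrite //= oppr0.
have aux (a b c d : R[i]) : a * b * (c * d) = c * (a * (b * d)) by ring.
exact: aux.
Qed.

Definition Lint (s : R) (h : R -> R[i]) : \bar R :=
  (\int[mu]_x (normc (h x) `^ s)%:E)%E.

(** Boundedness of [h] is qualitative: [c] does not depend on [B], nor on [r]. Values in the
    extended reals allow either side to be infinite. *)
Definition riesz_exponent (s : R) : Prop :=
  exists2 c : R, 0 <= c & forall (r B : R) (h : R -> R[i]),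
    0 < r -> Cint h -> (forall y, normc (h y) <= B) ->
    (Lint s (fproj r h) <= c%:E * Lint s h)%E.

Lemma riesz_even m : (0 < m)%N -> riesz_exponent (2 * m)%:R.
Proof.
move=> m0; have [c c0 H] := @fproj_bound R m m0; exists c => // r B h r0 ih hB.
rewrite /Lint.
have E (f : R -> R[i]) : (fun x => (normc (f x) `^ (2 * m)%:R)%:E) =
    (fun x => (normc (f x) ^+ (2 * m))%:E).
  by apply/funext => x; rewrite powR_mulrn ?normc_ge0.
by rewrite !E; exact: H r0 ih hB.
Qed.

Lemma young_scaled (a b t p q : R) : 0 <= a -> 0 <= b -> 0 < t <= 1 -> 1 <= p -> 1 <= q ->
  q^-1 + p^-1 = 1 -> a * b <= (t^-1) `^ q * a `^ q + t * b `^ p.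
Proof.
move=> a0 b0 /andP[t0 t1] p1 q1 pq.
have p0 : 0 < p by exact: lt_le_trans p1.
have q0 : 0 < q by exact: lt_le_trans q1.
have -> : a * b = (t^-1 * a) * (t * b) by rewrite mulrACA mulVf ?mul1r// gt_eqF.
have ta : 0 <= t^-1 * a by rewrite mulr_ge0// invr_ge0 ltW.
have tb : 0 <= t * b by rewrite mulr_ge0// ltW.
apply: (le_trans (conjugate_powR ta tb q0 p0 pq)); apply: lerD.
  rewrite powRM ?invr_ge0 ?(ltW t0)//.
  by rewrite ler_piMr ?mulr_ge0 ?powR_ge0// invf_le1.
rewrite powRM ?(ltW t0)//; apply: (@le_trans _ _ (t `^ p * b `^ p)).
  by rewrite ler_piMr ?mulr_ge0 ?powR_ge0// invf_le1.
by rewrite ler_wpM2r ?powR_ge0// ge1r_powR ?t0.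
Qed.

(** At [g = 0] the exponent [q - 2] may be negative or zero; the factor [g] hides the conventional
    value of the power there. *)
Lemma mulr_powRB2 (g q : R) : 0 <= g -> 1 < q -> g `^ (q - 2) * g = g `^ (q - 1).
Proof.
move=> g0 q1; have [->|gn0] := eqVneq g 0.
  by rewrite mulr0 powR0// subr_eq0 gt_eqF.
rewrite -[X in _ * X](powRr1 g0) -powRD; last by rewrite gn0 implybT.
by congr (_ `^ _); ring.
Qed.

Lemma measurable_normc_powR (f : R -> R[i]) s : Cmeas f ->
  measurable_fun setT (fun x => normc (f x) `^ s).
Proof.
by move=> mf; apply: (measurableT_comp (measurable_powR s)); exact: Cmeas_normc.
Qed.

Section dual_test_function.
Variables (r B p q : R) (h : R -> R[i]) (n : nat).
Hypotheses (r0 : 0 < r) (ih : Cint h) (p1 : 1 < p) (q1 : 1 < q).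
Hypothesis pq : q^-1 + p^-1 = 1.

Let N := \int[mu]_x normc (h x).
Let M := r * N.
Let I := (`[(- n.+1%:R : R), n.+1%:R]%classic : set R).
Let g x := normc (fproj r h x).

(** The extremal function of the duality between [L^q] and [L^p], cut off to a bounded window so
    that it is integrable. *)
Definition dual_test (x : R) : R[i] :=
  (\1_I x * g x `^ (q - 2))%:C * conjc (fproj r h x).

Let g0 x : 0 <= g x. Proof. exact: normc_ge0. Qed.
Let gM x : g x <= M. Proof. exact: normc_fproj. Qed.
Let M0 : 0 <= M. Proof. exact: le_trans (g0 0) (gM 0). Qed.
Let i0 x : 0 <= \1_I x :> R. Proof. by rewrite indicE. Qed.
Let mI : measurable_fun setT (\1_I : R -> R).
Proof. by apply: measurable_indic; rewrite /I; exact: measurable_itv. Qed.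
Let iI : rint (\1_I : R -> R). Proof. exact: integrable_indic_itv. Qed.

Lemma normc_dual_test x : normc (dual_test x) = \1_I x * g x `^ (q - 1).
Proof.
rewrite /dual_test Normc.normcM normcJ normcR ger0_norm ?mulr_ge0 ?powR_ge0//.
by rewrite -mulrA mulr_powRB2.
Qed.

Lemma Cmeas_dual_test : Cmeas dual_test.
Proof.
apply: CmeasM; last by apply: CmeasJ; exact: Cmeas_fproj.
apply: CmeasR; apply: measurable_funM => //.
exact: measurable_normc_powR (Cmeas_fproj r ih).
Qed.

Lemma dual_test_bounded x : normc (dual_test x) <= M `^ (q - 1).
Proof.
rewrite normc_dual_test; apply: (@le_trans _ _ (g x `^ (q - 1))).
  by rewrite ler_piMl ?powR_ge0// indicE; case: (x \in _).
by apply: ge0_ler_powR; rewrite ?nnegrE// subr_ge0 ltW.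
Qed.

Lemma Cint_dual_test : Cint dual_test.
Proof.
apply: (Cint_le Cmeas_dual_test (rintZ (M `^ (q - 1)) iI)) => x.
rewrite normc_dual_test mulrC; apply: ler_wpM2r; first exact: i0.
by apply: ge0_ler_powR; rewrite ?nnegrE// subr_ge0 ltW.
Qed.

Lemma dual_testM x : dual_test x * fproj r h x = (\1_I x * g x `^ q)%:C.
Proof.
have G : g x `^ (q - 2) * g x ^+ 2 = g x `^ q.
  by rewrite expr2 mulrA mulr_powRB2// mulrC mulr_powRB1// (lt_trans _ q1).
by rewrite /dual_test -mulrA conjc_mulE -rmorphM -/(g x) -mulrA G.
Qed.

Lemma normc_dual_testX x : normc (dual_test x) `^ p = \1_I x * g x `^ q.
Proof.
have p0 : 0 < p by exact: lt_trans p1.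
have q0 : 0 < q by exact: lt_trans q1.
rewrite normc_dual_test powRM ?powR_ge0// -powRrM.
have qn : q - 1 != 0 by rewrite subr_eq0 gt_eqF.
have qn0 : q != 0 by rewrite gt_eqF.
have -> : (q - 1) * p = q.
  have -> : p = q / (q - 1).
    rewrite -[p]invrK; have -> : p^-1 = 1 - q^-1 by rewrite -pq addrC addKr.
    by field; rewrite qn qn0.
  by field; rewrite qn.
by rewrite indicE; case: (x \in I); rewrite ?powR1// powR0 ?mul0r// gt_eqF.
Qed.

Lemma rint_dual_test : rint (fun x => \1_I x * g x `^ q).
Proof.
apply: (rint_le _ (rintZ (M `^ q) iI)) => [|x].
  by apply: measurable_funM => //; exact: measurable_normc_powR (Cmeas_fproj r ih).
rewrite ger0_norm ?mulr_ge0 ?powR_ge0// mulrC; apply: ler_wpM2r; first exact: i0.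
by apply: ge0_ler_powR; rewrite ?nnegrE// ltW// (lt_trans _ q1).
Qed.

End dual_test_function.

Lemma le_Cintegral_normc (f : R -> R[i]) : Cint f ->
  ((normc (Cintegral setT f))%:E <= \int[mu]_x (normc (f x))%:E)%E.
Proof.
move=> fi; have := normc_Cintegral fi; rewrite -lee_fin /Rintegral fineK//.
exact: integrable_fin_num (Cint_normc fi).
Qed.

Lemma ge0_integralZl_fin (k : R) (f : R -> R) : 0 <= k -> measurable_fun setT f ->
  (forall x, 0 <= f x) ->
  (\int[mu]_x (k * f x)%:E = k%:E * \int[mu]_x (f x)%:E)%E.
Proof.
move=> k0 mf f0; rewrite -ge0_integralZl//.
- exact/measurable_EFinP.
- by move=> x _; rewrite lee_fin.
Qed.

(** The window integral [X] of the power [q] of the projection of [h] is both the pairing with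
    [dual_test] and the integral of the power [p] of [dual_test]. After [fproj_dual], Young and the
    inequality for [p] bound [X] by a multiple of [Lint q h] plus [X / 2]. The window keeps [X]
    finite, so the half is absorbed; Fatou then removes the window. *)
Lemma riesz_dual (p q : R) : 1 < p -> 1 < q -> q^-1 + p^-1 = 1 ->
  riesz_exponent p -> riesz_exponent q.
Proof.
move=> p1 q1 pq [c c0 H].
(* The value ensures [t * c <= 2^-1] together with [t <= 1], also when [c = 0]. *)
pose t := (2 * (c + 1))^-1.
have c1 : 0 < 2 * (c + 1) by rewrite mulr_gt0// ltr_wpDl.
have t0 : 0 < t by rewrite invr_gt0.
have t1 : t <= 1 by rewrite invf_le1//; lra.
have tc : t * c <= 2^-1 by rewrite /t mulrC ler_pdivrMr//; lra.
pose K := (t^-1) `^ q.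
have K0 : 0 <= K by exact: powR_ge0.
exists (2 * K) => [|r B h r0 ih hB]; first by rewrite mulr_ge0.
rewrite {1}/Lint.
have mh := Cint_meas ih.
pose phi n := dual_test r q h n.
pose f_ n x := normc (phi n x) `^ p.
have fE n x : f_ n x = normc (fproj r h x) `^ q * \1_(`[(- n.+1%:R : R), n.+1%:R]%classic) x.
  by rewrite /f_ /phi (normc_dual_testX r h n p1 q1 pq) mulrC.
apply: (@fatou_le _ f_).
- by move=> n; apply: measurable_normc_powR; exact: Cmeas_dual_test.
- by move=> n x; exact: powR_ge0.
- by move=> x; under eq_fun do rewrite fE; exact: (@cvg_indic_sym _ (fun x => normc (fproj r h x) `^ q)).
move=> n.
have iphi : Cint (phi n) := Cint_dual_test n r0 ih q1.
have mphi := Cint_meas iphi.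
pose k x := conjc (phi n x).
have ik : Cint k := CintJ iphi.
have nk x : normc (k x) = normc (phi n x) by rewrite /k normcJ.
pose X := \int[mu]_x (f_ n x).
have rX : rint (f_ n).
  rewrite (_ : f_ n = fun x => \1_(`[(- n.+1%:R : R), n.+1%:R]%classic) x * normc (fproj r h x) `^ q).
    exact: rint_dual_test.
  by apply/funext => x; rewrite fE mulrC.
have XE : (\int[mu]_x (f_ n x)%:E = X%:E)%E.
  by rewrite /X /Rintegral fineK//; exact: integrable_fin_num rX.
have X0 : 0 <= X by apply: Rintegral_ge0 => x _; exact: powR_ge0.
have kB x : normc (k x) <= (r * \int[mu]_x normc (h x)) `^ (q - 1).
  by rewrite nk; exact: dual_test_bounded.
have Hk := H r _ k r0 ik kB.
have LkX : Lint p k = X%:E.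
  by rewrite -XE /Lint; apply: eq_integral => x _; rewrite nk.
rewrite LkX in Hk.
have D := fproj_dual r0 ih iphi.
have XC : Cintegral setT (fun x => phi n x * fproj r h x) = X%:C.
  rewrite (_ : (fun x => phi n x * fproj r h x) = fun x => (f_ n x)%:C); last first.
    by apply/funext => x; rewrite /phi dual_testM// fE mulrC.
  apply: eqcP => //=; by rewrite /Rintegral integral0_eq.
rewrite XC in D.
have jk : Cint (fun m => h m * conjc (fproj r k m)).
  apply: (CintM ih (B := r * \int[mu]_x normc (k x))).
    by apply: CmeasJ; exact: Cmeas_fproj.
  by move=> x; rewrite normcJ; exact: normc_fproj.
have mfk := Cmeas_fproj r ik.
have b1 : (X%:E <= K%:E * Lint q h + t%:E * Lint p (fproj r k))%E.
  have XN : X = normc (X%:C) by rewrite normcR ger0_norm.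
  rewrite {1}XN D; apply: (le_trans (le_Cintegral_normc jk)).
  have Y x : normc (h x * conjc (fproj r k x)) <=
      1 * (K * normc (h x) `^ q + t * normc (fproj r k x) `^ p).
    rewrite mul1r Normc.normcM normcJ; apply: young_scaled; rewrite ?normc_ge0 ?t0 ?t1 ?ltW//.
  have m1 : measurable_fun setT (fun x => K * normc (h x) `^ q).
    by apply: measurable_funM; [exact: measurable_cst|exact: measurable_normc_powR].
  have m2 : measurable_fun setT (fun x => t * normc (fproj r k x) `^ p).
    by apply: measurable_funM; [exact: measurable_cst|exact: measurable_normc_powR].
  apply: (le_trans (le_int_lin (Cmeas_normc (Cint_meas jk)) m1 m2 ler01 _ _ _ Y)).
  - by move=> x; exact: normc_ge0.
  - by move=> x; rewrite mulr_ge0// powR_ge0.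
  - by move=> x; rewrite mulr_ge0 ?powR_ge0// ltW.
  rewrite mul1e; apply: leeD.
    rewrite ge0_integralZl_fin//; [exact: measurable_normc_powR|by move=> x; exact: powR_ge0].
  by rewrite ge0_integralZl_fin ?(ltW t0)//; [exact: measurable_normc_powR|move=> x; exact: powR_ge0].
rewrite XE.
have Y0 : (0 <= Lint q h)%E by apply: integral_ge0 => x _; rewrite lee_fin powR_ge0.
have b2 : (X%:E <= K%:E * Lint q h + (2^-1 * X)%:E)%E.
  apply: (le_trans b1); apply: leeD => //.
  apply: (@le_trans _ _ (t%:E * (c%:E * X%:E))%E); first by apply: lee_wpmul2l; rewrite ?lee_fin ?(ltW t0).
  by rewrite -!EFinM lee_fin mulrA ler_wpM2r.
have Kp : 0 < K by rewrite powR_gt0// invr_gt0.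
move: b2 Y0; case: (Lint q h) => [y| |] //; last first.
  by move=> _ _; rewrite gt0_muley ?leey// lte_fin mulr_gt0.
rewrite -!EFinM -EFinD !lee_fin => b2 y0; lra.
Qed.

End RieszDual.

(** * Derivatives of Fourier integrals *)

Section ContinuousFourier.
Context {R : realType}.
Local Notation mu := (@lebesgue_measure R).
Local Notation Re := complex.Re.
Local Notation Im := complex.Im.
Local Notation normc := Normc.normc.

Definition Ccont (f : R -> R[i]) :=
  continuous (fun x => Re (f x)) /\ continuous (fun x => Im (f x)).

Lemma Ccont_cst z : Ccont (fun=> z).
Proof. by split => x; exact: cvg_cst. Qed.

Lemma CcontD f g : Ccont f -> Ccont g -> Ccont (fun x => f x + g x).
Proof.
move=> [f1 f2] [g1 g2]; split; under eq_fun do rewrite raddfD; move=> x.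
  exact: cvgD (f1 x) (g1 x).
exact: cvgD (f2 x) (g2 x).
Qed.

Lemma CcontM f g : Ccont f -> Ccont g -> Ccont (fun x => f x * g x).
Proof.
move=> [f1 f2] [g1 g2]; split.
  under eq_fun do rewrite ReM; move=> x.
  exact: cvgB (cvgM (f1 x) (g1 x)) (cvgM (f2 x) (g2 x)).
under eq_fun do rewrite ImM; move=> x.
exact: cvgD (cvgM (f1 x) (g2 x)) (cvgM (f2 x) (g1 x)).
Qed.

Lemma CcontN f : Ccont f -> Ccont (fun x => - f x).
Proof.
move=> [f1 f2]; split; under eq_fun do rewrite raddfN; move=> x.
  exact: cvgN (f1 x).
exact: cvgN (f2 x).
Qed.

Lemma CcontB f g : Ccont f -> Ccont g -> Ccont (fun x => f x - g x).
Proof. by move=> cf cg; apply: CcontD => //; exact: CcontN. Qed.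

Lemma Ccont_comp f (g : R -> R) : Ccont f -> continuous g -> Ccont (fun x => f (g x)).
Proof.
move=> [f1 f2] cg; split => x.
  by apply: (@continuous_comp _ _ _ g (fun x => Re (f x))); [exact: cg|exact: f1].
by apply: (@continuous_comp _ _ _ g (fun x => Im (f x))); [exact: cg|exact: f2].
Qed.

Lemma Ccont_expi : Ccont expi.
Proof. by split; [exact: continuous_cos|exact: continuous_sin]. Qed.

Lemma Ccont_meas f : Ccont f -> Cmeas f.
Proof. by move=> [f1 f2]; split; exact: continuous_measurable_fun. Qed.

Lemma Cint_continuous (f : R -> R -> R[i]) (g : R -> R) :
  (forall x, Cmeas (f x)) -> rint g -> (forall y, Ccont (f ^~ y)) ->
  (forall x y, normc (f x y) <= g y) -> Ccont (fun x => Cintegral setT (f x)).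
Proof.
move=> mf ig fc fg; split => /=.
  apply: (Rint_continuous (fun x => (mf x).1) ig (fun y => (fc y).1)) => x y.
  exact: le_trans (Re_le_normc _) (fg x y).
apply: (Rint_continuous (fun x => (mf x).2) ig (fun y => (fc y).2)) => x y.
exact: le_trans (Im_le_normc _) (fg x y).
Qed.

Lemma continuous_mulM (a : R) : continuous (fun x : R => a * x).
Proof. by move=> x; apply: cvgM; [exact: cvg_cst|exact: cvg_id]. Qed.

Lemma Ccont_fourier h : Cint h -> Ccont (fourier h).
Proof.
move=> ih; apply: (Cint_continuous _ (Cint_normc ih)).
- by move=> t; exact: Cint_meas (Cint_fourier t ih).
- move=> m; apply: CcontM; first exact: Ccont_cst.
  apply: (Ccont_comp Ccont_expi) => x; apply: cvgN; exact: continuous_mulM.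
- by move=> t m; rewrite Normc.normcM normc_expi mulr1.
Qed.

Definition Cderiv (f f' : R -> R[i]) := forall x : R,
  is_derive x 1 (fun x => Re (f x)) (Re (f' x)) /\
  is_derive x 1 (fun x => Im (f x)) (Im (f' x)).

Lemma Cderiv_fourier h : Cint h -> Cint (fun m => (0 +i* (- m)) * h m) ->
  Cderiv (fourier h) (fourier (fun m => (0 +i* (- m)) * h m)).
Proof.
move=> ih ih' t.
have dm (m s : R) : is_derive s 1 (fun s : R => m * s) m.
  have D := is_deriveM (is_derive_cst m s 1) (is_derive_id s 1).
  by apply: (is_derive_eq D); rewrite scaler0 addr0 /GRing.scale/= mulr1.
have dc (m s : R) : is_derive s 1 (fun s => cos (- (m * s))) (m * sin (- (m * s))).
  rewrite (_ : (fun s => cos (- (m * s))) = (fun s => cos (m * s))); last first.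
    by apply/funext => u; rewrite cosN.
  have D := @is_derive1_comp _ (@cos R) (fun s => m * s) s _ _ (is_derive_cos _) (dm m s).
  by apply: (is_derive_eq D); rewrite mulrC sinN mulrN.
have ds (m s : R) : is_derive s 1 (fun s => sin (- (m * s))) (- m * cos (- (m * s))).
  rewrite (_ : (fun s => sin (- (m * s))) = - (fun s => sin (m * s))); last first.
    by apply/funext => u; rewrite sinN.
  have D := @is_derive1_comp _ (@sin R) (fun s => m * s) s _ _ (is_derive_sin _) (dm m s).
  by apply: (is_derive_eq (is_deriveN D)); rewrite mulrC cosN mulNr.
have comb (a b m s : R) : is_derive s 1 (fun s => a * cos (- (m * s)) + b * sin (- (m * s)))
    (a * (m * sin (- (m * s))) + b * (- m * cos (- (m * s)))).
  have D1 := is_deriveM (is_derive_cst a s 1) (dc m s).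
  have D2 := is_deriveM (is_derive_cst b s 1) (ds m s).
  have D : is_derive s 1 _ (a * (m * sin (- (m * s))) + cos (- (m * s)) * 0 +
    (b * (- m * cos (- (m * s))) + sin (- (m * s)) * 0)) := is_deriveD D1 D2.
  by apply: (is_derive_eq D); ring.
have nh' m s : normc ((0 +i* - m) * h m * expi (- (m * s))) <= normc ((0 +i* - m) * h m).
  by rewrite Normc.normcM normc_expi mulr1.
split.
- apply: (@Rint_derive _ (fun s m => Re (h m * expi (- (m * s))))
    (fun s m => Re ((0 +i* (- m)) * h m * expi (- (m * s)))) _ _ (Cint_normc ih')).
  + by move=> s; exact: (Cint_fourier s ih).1.
  + move=> s m; rewrite (_ : (fun s => Re (h m * expi (- (m * s)))) =
      (fun s => Re (h m) * cos (- (m * s)) + - Im (h m) * sin (- (m * s)))); last first.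
      by apply/funext => u; rewrite ReM /= mulNr.
    by apply: (is_derive_eq (comb _ _ m s)); rewrite ReM; case: (h m) => a b /=; ring.
  + by move=> s m; exact: le_trans (Re_le_normc _) (nh' m s).
- apply: (@Rint_derive _ (fun s m => Im (h m * expi (- (m * s))))
    (fun s m => Im ((0 +i* (- m)) * h m * expi (- (m * s)))) _ _ (Cint_normc ih')).
  + by move=> s; exact: (Cint_fourier s ih).2.
  + move=> s m; rewrite (_ : (fun s => Im (h m * expi (- (m * s)))) =
      (fun s => Im (h m) * cos (- (m * s)) + Re (h m) * sin (- (m * s)))); last first.
      by apply/funext => u; rewrite ImM /= addrC.
    by apply: (is_derive_eq (comb _ _ m s)); rewrite ImM; case: (h m) => a b /=; ring.
  + by move=> s m; exact: le_trans (Im_le_normc _) (nh' m s).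
Qed.

(** The factor is a power of [- i m], which a derivative in [t] of [expi (- (m * t))] brings
    down. *)
Definition fourier_mult (k : nat) (h : R -> R[i]) (m : R) : R[i] := (0 +i* (- m)) ^+ k * h m.

(** The kernel row agrees with a Fourier integral on [[0, r]] only; agreement on the open interval
    is what survives every derivation. *)
Lemma derive1n_near (a b : R) (f g : R -> R) n : (forall x, a < x < b -> f x = g x) ->
  forall x, a < x < b -> derive1n n f x = derive1n n g x.
Proof.
move=> fg; elim: n => [//|n IH] x xab; rewrite !derive1nS !derive1E.
apply: near_eq_derive.
have /near_in_itvoo : x \in `]a, b[ by rewrite in_itv.
by apply: filterS => y; rewrite in_itv/=; exact: IH.
Qed.

Lemma Cderive1n_fourier k h t : (forall j, (j <= k)%N -> Cint (fourier_mult j h)) ->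
  Cderive1n k (fourier h) t = fourier (fourier_mult k h) t.
Proof.
elim: k t => [|k IH] t ik.
  rewrite /Cderive1n /=.
  rewrite (_ : fourier_mult 0 h = h); last by apply/funext => m; rewrite /fourier_mult expr0 mul1r.
  by apply: eqcP.
have ik' j : (j <= k)%N -> Cint (fourier_mult j h) by move=> jk; apply: ik; rewrite ltnW.
have E : fourier_mult k.+1 h = fun m => (0 +i* (- m)) * fourier_mult k h m.
  by apply/funext => m; rewrite /fourier_mult exprS mulrA.
have d : Cderiv (fourier (fourier_mult k h)) (fourier (fourier_mult k.+1 h)).
  by rewrite E; apply: Cderiv_fourier; [exact: ik'|rewrite -E; exact: ik].
have IH' s := IH s ik'.
have IR : derive1n k (fun y => Re (fourier h y)) = (fun s => Re (fourier (fourier_mult k h) s)).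
  by apply/funext => s; have := congr1 (@complex.Re R) (IH' s).
have II : derive1n k (fun y => Im (fourier h y)) = (fun s => Im (fourier (fourier_mult k h) s)).
  by apply/funext => s; have := congr1 (@complex.Im R) (IH' s).
rewrite /Cderive1n !derive1nS IR II !derive1E.
have [d1 d2] := d t.
by rewrite (@derive_val _ _ _ _ _ _ _ d1) (@derive_val _ _ _ _ _ _ _ d2); apply: eqcP.
Qed.

End ContinuousFourier.

(** * The last row of the resolvent kernel *)

Section KreinKernel.
Context {R : realType}.
Local Notation mu := (@lebesgue_measure R).
Local Notation Re := complex.Re.
Local Notation Im := complex.Im.
Local Notation normc := Normc.normc.

(** The closed interval matters, since the lemma is applied at the endpoint [r]: even there []a, b[]
    has positive length. *)
Lemma ae_itv_dense (P : R -> Prop) (r x e : R) : 0 < r -> 0 < e ->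
  {ae mu, forall y, y \in `[0, r] -> P y} -> x \in `[0, r] ->
  exists y, [/\ y \in `[0, r], `|y - x| < e & P y].
Proof.
move=> r0 e0 aeP; rewrite in_itv/= => /andP[x0 xr].
apply: contrapT => /forallNP nP.
pose a := Num.max 0 (x - e); pose b := Num.min r (x + e).
have ab : a < b by rewrite /a /b gt_max !lt_min; apply/andP; split; apply/andP; split; lra.
have : mu.-negligible `]a, b[%classic.
  apply: negligibleS aeP => y /=; rewrite in_itv/= /a /b gt_max lt_min.
  move=> /andP[/andP[y0 xy] /andP[yr yx]] Py; apply: (nP y).
  have yI : y \in `[0, r] by rewrite in_itv/= !ltW.
  split => //; last exact: Py.
  by rewrite ltr_norml; apply/andP; split; lra.
move/negligibleP => /(_ (measurable_itv _)).
move=> H0; have HL := @lebesgue_measure_itv R `]a, b[.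
rewrite /= lte_fin ab -EFinB in HL.
have : (b - a)%:E = 0%E by rewrite -HL.
by move/eqP; rewrite eqe subr_eq0 gt_eqF.
Qed.

Lemma continuous_ae0 (f : R -> R) (r : R) : 0 < r -> continuous f ->
  {ae mu, forall y, y \in `[0, r] -> f y = 0} ->
  forall x, x \in `[0, r] -> f x = 0.
Proof.
move=> r0 cf ae0 x xr; apply/eqP/negP => /negP fx0.
have /cvgrPdist_lt /(_ `|f x|) := cf x; rewrite normr_gt0 => /(_ fx0) [e /= e0 He].
have [y [yr yx fy]] := ae_itv_dense r0 e0 ae0 xr.
have := He y; rewrite /ball_/= fy subr0 ltxx distrC => /(_ yx); by [].
Qed.

Lemma Ccontinuous_ae0 (f : R -> R[i]) (r : R) : 0 < r -> Ccont f ->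
  {ae mu, forall y, y \in `[0, r] -> f y = 0} ->
  forall x, x \in `[0, r] -> f x = 0.
Proof.
move=> r0 [c1 c2] ae0 x xr; apply: eqcP.
  rewrite (continuous_ae0 r0 c1 _ xr)//.
  by apply: (ae_imp ae0) => y H yr; rewrite H.
rewrite (continuous_ae0 r0 c2 _ xr)//.
by apply: (ae_imp ae0) => y H yr; rewrite H.
Qed.

(** The retraction onto [[0, r]]. Composing with it turns continuity within the square into
    continuity on the plane, so that global lemmas apply to the kernel. *)
Definition clamp (r x : R) : R := Num.min (Num.max x 0) r.

Lemma clamp_itv r x : 0 <= r -> clamp r x \in `[0, r].
Proof. by move=> r0; rewrite in_itv/= /clamp le_min le_max lexx orbT r0/= ge_min lexx orbT. Qed.

Lemma clamp_id r x : x \in `[0, r] -> clamp r x = x.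
Proof.
by rewrite in_itv/= => /andP[x0 xr]; rewrite /clamp (max_idPl x0) (min_idPl xr).
Qed.

Lemma continuous_clamp r : continuous (clamp r).
Proof.
move=> x.
have c1 : {for x, continuous (id : R -> R^o)} by exact: cvg_id.
have c2 (a : R) : {for x, continuous (cst a : R -> R^o)} by exact: cvg_cst.
exact: (continuous_min (continuous_max c1 (c2 0)) (c2 r)).
Qed.

Lemma within_continuous_clamp (F : R * R -> R) (r : R) : 0 <= r ->
  {within `[0, r] `*` `[0, r], continuous F} ->
  forall f : R -> R * R, continuous f ->
  continuous (fun t => F (clamp r (f t).1, clamp r (f t).2)).
Proof.
move=> r0 /subspace_continuousP cF f cft t.
pose phi s := (clamp r (f s).1, clamp r (f s).2).
have Aphi s : (`[0, r]%classic `*` `[0, r]%classic : set (R * R)) (phi s).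
  by split; exact: clamp_itv.
have cphi : phi s @[s --> t] --> phi t.
  have c1 : clamp r (f s).1 @[s --> t] --> clamp r (f t).1.
    apply: (@continuous_comp _ _ _ (fun s => (f s).1) (clamp r)); last exact: continuous_clamp.
    by apply: (@continuous_comp _ _ _ f fst); [exact: cft|exact: cvg_fst].
  have c2 : clamp r (f s).2 @[s --> t] --> clamp r (f t).2.
    apply: (@continuous_comp _ _ _ (fun s => (f s).2) (clamp r)); last exact: continuous_clamp.
    by apply: (@continuous_comp _ _ _ f snd); [exact: cft|exact: cvg_snd].
  exact: (cvg_pair c1 c2).
apply: (@cvg_comp _ _ _ phi F _ (within (`[0, r]%classic `*` `[0, r]%classic) (nbhs (phi t)))).
  move=> U HU; have H : nbhs t (fun s => (`[0, r]%classic `*` `[0, r]%classic) (phi s) -> U (phi s)).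
    exact: (cphi _ HU).
  have : nbhs t (fun s => U (phi s)) by apply: filterS H => s; apply; exact: Aphi.
  exact.
exact: cF.
Qed.

Lemma within_continuous_bounded (F : R * R -> R) (r : R) : 0 <= r ->
  {within `[0, r] `*` `[0, r], continuous F} ->
  exists B : R, forall x y, `|F (clamp r x, clamp r y)| <= B.
Proof.
move=> r0 cF.
have cA : compact (`[0, r]%classic `*` `[0, r]%classic : set (R * R)).
  by apply: compact_setX; exact: segment_compact.
have := continuous_compact cF cA.
move=> /compact_bounded [B [Breal HB]].
exists (B + 1) => x y; apply: (HB (B + 1)); first by rewrite ltrDl.
exists (clamp r x, clamp r y) => //=.
by split; exact: clamp_itv.
Qed.

Lemma L2_on_bounded (r B : R) (g : R -> R[i]) : Cmeas g -> (forall x, normc (g x) <= B) ->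
  L2_on r g.
Proof.
move=> mg gB; split.
- by apply: measurable_funTS; exact: mg.1.
- by apply: measurable_funTS; exact: mg.2.
- apply: (@le_lt_trans _ _ (\int[mu]_(x in `[0%R, r]) (B ^+ 2)%:E)%E).
    apply: ge0_le_integral => //.
    + by move=> x _; rewrite lee_fin exprn_ge0// normc_ge0.
    + by apply/measurable_EFinP; apply: measurable_funTS; apply: measurable_funX; exact: Cmeas_normc.
    + by move=> x _; rewrite lee_fin lerXn2r ?nnegrE ?normc_ge0// (le_trans _ (gB x)) ?normc_ge0.
  rewrite integral_cst//= lte_mul_pinfty ?lee_fin ?sqr_ge0//.
  by rewrite lebesgue_measure_itv/=; case: ifP => _; rewrite ?ltry.
Qed.

End KreinKernel.

(** * The resolvent identity tested against bounded functions *)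

Section KreinRow.
Context {R : realType}.
Local Notation mu := (@lebesgue_measure R).
Local Notation Re := complex.Re.
Local Notation Im := complex.Im.
Local Notation normc := Normc.normc.

Lemma cind_out (r t : R) : t \notin `[0, r] -> cind r t = 0.
Proof. by move=> tr; rewrite /cind indicE memNset//; apply/negP. Qed.

Lemma Cint_cind (r B : R) (f : R -> R[i]) : Cmeas f -> (forall x, normc (f x) <= B) ->
  Cint (fun x => cind r x * f x).
Proof.
move=> mf fB; apply: (Cint_le _ (rintZ B (rint_indic r))).
  by apply: CmeasM => //; exact: Cmeas_cind.
move=> x; rewrite Normc.normcM normc_cind mulrC.
by apply: ler_wpM2r; [rewrite indicE|exact: fB].
Qed.

Variables (w : R -> R) (r : R) (G : R -> R -> R[i]) (NH : R).
Hypothesis r0 : 0 < r.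
Hypothesis cH : Ccont (krein_H w).
Hypothesis HB : forall x, normc (krein_H w x) <= NH.
Hypothesis HG : is_krein_kernel w r G.

Let H := krein_H w.
Let Gc x y := G (clamp r x) (clamp r y).

Lemma Gc_bounded : exists B : R, forall x y, normc (Gc x y) <= B.
Proof.
have [c1 c2 _] := HG.
have [B1 H1] := within_continuous_bounded (ltW r0) c1.
have [B2 H2] := within_continuous_bounded (ltW r0) c2.
exists (B1 + B2) => x y; apply: (le_trans (normc_le_ReIm _)).
by apply: lerD; [exact: H1|exact: H2].
Qed.

Lemma Ccont_Gcl y : Ccont (fun x => Gc x y).
Proof.
have [c1 c2 _] := HG.
have cf : continuous (fun x : R => (x, y)).
  by move=> x; exact: (cvg_pair cvg_id (cvg_cst y)).
split.
  exact: (within_continuous_clamp (ltW r0) c1 cf).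
exact: (within_continuous_clamp (ltW r0) c2 cf).
Qed.

Lemma Ccont_Gcr x : Ccont (Gc x).
Proof.
have [c1 c2 _] := HG.
have cf : continuous (fun y : R => (x, y)).
  by move=> y; exact: (cvg_pair (cvg_cst x) cvg_id).
split.
  exact: (within_continuous_clamp (ltW r0) c1 cf).
exact: (within_continuous_clamp (ltW r0) c2 cf).
Qed.

Lemma Ccont_HBr (a : R) : Ccont (fun y => H (a - y)).
Proof.
apply: (Ccont_comp cH) => y; apply: cvgB; [exact: cvg_cst|exact: cvg_id].
Qed.

Lemma Ccont_HBl (a : R) : Ccont (fun y => H (y - a)).
Proof.
apply: (Ccont_comp cH) => y; apply: cvgB; [exact: cvg_id|exact: cvg_cst].
Qed.

Lemma krein_opE g x : krein_op w r g x =
  Cintegral setT (fun y => cind r y * (H (x - y) * g y)).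
Proof. by rewrite /krein_op /int_op Cintegral_indic. Qed.

Lemma int_op_clampE f x : x \in `[0, r] -> int_op r G f x =
  Cintegral setT (fun y => cind r y * (Gc x y * f y)).
Proof.
move=> xr; rewrite /int_op Cintegral_indic; apply: eq_Cintegral => y _.
rewrite -/(cind r y); have [yr|yr] := boolP (y \in `[0, r]).
  by rewrite /Gc !clamp_id.
by rewrite cind_out// !mul0r.
Qed.

Section test.
Variables (g : R -> R[i]) (B : R).
Hypothesis mg : Cmeas g.
Hypothesis gB : forall x, normc (g x) <= B.

Let Hg := krein_op w r g.

Lemma HgM x y : normc (H (x - y) * g y) <= NH * B.
Proof.
by rewrite Normc.normcM; apply: ler_pM; rewrite ?normc_ge0//; exact: HB.
Qed.

Lemma Cmeas_HgM (x : R) : Cmeas (fun y : R => H (x - y) * g y).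
Proof. by apply: CmeasM => //; exact: Ccont_meas (Ccont_HBr x). Qed.

Lemma dominated_cind (f : R -> R[i]) (M : R) y : (forall y, normc (f y) <= M) ->
  normc (cind r y * f y) <= M * \1_(`[0, r]%classic : set R) y.
Proof.
move=> fM; rewrite Normc.normcM normc_cind mulrC.
by apply: ler_wpM2r; [rewrite indicE|exact: fM].
Qed.

Lemma Ccont_Hg : Ccont Hg.
Proof.
rewrite (_ : Hg = fun x => Cintegral setT (fun y => cind r y * (H (x - y) * g y))); last first.
  by apply/funext => x; exact: krein_opE.
apply: (Cint_continuous _ (rintZ (NH * B) (rint_indic r))).
- by move=> x; apply: CmeasM; [exact: Cmeas_cind|exact: Cmeas_HgM].
- move=> y; apply: CcontM; first exact: Ccont_cst.
  by apply: CcontM; [exact: Ccont_HBl|exact: Ccont_cst].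
- by move=> x y; exact: (dominated_cind y (HgM x)).
Qed.

Lemma Hg_bounded : exists M : R, forall x, normc (Hg x) <= M.
Proof.
exists (\int[mu]_y (NH * B * \1_(`[0, r]%classic : set R) y)) => x.
rewrite /Hg krein_opE; apply: normc_Cintegral_le.
- by apply: CmeasM; [exact: Cmeas_cind|exact: Cmeas_HgM].
- by apply: rintZ; exact: rint_indic.
- by move=> y; exact: (dominated_cind y (HgM x)).
Qed.

(* The equivalence defining the kernel, applied to the pair [g + Hg], [g] and
   evaluated at [r]: both sides are continuous, so the equality holds there. *)
Lemma krein_test : Hg r = Cintegral setT (fun y => cind r y * (Gc r y * (g y + Hg y))).
Proof.
have [M HM] := Hg_bounded; have [BG GB] := Gc_bounded.
pose f x := g x + Hg x.
have mf : Cmeas f by apply: CmeasD => //; exact: Ccont_meas Ccont_Hg.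
have fB x : normc (f x) <= B + M by apply: (le_trans (le_normcD _ _)); exact: lerD.
have GfB x y : normc (Gc x y * f y) <= BG * (B + M).
  by rewrite Normc.normcM; apply: ler_pM; rewrite ?normc_ge0//.
pose E x := Hg x - Cintegral setT (fun y => cind r y * (Gc x y * f y)).
have cE : Ccont E.
  apply: CcontB; first exact: Ccont_Hg.
  apply: (Cint_continuous _ (rintZ (BG * (B + M)) (rint_indic r))).
  - move=> x; apply: CmeasM; first exact: Cmeas_cind.
    by apply: CmeasM => //; exact: Ccont_meas (Ccont_Gcr x).
  - move=> y; apply: CcontM; first exact: Ccont_cst.
    by apply: CcontM; [exact: Ccont_Gcl|exact: Ccont_cst].
  - by move=> x y; exact: (dominated_cind y (GfB x)).
have [_ _ /(_ f g (L2_on_bounded r mf fB) (L2_on_bounded r mg gB)) [K _]] := HG.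
have aeE : eqae_on r g (fun x => f x - int_op r G f x).
  by apply: K; apply: aeW => x.
have E0 : {ae mu, forall x, x \in `[0, r] -> E x = 0}.
  apply: (ae_imp aeE) => x gx xr; have := gx xr; rewrite int_op_clampE// => e.
  have : E x = f x - Cintegral setT (fun y => cind r y * (Gc x y * f y)) - g x.
    by rewrite /E /f; set c := Cintegral _ _; ring.
  by rewrite -e subrr.
have rr : r \in `[0, r] by rewrite in_itv/= lexx ltW.
have := Ccontinuous_ae0 r0 cE E0 rr; rewrite /E => /eqP.
by rewrite subr_eq0 => /eqP.
Qed.

(** The defect of the resolvent identity [G + G H = H] on the row [s = r]. *)
Definition krein_row (y : R) : R[i] :=
  H (r - y) - Gc r y - Cintegral setT (fun z => cind r z * (Gc r z * H (z - y))).

(** Fubini moves the operators in [krein_test] from [g] onto the row, which leaves [g] as a bare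
    factor in front of the defect. *)
Lemma krein_row_test : Cintegral setT (fun y => cind r y * (g y * krein_row y)) = 0.
Proof.
have [M HM] := Hg_bounded; have [BG GB] := Gc_bounded.
pose Phi (p : R * R) := cind r p.1 * (g p.1 * (cind r p.2 * (Gc r p.2 * H (p.2 - p.1)))).
have mGr := Ccont_meas (Ccont_Gcr r).
have mPhi : Cmeas Phi.
  apply: CmeasM; first exact: Cmeas_fst (Cmeas_cind r).
  apply: CmeasM; first exact: Cmeas_fst mg.
  apply: CmeasM; first exact: Cmeas_snd (Cmeas_cind r).
  apply: CmeasM; first exact: Cmeas_snd mGr.
  apply: (Cmeas_comp (Ccont_meas cH)); apply: measurable_funB; [exact: measurable_snd|exact: measurable_fst].
have GHB y z : normc (Gc r z * H (z - y)) <= BG * NH.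
  by rewrite Normc.normcM; apply: ler_pM; rewrite ?normc_ge0//; exact: HB.
have Pab y z : normc (Phi (y, z)) <= `|B * \1_(`[0, r]%classic : set R) y| *
    `|BG * NH * \1_(`[0, r]%classic : set R) z|.
  have -> : Phi (y, z) = (cind r y * g y) * (cind r z * (Gc r z * H (z - y))).
    by rewrite /Phi/= mulrA.
  rewrite Normc.normcM; apply: ler_pM; rewrite ?normc_ge0//.
    by apply: le_trans (ler_norm _); exact: dominated_cind.
  by apply: le_trans (ler_norm _); exact: (dominated_cind z (GHB y)).
have iz y : Cint (fun z => cind r z * (Gc r z * H (z - y))).
  apply: (@Cint_cind _ (BG * NH)); last by move=> z; exact: GHB.
  by apply: CmeasM => //; exact: Ccont_meas (Ccont_HBl y).
have E1 y : Cintegral setT (fun z => Phi (y, z)) =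
    cind r y * (g y * Cintegral setT (fun z => cind r z * (Gc r z * H (z - y)))).
  rewrite mulrA -CintegralZ; last exact: iz.
  by apply: eq_Cintegral => z _; rewrite /Phi/= mulrA.
have iHg z : Cint (fun y => cind r y * (H (z - y) * g y)).
  by apply: (@Cint_cind _ (NH * B)); [exact: Cmeas_HgM|move=> y; exact: HgM].
have E2 z : Cintegral setT (fun y => Phi (y, z)) = cind r z * (Gc r z * Hg z).
  rewrite mulrA /Hg krein_opE -CintegralZ; last exact: iHg.
  apply: eq_Cintegral => y _; rewrite /Phi [LHS]/=.
  have aux (a b c d k : R[i]) : a * (b * (c * (d * k))) = c * d * (a * (k * b)) by ring.
  exact: aux.
have i2 : Cint (fun y => cind r y * (Gc r y * g y)).
  apply: (@Cint_cind _ (BG * B)); first exact: CmeasM.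
  by move=> y; rewrite Normc.normcM; apply: ler_pM; rewrite ?normc_ge0.
have i3 : Cint (fun y => cind r y * (Gc r y * Hg y)).
  apply: (@Cint_cind _ (BG * M)); first by apply: CmeasM => //; exact: Ccont_meas Ccont_Hg.
  by move=> y; rewrite Normc.normcM; apply: ler_pM; rewrite ?normc_ge0.
have [i1 _ E] := Cfubini mPhi (rintZ B (rint_indic r)) (rintZ (BG * NH) (rint_indic r)) Pab.
have := krein_test.
have -> : Cintegral setT (fun y => cind r y * (Gc r y * (g y + Hg y))) =
    Cintegral setT (fun y => cind r y * (Gc r y * g y)) + Cintegral setT (fun y => cind r y * (Gc r y * Hg y)).
  by rewrite -(CintegralD i2 i3); apply: eq_Cintegral => y _; rewrite mulrDr mulrDr.
have -> : Cintegral setT (fun y => cind r y * (Gc r y * Hg y)) =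
    Cintegral setT (fun y => Cintegral setT (fun z => Phi (y, z))).
  by rewrite E; apply: eq_Cintegral => y _; rewrite E2.
rewrite {1}/Hg krein_opE => Hr.
have -> : Cintegral setT (fun y => cind r y * (g y * krein_row y)) =
  Cintegral setT (fun y => cind r y * (H (r - y) * g y)) -
  Cintegral setT (fun y => cind r y * (Gc r y * g y)) -
  Cintegral setT (fun y => Cintegral setT (fun z => Phi (y, z))).
  rewrite -(CintegralB (iHg r) i2) -(CintegralB (CintB (iHg r) i2) i1).
  apply: eq_Cintegral => y _; rewrite E1 /krein_row.
  have aux (a b c d k : R[i]) : a * (b * (c - d - k)) = a * (c * b) - a * (d * b) - a * (b * k) by ring.
  exact: aux.
rewrite Hr.
have aux (a b : R[i]) : a + b - a - b = 0 by ring.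
exact: aux.
Qed.

End test.

End KreinRow.

(** * The row as a Fourier transform *)

Section KreinEquation.
Context {R : realType}.
Local Notation mu := (@lebesgue_measure R).
Local Notation Re := complex.Re.
Local Notation Im := complex.Im.
Local Notation normc := Normc.normc.

Lemma ae0_of_sqr_integral (r : R) (f : R -> R[i]) : Cmeas f ->
  Cint (fun y => cind r y * (conjc (f y) * f y)) ->
  Cintegral setT (fun y => cind r y * (conjc (f y) * f y)) = 0 ->
  {ae mu, forall y, y \in `[0, r] -> f y = 0}.
Proof.
move=> mf fi f0.
pose q y : R := \1_(`[0, r]%classic : set R) y * normc (f y) ^+ 2.
have E : (fun y => cind r y * (conjc (f y) * f y)) = (fun y => (q y)%:C).
  by apply/funext => y; rewrite conjc_mulE /cind /q -rmorphM.
rewrite E in fi f0.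
have q0 y : 0 <= q y by rewrite /q mulr_ge0 ?sqr_ge0// indicE.
have iq : rint q by exact: fi.1.
have I0 : (\int[mu]_x `|(q x)%:E| = 0)%E.
  have R0 : \int[mu]_x q x = 0 by exact: (congr1 (@complex.Re R) f0).
  under eq_integral do rewrite gee0_abs ?lee_fin//.
  have := congr1 EFin R0; rewrite /Rintegral fineK//; exact: integrable_fin_num iq.
have /(ae_eq_integral_abs mu measurableT (measurable_int mu iq)) := I0.
move=> ae; apply: (ae_imp ae) => y /(_ Logic.I) [] + yr.
rewrite /q indicE mem_set// mul1r => /eqP; rewrite sqrf_eq0 normc_eq0 => /eqP.
exact.
Qed.

Section row.
Variables (w : R -> R) (r : R) (G : R -> R -> R[i]) (NH : R).
Hypothesis r0 : 0 < r.
Hypothesis cH : Ccont (krein_H w).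
Hypothesis HB : forall x, normc (krein_H w x) <= NH.
Hypothesis HG : is_krein_kernel w r G.

Lemma krein_row_bounded : exists B : R, forall y, normc (krein_row w r G y) <= B.
Proof.
have [BG GB] := Gc_bounded r0 HG.
have mGr := Ccont_meas (Ccont_Gcr r0 HG r).
exists (NH + BG + \int[mu]_z (BG * NH * \1_(`[0, r]%classic : set R) z)) => y.
rewrite /krein_row; apply: (le_trans (normcB _ _)); apply: lerD.
  by apply: (le_trans (normcB _ _)); apply: lerD; [exact: HB|exact: GB].
have GHB z : normc (G (clamp r r) (clamp r z) * krein_H w (z - y)) <= BG * NH.
  by rewrite Normc.normcM; apply: ler_pM; rewrite ?normc_ge0.
apply: normc_Cintegral_le.
- apply: CmeasM; first exact: Cmeas_cind.
  by apply: CmeasM; [exact: mGr|exact: Ccont_meas (Ccont_HBl cH y)].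
- by apply: rintZ; exact: rint_indic.
- by move=> z; exact: (dominated_cind r z GHB).
Qed.

Lemma Ccont_krein_row : Ccont (krein_row w r G).
Proof.
have [BG GB] := Gc_bounded r0 HG.
have mGr := Ccont_meas (Ccont_Gcr r0 HG r).
have GHB y z : normc (G (clamp r r) (clamp r z) * krein_H w (z - y)) <= BG * NH.
  by rewrite Normc.normcM; apply: ler_pM; rewrite ?normc_ge0.
apply: CcontB.
  exact: (CcontB (Ccont_HBr cH r) (Ccont_Gcr r0 HG r)).
apply: (Cint_continuous _ (rintZ (BG * NH) (rint_indic r))).
- move=> y; apply: CmeasM; first exact: Cmeas_cind.
  by apply: CmeasM; [exact: mGr|exact: Ccont_meas (Ccont_HBl cH y)].
- move=> z; apply: CcontM; first exact: Ccont_cst.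
  exact: (CcontM (Ccont_cst _) (Ccont_HBr cH z)).
- by move=> y z; exact: (dominated_cind r z (GHB y)).
Qed.

(** The conjugate of the defect is itself an admissible test function, so the square integral of the
    defect vanishes; continuity turns almost everywhere into everywhere. *)
Lemma krein_row0 t : t \in `[0, r] -> krein_row w r G t = 0.
Proof.
have [B HBr] := krein_row_bounded.
have cR := Ccont_krein_row.
have mR := Ccont_meas cR.
have cB x : normc (conjc (krein_row w r G x)) <= B by rewrite normcJ; exact: HBr.
have T0 := krein_row_test r0 cH HB HG (CmeasJ mR) cB.
apply: (Ccontinuous_ae0 r0 cR).
apply: (ae0_of_sqr_integral mR _ T0).
apply: (@Cint_cind _ r (B * B)).
  exact: CmeasM (CmeasJ mR) mR.
move=> y; rewrite Normc.normcM normcJ.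
by apply: ler_pM; [exact: normc_ge0|exact: normc_ge0|exact: HBr|exact: HBr].
Qed.

End row.

Section equation.
Variables (w v : R -> R) (r c0 : R) (G : R -> R -> R[i]).
Let V (l : R) : R[i] := (v l)%:C.
Hypothesis r0 : 0 < r.
Hypothesis iv : rint v.
Hypothesis Hw : forall x, krein_H w x = c0%:C * fourier V (- x).
Hypothesis HG : is_krein_kernel w r G.

Definition row_transform (l : R) : R[i] := Cintegral `[0, r] (fun z => G r z * expi (l * z)).

(** The density [h] of the overview without its factor [(2 pi)^-1], which is carried separately as
    [c0]. *)
Definition row_density (l : R) : R[i] := V l * (expi (l * r) - row_transform l).

Let iV : Cint V.
Proof.
apply: CintP; first exact: CmeasR (rint_meas iv).
by rewrite /V; under eq_fun do rewrite normcR; exact: rint_norm.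
Qed.

Let cH : Ccont (krein_H w).
Proof.
rewrite (funext Hw); apply: CcontM; first exact: Ccont_cst.
apply: (Ccont_comp (Ccont_fourier iV)) => x; apply: cvgN; exact: cvg_id.
Qed.

Let NH := `|c0| * \int[mu]_x normc (V x).

Let HB x : normc (krein_H w x) <= NH.
Proof.
rewrite Hw Normc.normcM normcR; apply: ler_wpM2l; first exact: normr_ge0.
exact: normc_fourier.
Qed.

Let Gr (z : R) := G (clamp r r) (clamp r z).

Let mGr : Cmeas Gr. Proof. exact: Ccont_meas (Ccont_Gcr r0 HG r). Qed.

Let rr : r \in `[0, r]. Proof. by rewrite in_itv/= lexx ltW. Qed.

Lemma row_transformE l : row_transform l = Cintegral setT (fun z => cind r z * (Gr z * expi (l * z))).
Proof.
rewrite /row_transform Cintegral_indic; apply: eq_Cintegral => z _.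
rewrite -/(cind r z); have [zr|zr] := boolP (z \in `[0, r]).
  by rewrite /Gr !clamp_id.
by rewrite cind_out// !mul0r.
Qed.

Lemma row_transform_bounded : exists M : R, forall l, normc (row_transform l) <= M.
Proof.
have [BG GB] := Gc_bounded r0 HG.
exists (\int[mu]_z (BG * \1_(`[0, r]%classic : set R) z)) => l.
rewrite row_transformE; apply: normc_Cintegral_le.
- by apply: CmeasM; [exact: Cmeas_cind|apply: CmeasM => //; exact: Cmeas_expiM].
- by apply: rintZ; exact: rint_indic.
- move=> z; have GE y : normc (Gr y * expi (l * y)) <= BG.
    by rewrite Normc.normcM normc_expi mulr1; exact: GB.
  exact: (dominated_cind r z GE).
Qed.

Lemma Cmeas_row_transform : Cmeas row_transform.
Proof.
pose F (p : R * R) := cind r p.2 * (Gr p.2 * expi (p.1 * p.2)).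
have mF : Cmeas F.
  apply: CmeasM; first exact: Cmeas_snd (Cmeas_cind r).
  apply: CmeasM; first exact: Cmeas_snd mGr.
  apply: Cmeas_expi; apply: measurable_funM; [exact: measurable_fst|exact: measurable_snd].
rewrite (_ : row_transform = fun l => Cintegral setT (fun z => F (l, z))).
  exact: Cmeas_int mF.
by apply/funext => l; rewrite row_transformE.
Qed.

Lemma row_density_bounded : exists2 M : R, 0 <= M & forall l, normc (row_density l) <= `|v l| * M.
Proof.
have [M HM] := row_transform_bounded.
exists (1 + M); first by rewrite addr_ge0// (le_trans (normc_ge0 _) (HM 0)).
move=> l; rewrite /row_density Normc.normcM /V normcR; apply: ler_wpM2l => //.
by apply: (le_trans (normcB _ _)); rewrite normc_expi lerD2l.
Qed.

Lemma Cint_row_density : Cint row_density.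
Proof.
have [M _ HM] := row_density_bounded.
apply: (Cint_le _ (rintZ M (rint_norm iv))); last by move=> l; rewrite mulrC; exact: HM.
apply: CmeasM; first exact: Cint_meas iV.
apply: CmeasB; last exact: Cmeas_row_transform.
by apply: Cmeas_expi; exact: measurable_funM.
Qed.

(** The Fourier representation of [krein_H] is inserted in the vanishing defect. The term
    [H (r - t)] contributes [V l * expi (l * r)] to the density and, after Fubini, the integral term
    contributes [V l * row_transform l]. *)
Lemma krein_rowE t : t \in `[0, r] -> G r t = c0%:C * fourier row_density t.
Proof.
move=> tr; have [BG GB] := Gc_bounded r0 HG.
pose F (p : R * R) := (cind r p.1 * Gr p.1) * (V p.2 * expi (- (p.2 * - (p.1 - t)))).
have mF : Cmeas F.
  apply: CmeasM.
    by apply: CmeasM; [exact: Cmeas_fst (Cmeas_cind r)|exact: Cmeas_fst mGr].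
  apply: CmeasM; first exact: Cmeas_snd (Cint_meas iV).
  apply: Cmeas_expi; apply: measurable_funN; apply: measurable_funM; first exact: measurable_snd.
  apply: measurable_funN; apply: measurable_funB; [exact: measurable_fst|exact: measurable_cst].
have Fab z l : normc (F (z, l)) <= `|BG * \1_(`[0, r]%classic : set R) z| * `|normc (V l)|.
  rewrite /F [X in normc X]/= Normc.normcM; apply: ler_pM; rewrite ?normc_ge0//.
    apply: le_trans (ler_norm _); exact: (dominated_cind r z (GB r)).
  by rewrite Normc.normcM normc_expi mulr1 ler_norm.
have iz l : Cint (fun z => cind r z * (Gr z * expi (l * z))).
  apply: (@Cint_cind _ r BG); first by apply: CmeasM => //; exact: Cmeas_expiM.
  by move=> z; rewrite Normc.normcM normc_expi mulr1; exact: GB.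
have iX : Cint (fun l => V l * expi (l * r) * expi (- (l * t))).
  apply: (CintM (B := 1)); last by move=> l; rewrite normc_expi.
    apply: (CintM iV (B := 1)); last by move=> l; rewrite normc_expi.
    by apply: Cmeas_expi; exact: measurable_funM.
  by apply: Cmeas_expi; apply: measurable_funN; exact: measurable_funM.
have E2 l : Cintegral setT (fun z => F (z, l)) = V l * row_transform l * expi (- (l * t)).
  rewrite row_transformE mulrAC -CintegralZ; last exact: iz.
  apply: eq_Cintegral => z _; rewrite /F [LHS]/=.
  have -> : - (l * - (z - t)) = - (l * t) + l * z by ring.
  rewrite expiD.
  have aux (a b c d k : R[i]) : a * b * (c * (d * k)) = c * d * (a * (b * k)) by ring.
  exact: aux.
have K0 := krein_row0 r0 cH HB HG tr.
rewrite /krein_row [clamp r t]clamp_id// in K0.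
have aux0 (a b c : R[i]) : a - b - c = 0 -> b = a - c.
  by move=> abc; rewrite -[a](subrK b) -addrA [b - c]addrC addrA abc add0r.
rewrite [clamp r r]clamp_id// in K0; rewrite (aux0 _ _ _ K0); clear K0 aux0.
have [i1 i2 E] := Cfubini mF (rintZ BG (rint_indic r)) (Cint_normc iV) Fab.
have -> : Cintegral setT (fun z => cind r z * (G r (clamp r z) * krein_H w (z - t))) =
    c0%:C * Cintegral setT (fun z => Cintegral setT (fun l => F (z, l))).
  rewrite -CintegralZ; last exact: i1.
  apply: eq_Cintegral => z _; rewrite Hw /F [in RHS]/= CintegralZ; last exact: Cint_fourier.
  rewrite -/(fourier V (- (z - t))) /Gr (clamp_id rr).
  have aux (a b c d : R[i]) : a * (b * (c * d)) = c * (a * b * d) by ring.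
  exact: aux.
rewrite {}E Hw -mulrBr; congr (_ * _).
have -> : fourier V (- (r - t)) = Cintegral setT (fun l => V l * expi (l * r) * expi (- (l * t))).
  apply: eq_Cintegral => l _; have -> : - (l * - (r - t)) = l * r + - (l * t) by ring.
  by rewrite expiD mulrA.
rewrite -(CintegralB iX i2); apply: eq_Cintegral => l _; rewrite E2 /row_density.
have aux (a b c d : R[i]) : a * b * c - a * d * c = a * (b - d) * c by ring.
exact: aux.
Qed.

End equation.
End KreinEquation.

(** * Estimates of the remainder *)

Section KreinRemainder.
Context {R : realType}.
Local Notation mu := (@lebesgue_measure R).
Local Notation Re := complex.Re.
Local Notation Im := complex.Im.
Local Notation normc := Normc.normc.

(** The two-sided derivative has no meaning at [0] and [r]; these points carry no mass. *)
Lemma Cintegral_itv_interior (r : R) (f g : R -> R[i]) : Cmeas g ->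
  (forall t, 0 < t < r -> f t = g t) ->
  Cintegral `[0, r] f = Cintegral `[0, r] g.
Proof.
move=> [g1 g2] fg.
have E (a b : R -> R) : measurable_fun setT b -> (forall t, 0 < t < r -> a t = b t) ->
    \int[mu]_(x in `[0, r]) a x = \int[mu]_(x in `[0, r]) b x.
  move=> mb ab; have mb' : measurable_fun `]0, r[ b := measurable_funTS mb.
  congr fine; apply: eq_integral_itv_bounded => //.
    apply: eq_measurable_fun mb' => t; rewrite inE/= in_itv/= => tr.
    by rewrite ab.
by apply: eqcP; apply: E => // t /fg ->.
Qed.

Lemma normc_i : normc ('i%C : R[i]) = 1.
Proof. by rewrite /Normc.normc/= expr0n/= add0r expr1n sqrtr1. Qed.

Lemma krein_remainder_fproj (w : R -> R) (k : nat) (r l : R) (h : R -> R[i]) :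
  (forall j, (j <= k)%N -> Cint (fourier_mult j h)) ->
  (forall t, t \in `[0, r] -> krein_Gamma w r r t = fourier h t) ->
  normc (krein_remainder w k r l) = normc (fproj r (fourier_mult k h) l).
Proof.
move=> ih GE; rewrite /krein_remainder Normc.normcM.
have -> : normc (- ('i%C ^+ k) : R[i]) = 1.
  by rewrite normcN normcX normc_i expr1n.
rewrite mul1r; congr (normc _); apply: Cintegral_itv_interior.
  by apply: CmeasM; [exact: Cmeas_fourier (ih k (leqnn k))|exact: Cmeas_expiM].
move=> t tr; congr (_ * _); rewrite -(Cderive1n_fourier t ih).
have I s : 0 < s < r -> s \in `[0, r].
  by move=> /andP[s0 sr]; rewrite in_itv/= !ltW.
apply: eqcP; apply: (derive1n_near (a := 0) (b := r)) => // s /I /GE -> //.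
Qed.

(** If the defining set is empty, [xget] returns the zero kernel, all of whose derivatives vanish;
    this settles one branch of [krein_remainder_density]. *)
Lemma krein_remainder_default (w : R -> R) (k : nat) (r l : R) :
  ~ (exists G, is_krein_kernel w r G) -> krein_remainder w k r l = 0.
Proof.
move=> nG; rewrite /krein_remainder.
have -> : krein_Gamma w r = fun _ _ => 0.
  by rewrite /krein_Gamma; case: xgetP => // G _ HG; case: nG; exists G.
have D0 (n : nat) : derive1n n (fun=> 0 : R) = fun=> 0.
  elim: n => [//|n IH]; apply/funext => t.
  by rewrite derive1nS IH derive1_cst.
rewrite (_ : (fun t => _) = fun=> 0); last first.
  apply/funext => t; rewrite /Cderive1n [X in X * _](_ : _ = 0) ?mul0r//.
  by apply: eqcP; rewrite [LHS]/= D0.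
by rewrite Cintegral0 mulr0.
Qed.

(** Once the row is the Fourier transform of [h] on [[0, r]], [row_transform] is [fproj r h], and
    the formula for [h] becomes a fixed-point equation. *)
Lemma krein_row_fourier (w v : R -> R) (r c0 : R) (G : R -> R -> R[i]) :
  0 < r -> rint v -> (forall x, krein_H w x = c0%:C * fourier (fun l => (v l)%:C) (- x)) ->
  is_krein_kernel w r G ->
  exists h : R -> R[i], [/\ Cint h, forall t, t \in `[0, r] -> G r t = fourier h t &
    forall l, h l = c0%:C * ((v l)%:C * (expi (l * r) - fproj r h l))].
Proof.
move=> r0 iv Hw HG.
have id := Cint_row_density r0 iv HG.
pose h l := c0%:C * row_density v r G l.
have GE t : t \in `[0, r] -> G r t = fourier h t.
  move=> tr; rewrite (krein_rowE r0 iv Hw HG tr) /fourier -CintegralZ; last exact: Cint_fourier.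
  by apply: eq_Cintegral => m _; rewrite mulrA.
exists h; split => //; first exact: CintZ.
move=> l; rewrite /h /row_density; congr (_ * (_ * (_ - _))).
apply: eq_Cintegral => t; rewrite inE/= => tr; congr (_ * _); exact: GE.
Qed.

(* [Lint s h] is finite because [h] is bounded and integrable, which allows the
   term in [Lint s h] to be absorbed on the left. *)
Lemma fixed_point_Lint (s c d r K : R) (u : R -> R) (h g : R -> R[i]) : 1 < s -> 0 <= c ->
  (forall r B h, 0 < r -> Cint h -> (forall y, normc (h y) <= B) ->
    (Lint s (fproj r h) <= c%:E * Lint s h)%E) ->
  0 < r -> rint u -> (forall x, 0 <= u x <= d) -> (\int[mu]_x (u x)%:E <= K%:E)%E ->
  Cint h -> Cint g ->
  (forall x, normc (h x) <= u x * (1 + normc (fproj r h x))) ->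
  (forall x, normc (g x) <= u x * (1 + normc (fproj r h x))) ->
  c * 2 `^ s * d `^ s <= 2^-1 ->
  (Lint s (fproj r g) <= (c * (2 * 2 `^ s) * d `^ (s - 1) * K)%:E)%E.
Proof.
move=> s1 c0 Hc r0 iu ud uK ih ig hu gu cd.
have s0 : 0 < s by exact: lt_trans s1.
have u0 x : 0 <= u x by have /andP[] := ud x.
have uled x : u x <= d by have /andP[] := ud x.
have d0 : 0 <= d := le_trans (u0 0) (uled 0).
set A := fproj r h.
have mA : Cmeas A := Cmeas_fproj r ih.
pose M := r * \int[mu]_x normc (h x).
have AM x : normc (A x) <= M := normc_fproj _ r0 ih.
have M0 : 0 <= M := le_trans (normc_ge0 _) (AM 0).
have bd (f : R -> R[i]) : (forall x, normc (f x) <= u x * (1 + normc (A x))) ->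
    forall x, normc (f x) <= d * (1 + M).
  move=> fu x; apply: (le_trans (fu x)); apply: ler_pM => //.
    by rewrite addr_ge0 ?normc_ge0.
  by rewrite lerD2l.
have mu_ : measurable_fun setT (fun x => u x `^ s).
  by apply: (measurableT_comp (measurable_powR s)); exact: rint_meas.
pose U := (\int[mu]_x (u x `^ s)%:E)%E.
(* One factor of [u] is kept for the integral bound and the remaining power is estimated by [d];
   since [s > 1], this leaves a positive power of [d]. *)
have UK : (U <= (d `^ (s - 1) * K)%:E)%E.
  apply: (@le_trans _ _ (\int[mu]_x (d `^ (s - 1) * u x)%:E)%E).
    apply: le_int => //.
    - by apply: measurable_funM => //; exact: rint_meas.
    - by move=> x; exact: powR_ge0.
    - move=> x; rewrite -(mulr_powRB1 (u0 x) s0) mulrC; apply: ler_wpM2r => //.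
      by apply: ge0_ler_powR; rewrite ?nnegrE// subr_ge0 ltW.
  rewrite ge0_integralZl_fin ?powR_ge0//; last exact: rint_meas.
  by rewrite EFinM; apply: lee_wpmul2l; rewrite ?lee_fin ?powR_ge0.
have Lf (f : R -> R[i]) : Cint f -> (forall x, normc (f x) <= u x * (1 + normc (A x))) ->
    (Lint s f <= (2 `^ s)%:E * (U + (d `^ s)%:E * Lint s A))%E.
  move=> jf fu; rewrite /Lint.
  rewrite -(ge0_integralZl_fin (powR_ge0 d s) (measurable_normc_powR s mA)); last first.
    by move=> x; exact: powR_ge0.
  apply: le_int_lin => //.
  - exact: measurable_normc_powR (Cint_meas jf).
  - apply: measurable_funM; first exact: measurable_cst.
    exact: measurable_normc_powR.
  - by move=> x; exact: powR_ge0.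
  - by move=> x; exact: powR_ge0.
  - by move=> x; rewrite mulr_ge0 ?powR_ge0.
  move=> x; apply: (@le_trans _ _ ((u x * (1 + normc (A x))) `^ s)).
    apply: ge0_ler_powR; [exact: ltW|exact: normc_ge0| |exact: fu].
    by rewrite nnegrE mulr_ge0 ?addr_ge0 ?normc_ge0.
  have a0 := normc_ge0 (A x); set a := normc (A x) in a0 *.
  rewrite powRM ?addr_ge0//.
  have H1 : (1 + a) `^ s <= 2 `^ s * (1 + a `^ s).
    pose m := Num.max 1 a.
    apply: (@le_trans _ _ ((2 * m) `^ s)).
      have m1 : 1 <= m by rewrite /m le_max lexx.
      have ma : a <= m by rewrite /m le_max lexx orbT.
      apply: ge0_ler_powR; rewrite ?nnegrE; [exact: ltW|exact: addr_ge0|lra|lra].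
    rewrite powRM//; last by rewrite /m le_max ler01.
    apply: ler_wpM2l; first exact: powR_ge0.
    rewrite /m; case: (leP a 1) => _; first by rewrite powR1 lerDl powR_ge0.
    by rewrite lerDr.
  apply: (@le_trans _ _ (u x `^ s * (2 `^ s * (1 + a `^ s)))).
    by apply: ler_wpM2l => //; exact: powR_ge0.
  rewrite mulrCA; apply: ler_wpM2l; first exact: powR_ge0.
  rewrite mulrDr mulr1 lerD2l; apply: ler_wpM2r; first exact: powR_ge0.
  by apply: ge0_ler_powR; rewrite ?nnegrE// ltW.
have h_fin : (Lint s h < +oo)%E.
  apply: (@le_lt_trans _ _ (\int[mu]_x ((d * (1 + M)) `^ (s - 1) * normc (h x))%:E)%E).
    apply: le_int.
    - exact: measurable_normc_powR (Cint_meas ih).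
    - by apply: measurable_funM => //; exact: Cmeas_normc (Cint_meas ih).
    - by move=> x; exact: powR_ge0.
    - move=> x; rewrite -(mulr_powRB1 (normc_ge0 _) s0) mulrC; apply: ler_wpM2r; first exact: normc_ge0.
      apply: ge0_ler_powR; rewrite ?nnegrE ?normc_ge0 ?subr_ge0 ?(ltW s1)//.
        by rewrite mulr_ge0// addr_ge0.
      exact: bd hu x.
  have := integrable_lty measurableT (rintZ ((d * (1 + M)) `^ (s - 1)) (Cint_normc ih)).
  exact.
have P0 (f : R -> R[i]) : (0 <= Lint s f)%E by apply: integral_ge0 => x _; rewrite lee_fin powR_ge0.
have U0 : (0 <= U)%E by apply: integral_ge0 => x _; rewrite lee_fin powR_ge0.
have HA := Hc r _ h r0 ih (bd h hu).
have Hg := Hc r _ g r0 ig (bd g gu).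
have L1 := Lf h ih hu.
have L2 := Lf g ig gu.
apply: (le_trans Hg).
rewrite -!mulrA EFinM; apply: lee_wpmul2l => //.
apply: (@le_trans _ _ ((2 * 2 `^ s)%:E * U)%E); last first.
  by rewrite (mulrA 2) [leRHS]EFinM; apply: lee_wpmul2l.
apply: (le_trans L2).
have U_fin : (U < +oo)%E by exact: le_lt_trans UK (ltry _).
move: (powR_ge0 2 s) (powR_ge0 d s) U0 U_fin (P0 h) (P0 A) h_fin HA L1 cd.
(* Only the case of finite values survives. With [y = Lint s h], [x = Lint s A] and [z = U], the
   hypotheses give [a * b * x <= y / 2], hence [y <= 2 * a * z]. The bound for [g] involves the same
   [x], which explains the factor [2]. *)
rewrite -/A; move: (Lint s h) (Lint s A) (U) (2 `^ s) (d `^ s).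
move=> [y| |]// [x| |]// [z| |]// a b.
rewrite -?EFinM -?EFinD -?EFinM !lee_fin.
move=> a0 b0 z0 _ y0 x0 _ xy yab cab.
have H2 : a * b * x <= a * b * (c * y) by apply: ler_wpM2l => //; exact: mulr_ge0.
have H3 : c * a * b * y <= 2^-1 * y by exact: ler_wpM2r.
nra.
Qed.

End KreinRemainder.

(** * From norms of the weight to pointwise bounds *)

Section Smallness.
Context {R : realType}.
Local Notation mu := (@lebesgue_measure R).
Local Notation Re := complex.Re.
Local Notation Im := complex.Im.
Local Notation normc := Normc.normc.

Lemma japanese_ge1 (x : R) : 1 <= japanese x.
Proof. by rewrite /japanese -{1}sqrtr1 ler_sqrt ?lerDl ?sqr_ge0// addr_ge0 ?sqr_ge0. Qed.

Lemma le_norm_japanese (x : R) : `|x| <= japanese x.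
Proof. by rewrite /japanese -sqrtr_sqr ler_sqrt ?lerDr// addr_ge0 ?sqr_ge0. Qed.

Lemma measurable_japanese : measurable_fun setT (@japanese R).
Proof.
apply: continuous_measurable_fun => x.
apply: (@continuous_comp R R R (fun x => 1 + x ^+ 2) Num.sqrt); last exact: sqrt_continuous.
by apply: cvgD; [exact: cvg_cst|exact: exprn_continuous].
Qed.

Lemma inv_2pi : 0 <= (2 * pi : R)^-1 <= 1.
Proof.
have p2 := @pi_ge2 R; apply/andP; split; first by rewrite invr_ge0; lra.
by rewrite invf_le1; lra.
Qed.

(* [v] is [w - 1], replaced by [0] on the null set where the weighted bound
   fails, so that the bound holds everywhere. *)
Lemma small_weight_density (w : R -> R) (k : nat) (K d : R) : 0 < d -> weight w ->
  ('N[mu]_1[EFin \o weighted_dev k w] <= K%:E)%E ->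
  ('N[mu]_+oo[EFin \o weighted_dev k w] <= d%:E)%E ->
  exists v : R -> R, [/\ rint v, rint (fun x => `|v x| * japanese x ^+ k),
    forall x, `|v x| * japanese x ^+ k <= d,
    (\int[mu]_x (`|v x| * japanese x ^+ k)%:E <= K%:E)%E &
    forall x, krein_H w x = ((2 * pi)^-1)%:C * fourier (fun l => (v l)%:C) (- x)].
Proof.
move=> d0 [mw w0]; rewrite Lnorm1 => N1 Noo.
have j0 x : 0 <= japanese x ^+ k :> R by rewrite exprn_ge0 ?sqrtr_ge0.
have j1 x : 1 <= japanese x ^+ k :> R by rewrite exprn_ege1 ?japanese_ge1.
have mjk : measurable_fun setT (fun x : R => japanese x ^+ k).
  by apply: measurable_funX; exact: measurable_japanese.
have mdev : measurable_fun setT (weighted_dev k w).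
  by apply: measurable_funM => //; apply: measurable_funB.
have devE x : `|weighted_dev k w x| = `|w x - 1| * japanese x ^+ k.
  by rewrite /weighted_dev normrM (ger0_norm (j0 x)).
have aed : {ae mu, forall x, `|weighted_dev k w x| <= d}.
  move: Noo; rewrite unlock /Lnorm.
  (* The norm with exponent [+oo] unfolds to an essential supremum only when the measure is not
     zero. *)
  have -> : (0 < mu setT)%E by rewrite -set_itvNyy lebesgue_measure_itv ltry.
  by move=> /ess_supP H; apply: (ae_imp H) => x /=; rewrite lee_fin.
pose S : set R := (fun x => `|weighted_dev k w x|) @^-1` `]-oo, d].
have mS : measurable S.
  have mn : measurable_fun setT (fun x => `|weighted_dev k w x|) by exact: measurableT_comp.
  by rewrite /S -[_ @^-1` _]setTI; apply: mn.
pose v x : R := \1_S x * (w x - 1).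
have mv : measurable_fun setT v.
  by apply: measurable_funM; [exact: measurable_indic|exact: measurable_funB].
have vle x : `|v x| * japanese x ^+ k <= `|weighted_dev k w x|.
  rewrite devE; apply: ler_wpM2r => //; rewrite /v normrM ler_piMl// indicE.
  by case: (x \in S); rewrite ?normr1// normr0.
have idev : rint (weighted_dev k w).
  apply/integrableP; split; first exact/measurable_EFinP.
  exact: le_lt_trans N1 (ltry _).
have mu_ : measurable_fun setT (fun x => `|v x| * japanese x ^+ k).
  by apply: measurable_funM => //; exact: measurableT_comp.
have iu : rint (fun x => `|v x| * japanese x ^+ k).
  apply: (rint_le mu_ (rint_norm idev)) => x.
  by rewrite ger0_norm ?mulr_ge0//; exact: vle.
exists v; split => //.
- apply: (rint_le mv iu) => x.
  by rewrite -{1}[`|v x|]mulr1; apply: ler_wpM2l.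
- move=> x; have [xS|xS] := boolP (x \in S).
    apply: (le_trans (vle x)); by move: xS; rewrite inE /S/= in_itv.
  by rewrite /v indicE (negbTE xS) mul0r normr0 mul0r ltW.
- apply: le_trans N1; apply: le_int => //.
  + by apply: measurableT_comp.
  + by move=> x; rewrite mulr_ge0.
move=> x; rewrite /krein_H /fourier; congr (_ * _).
apply: ae_eq_Cintegral.
- apply: CmeasM; first by apply: CmeasR; exact: measurable_funB.
  by apply: Cmeas_expi; exact: measurable_funM.
- apply: CmeasM; first exact: CmeasR.
  by apply: Cmeas_expi; apply: measurable_funN; exact: measurable_funM.
apply: (ae_imp aed) => y yd; congr (_ * _); last by rewrite mulrN opprK.
rewrite /v indicE mem_set ?mul1r// /S/= in_itv/=; exact: yd.
Qed.

(** Here [h] is the density of the row and [g] its multiple by the power [k] of [- i l]. If there is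
    no kernel, both are zero, so the later estimates need no case distinction. *)
Lemma krein_remainder_density (w v : R -> R) (k : nat) (r d : R) :
  0 < r -> rint v -> rint (fun x => `|v x| * japanese x ^+ k) ->
  (forall x, `|v x| * japanese x ^+ k <= d) ->
  (forall x, krein_H w x = ((2 * pi)^-1)%:C * fourier (fun l => (v l)%:C) (- x)) ->
  exists h g : R -> R[i], [/\ Cint h, Cint g,
    forall x, normc (h x) <= `|v x| * japanese x ^+ k * (1 + normc (fproj r h x)),
    forall x, normc (g x) <= `|v x| * japanese x ^+ k * (1 + normc (fproj r h x)) &
    forall l, normc (krein_remainder w k r l) = normc (fproj r g l)].
Proof.
move=> r0 iv iu ud Hw.
have j0 x n : 0 <= japanese x ^+ n :> R by rewrite exprn_ge0 ?sqrtr_ge0.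
have c0 : Cint (fun=> 0 : R[i]) by split; exact: integrable0.
have [[G HG]|nG] := pselect (exists G, is_krein_kernel w r G); last first.
  exists (fun=> 0), (fun=> 0); split => // [x|x|l].
  - by rewrite Normc.normc0 mulr_ge0 ?mulr_ge0 ?addr_ge0 ?normc_ge0.
  - by rewrite Normc.normc0 mulr_ge0 ?mulr_ge0 ?addr_ge0 ?normc_ge0.
  rewrite (krein_remainder_default _ _ nG) /fproj; congr (normc _).
  rewrite -[LHS](@Cintegral0 _ `[0, r]); apply: eq_Cintegral => t _.
  by rewrite /fourier; under eq_fun do rewrite mul0r; rewrite Cintegral0 mul0r.
have HGam : is_krein_kernel w r (krein_Gamma w r).
  by rewrite /krein_Gamma; case: xgetP => [G' _ //|/(_ G)]; case.
have [h [ih GE hE]] := krein_row_fourier r0 iv Hw HGam.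
have hle x : normc (h x) <= `|v x| * (1 + normc (fproj r h x)).
  rewrite {1}hE 2!Normc.normcM !normcR.
  have /andP[c1 c2] := inv_2pi; rewrite (ger0_norm c1).
  apply: (@le_trans _ _ (1 * (`|v x| * normc (expi (x * r) - fproj r h x)))).
    by apply: ler_wpM2r => //; rewrite mulr_ge0 ?normc_ge0.
  rewrite mul1r; apply: ler_wpM2l => //.
  by apply: (le_trans (normcB _ _)); rewrite normc_expi.
(* All orders [j <= k] are covered, because [Cderive1n_fourier] differentiates one order at a time
   and needs each intermediate density to be integrable. *)
have gle j x : (j <= k)%N ->
    normc (fourier_mult j h x) <= `|v x| * japanese x ^+ k * (1 + normc (fproj r h x)).
  move=> jk; rewrite /fourier_mult Normc.normcM normcX.
  have -> : normc (0 +i* (- x)) = `|x| by rewrite /Normc.normc/= expr0n/= add0r sqrrN sqrtr_sqr.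
  apply: (@le_trans _ _ (japanese x ^+ k * (`|v x| * (1 + normc (fproj r h x))))).
    apply: ler_pM; [exact: exprn_ge0|exact: normc_ge0| |exact: hle].
    apply: (@le_trans _ _ (japanese x ^+ j)).
      by rewrite lerXn2r ?nnegrE ?sqrtr_ge0// le_norm_japanese.
    by rewrite ler_weXn2l// japanese_ge1.
  by rewrite mulrCA mulrA.
have igk j : (j <= k)%N -> Cint (fourier_mult j h).
  move=> jk; pose M := r * \int[mu]_x normc (h x).
  apply: (Cint_le _ (rintZ (1 + M) iu)).
    apply: CmeasM; last exact: Cint_meas.
    apply: CmeasX; split => /=; first exact: measurable_cst.
    exact: measurable_funN.
  move=> x; apply: (le_trans (gle j x jk)); rewrite mulrC; apply: ler_wpM2r.
    by rewrite mulr_ge0.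
  rewrite lerD2l; exact: normc_fproj.
exists h, (fourier_mult k h); split => //.
- exact: igk.
- move=> x; have := gle 0%N x (leq0n k); by rewrite /fourier_mult expr0 mul1r.
- by move=> x; exact: gle.
- by move=> l; exact: krein_remainder_fproj.
Qed.

End Smallness.

(** * Choice of constants and exponents *)

Section Conclusion.
Context {R : realType}.
Local Notation mu := (@lebesgue_measure R).
Local Notation normc := Normc.normc.

Lemma small_powR_pair (s Q K e : R) : 1 < s -> 0 <= Q -> 0 < e ->
  exists2 d0 : R, 0 < d0 & forall d, 0 < d <= d0 ->
    Q * d `^ s <= 2^-1 /\ 2 * Q * d `^ (s - 1) * K <= e.
Proof.
move=> s1 Q0 e0; have s0 : 0 < s - 1 by rewrite subr_gt0.
(* The summands [1] keep the denominators positive when [Q] or [K] vanishes, and [|K|] is used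
   because [K] carries no sign. Requiring [d <= 1] below makes [d]^ s[at most]d [^ (s - 1)]. *)
pose t := Num.min (e / (2 * Q * `|K| + 1)) (1 / (2 * Q + 1)).
have a1 : 0 < 2 * Q * `|K| + 1 by rewrite ltr_wpDl// mulr_ge0// mulr_ge0.
have a2 : 0 < 2 * Q + 1 by rewrite ltr_wpDl// mulr_ge0.
have t0 : 0 < t by rewrite /t lt_min !divr_gt0.
exists (Num.min 1 (t `^ (s - 1)^-1)); first by rewrite lt_min ltr01 powR_gt0.
move=> d /andP[d0]; rewrite le_min => /andP[d1 dt].
have dst : d `^ (s - 1) <= t.
  apply: (@le_trans _ _ ((t `^ (s - 1)^-1) `^ (s - 1))).
    by apply: ge0_ler_powR; rewrite ?nnegrE ?powR_ge0// ltW.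
  by rewrite -powRrM mulVf ?gt_eqF// powRr1// ltW.
have ds : d `^ s <= d `^ (s - 1).
  rewrite -(mulr_powRB1 (ltW d0) (lt_trans ltr01 s1)) ler_piMl ?powR_ge0//.
have p0 := powR_ge0 d (s - 1); have p1 := powR_ge0 d s.
move: dst; rewrite /t le_min !ler_pdivlMr// => /andP[t1 t2].
move: (d `^ (s - 1)) (d `^ s) p0 p1 ds t1 t2 => y x y0 x0 xy t1 t2.
split; first by nra.
have : 2 * Q * y * K <= 2 * Q * y * `|K| by apply: ler_wpM2l; rewrite ?ler_norm// !mulr_ge0.
by nra.
Qed.

(** The threshold [d0] precedes [w] and [r], which gives the uniformity in both. Measurability is
    returned too, as it is visible only through the density [g]. *)
Lemma Lint_krein_remainder (s K e : R) (k : nat) : 1 < s -> riesz_exponent s -> 0 < e ->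
  exists2 d0 : R, 0 < d0 & forall d, 0 < d <= d0 ->
    forall (w : R -> R) (r : R), 0 < r -> weight w ->
    ('N[mu]_1[EFin \o weighted_dev k w] <= K%:E)%E ->
    ('N[mu]_+oo[EFin \o weighted_dev k w] <= d%:E)%E ->
    measurable_fun setT (fun l => normc (krein_remainder w k r l)) /\
    (Lint s (krein_remainder w k r) <= e%:E)%E.
Proof.
move=> s1 [c c0 Hc] e0.
have Q0 : 0 <= c * 2 `^ s by rewrite mulr_ge0 ?powR_ge0.
have [d0 d0_gt0 Hd] := small_powR_pair K s1 Q0 e0.
exists d0 => // d dd w r r0 ww N1 Noo.
have d_gt0 : 0 < d by have /andP[] := dd.
have [H1 H2] := Hd d dd.
have [v [iv iu ud uK Hw]] := small_weight_density d_gt0 ww N1 Noo.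
have [h [g [ih ig hu gu RE]]] := krein_remainder_density r0 iv iu ud Hw.
have mg := Cmeas_fproj r ig.
split; first by rewrite (funext RE); exact: Cmeas_normc.
have -> : Lint s (krein_remainder w k r) = Lint s (fproj r g).
  by apply: eq_integral => l _; rewrite RE.
have u0d x : 0 <= `|v x| * japanese x ^+ k <= d.
  by rewrite ud andbT mulr_ge0// exprn_ge0// sqrtr_ge0.
apply: (le_trans (fixed_point_Lint s1 c0 Hc r0 iu u0d uK ih ig hu gu H1)).
by rewrite lee_fin (mulrCA c).
Qed.

Lemma conjugate_even_exponent (p : R) : 1 < p ->
  exists m : nat, exists s : R, [/\ (0 < m)%N, 1 < (2 * m)%:R :> R, p <= (2 * m)%:R &
    [/\ 1 < s, s <= p & s^-1 + (2 * m)%:R^-1 = 1]].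
Proof.
move=> p1; have p0 : 0 < p - 1 by rewrite subr_gt0.
(* An even number above both [p] and its conjugate exponent: being above [p / (p - 1)] means exactly
   that the conjugate of [2 * m] is at most [p]. *)
pose x := p + p / (p - 1).
have q0 : 0 < p / (p - 1) by rewrite divr_gt0//; lra.
have x0 : 0 <= x by rewrite /x; lra.
have := archi_boundP x0; set m := Num.bound x => xm.
have S1 : x <= (2 * m)%:R by rewrite natrM; lra.
have Sp : p <= (2 * m)%:R by rewrite /x in S1; lra.
have Sq : p <= (2 * m)%:R * (p - 1) by rewrite -ler_pdivrMr//; rewrite /x in S1; lra.
have m0 : (0 < m)%N by rewrite lt0n; apply/eqP => m0; rewrite m0 in xm; lra.
exists m, ((2 * m)%:R / ((2 * m)%:R - 1)).
clear S1 xm; clearbody m; move: ((2 * m)%:R : R) Sp Sq => S Sp Sq.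
have Sm : 0 < S - 1 by lra.
split => //; first lra; split.
- by rewrite ltr_pdivlMr//; lra.
- by rewrite ler_pdivrMr//; lra.
by field; rewrite ?gt_eqF//; lra.
Qed.

(** Small values are controlled by the lower power and large ones by the higher power. Since
    smallness is known at both exponents, this pointwise bound takes the place of operator
    interpolation. *)
Lemma powR_between (a s p q : R) : 0 <= a -> 0 < s -> s <= p -> p <= q ->
  a `^ p <= a `^ s + a `^ q.
Proof.
move=> a0 s0 sp pq; have [a1|a1] := leP 1 a.
  by apply: (le_trans (ler_powR a1 pq)); rewrite lerDr powR_ge0.
have [->|an0] := eqVneq a 0.
  by rewrite powR0 ?addr_ge0 ?powR_ge0// gt_eqF// (lt_le_trans s0).
have aI : 0 < a <= 1 by rewrite lt0r an0 a0 ltW.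
by apply: (le_trans (ger_powR aI sp)); rewrite lerDl powR_ge0.
Qed.

End Conclusion.

Local Open Scope ereal_scope.

Theorem mainTheorem7 (R : realType) (C : R) (k : nat) (p : R) (hp : (1 < p)%R) :
  forall eta : R, (0 < eta)%R ->
  exists2 delta : R, (0 < delta)%R &
    forall w : R -> R, weight w ->
      'N[lebesgue_measure]_1[EFin \o weighted_dev k w] <= C%:E ->
      'N[lebesgue_measure]_+oo[EFin \o weighted_dev k w] <= delta%:E ->
      ereal_sup [set 'N[lebesgue_measure]_(p%:E)[EFin \o
                       (fun l : R => Normc.normc (krein_remainder w k r l))]
                | r in [set r : R | (0 < r)%R]] <= eta%:E.
Proof.
move=> eta eta0.
have [m [s [m0 S1 pS [s1 sp sS]]]] := conjugate_even_exponent hp.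
have p0 : (0 < p)%R by exact: lt_trans hp.
have e0 : (0 < eta `^ p / 2)%R by rewrite divr_gt0// powR_gt0.
have rS : riesz_exponent ((2 * m)%:R : R) := @riesz_even R m m0.
have rs : riesz_exponent s := riesz_dual S1 s1 sS rS.
have [d1 d1_gt0 H1] := Lint_krein_remainder C k s1 rs e0.
have [d2 d2_gt0 H2] := Lint_krein_remainder C k S1 rS e0.
have d_gt0 : (0 < Num.min d1 d2)%R by rewrite lt_min d1_gt0.
exists (Num.min d1 d2) => // w ww N1 Noo; apply: ge_ereal_sup => _ [r /= r0 <-].
have I1 : (0 < Num.min d1 d2 <= d1)%R by rewrite d_gt0 ge_min lexx.
have I2 : (0 < Num.min d1 d2 <= d2)%R by rewrite d_gt0 ge_min lexx orbT.
have [mR L1] := H1 _ I1 w r r0 ww N1 Noo.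
have [_ L2] := H2 _ I2 w r r0 ww N1 Noo.
rewrite unlock /Lnorm.
have -> : (fun x => `|(EFin \o (fun l : R => Normc.normc (krein_remainder w k r l))) x| `^ p) =
    (fun x => (Normc.normc (krein_remainder w k r x) `^ p)%:E).
  by apply/funext => x /=; rewrite ger0_norm ?normc_ge0.
have mpow (t : R) : measurable_fun setT (fun x => (Normc.normc (krein_remainder w k r x) `^ t)%R).
  exact: (measurableT_comp (measurable_powR t)).
have B : \int[lebesgue_measure]_x (Normc.normc (krein_remainder w k r x) `^ p)%:E <= (eta `^ p)%:E.
  apply: (@le_trans _ _ (1%:E * (Lint s (krein_remainder w k r) + Lint (2 * m)%:R (krein_remainder w k r)))).
    apply: le_int_lin; [exact: mpow|exact: mpow|exact: mpow|exact: ler01| | | |].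
    - by move=> x; exact: powR_ge0.
    - by move=> x; exact: powR_ge0.
    - by move=> x; exact: powR_ge0.
    - by move=> x; rewrite mul1r; apply: powR_between => //; [exact: normc_ge0|exact: lt_trans s1].
  by rewrite mul1e (splitr (powR eta p)) EFinD; exact: leeD L1 L2.
have etaE : eta%:E = ((eta `^ p)%:E `^ p^-1)%E.
  by rewrite poweR_EFin -powRrM mulfV ?gt_eqF// powRr1// ltW.
rewrite etaE; apply: gt0_ler_poweR => //.
- by rewrite invr_ge0 ltW.
- by rewrite in_itv/= leey andbT; apply: integral_ge0 => x _; rewrite lee_fin powR_ge0.
- by rewrite in_itv/= leey andbT lee_fin powR_ge0.
Qed.
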